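(* The multitime correlation function is given by a quaternion determinant: $$ \rho^T_N \left(t_{1}, \xi^{N_1}_1; \dots; t_{M+1}, \xi^{N_{M+1}}_{M+1} \right) = {\rm Tdet}\, Q \left({\bf x}^{(1)}_{N_1},{\bf x}^{(2)}_{N_2},\dots, {\bf x}^{(M+1)}_{N_{M+1}} \right). $$
   Context: Setting. $N$ is an even positive integer, $T>0$, $M\ge 1$, and $0=t_0<t_1<\dots<t_M<t_{M+1}=T$. Let $p_t(x,y)=\frac{1}{\sqrt{2\pi t}}e^{-(x-y)^2/2t}$ for $t>0$, with the convention $p_0(y,x)\,dy=\delta_x(dy)$. Let ${\bf R}^N_<=\{{\bf x}\in{\bf R}^N: x_1<\dots<x_N\}$, $h_N({\bf x})=\prod_{1\le i<j\le N}(x_j-x_i)$, and $C(N,T,t)=\pi^{N/2}\big(\prod_{j=1}^N\Gamma(j/2)\big)^{-1}T^{N(N-1)/4}t^{-N(N-1)/2}$. For ${\bf x}^{(m)}_N=(x^{(m)}_1,\dots,x^{(m)}_N)$, $1\le m\le M+1$, write ${\bf x}^{(m)}_{N'}=(x^{(m)}_1,\dots,x^{(m)}_{N'})$ and $\xi^{N'}_m=\{x^{(m)}_i\}_{i=1}^{N'}$. The multitime transition density of $N$ Brownian motions started at the origin and conditioned not to collide on $[0,T]$ is $$\rho_N^T(t_1,\xi^N_1;\dots;t_{M+1},\xi^N_{M+1})=C(N,T,t_1)\,h_N({\bf x}^{(1)}_N)\,{\rm sgn}\big(h_N({\bf x}^{(M+1)}_N)\big)\prod_{i=1}^N p_{t_1}(0,x^{(1)}_i)\prod_{m=1}^M\det_{1\le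 i,j\le N}\big(p_{t_{m+1}-t_m}(x^{(m)}_i,x^{(m+1)}_j)\big),$$ and for positive integers $N_m\le N$ the $(N_1,\dots,N_{M+1})$-multitime correlation function is $$\rho_N^T(t_1,\xi^{N_1}_1;\dots;t_{M+1},\xi^{N_{M+1}}_{M+1})=\int_{\prod_m{\bf R}^{N-N_m}}\prod_{m=1}^{M+1}\frac{1}{(N-N_m)!}\prod_{i=N_m+1}^N dx^{(m)}_i\;\rho_N^T(t_1,\xi^N_1;\dots;t_{M+1},\xi^N_{M+1}).$$ Ingredients. For $1\le m,n\le M+1$, $F^{m,n}(x,y)=\int_{-\infty}^{\infty}dw\int_{-\infty}^{w}dz\,\big[p_{T-t_m}(x,z)p_{T-t_n}(y,w)-p_{T-t_m}(x,w)p_{T-t_n}(y,z)\big]$. Let $c_1=\sqrt{t_1(2T-t_1)/T}$, $z_1=\sqrt{(2T-t_1)/t_1}$, $H_j$ the Hermite polynomials, and $\alpha_{kj}=2^{-k}c_1^k\delta_{kj}$ for $k$ even, $\alpha_{kj}=2^{-k}c_1^k\{\delta_{kj}-2(k-1)\delta_{k-2,j}\}$ for $k$ odd. Define the monic polynomials $R_k(x)=z_1^{-k}\sum_{j=0}^k\alpha_{kj}H_j(x/c_1)z_1^j$, $r_j=\frac{\Gamma(j+\frac12)\Gamma(j+1)}{\pi}\big(\frac{t_1^2}{T}\big)^{2j+1/2}$, $R^{(m)}_k(x)=\int_{\bf R}dy\,R_k(y)p_{t_1}(0,y)p_{t_m-t_1}(y,x)$, and $\Phi^{(m)}_k(x)=\int_{\bf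 R}dy\,R^{(m)}_k(y)F^{m,m}(y,x)$. Set $D^{m,n}(x,y)=\sum_{k=0}^{N/2-1}\frac{1}{r_k}[R^{(m)}_{2k}(x)R^{(n)}_{2k+1}(y)-R^{(m)}_{2k+1}(x)R^{(n)}_{2k}(y)]$, $I^{m,n}(x,y)=-\sum_{k=0}^{N/2-1}\frac{1}{r_k}[\Phi^{(m)}_{2k}(x)\Phi^{(n)}_{2k+1}(y)-\Phi^{(m)}_{2k+1}(x)\Phi^{(n)}_{2k}(y)]$, $S^{m,n}(x,y)=\sum_{k=0}^{N/2-1}\frac{1}{r_k}[\Phi^{(m)}_{2k}(x)R^{(n)}_{2k+1}(y)-\Phi^{(m)}_{2k+1}(x)R^{(n)}_{2k}(y)]$, $\tilde S^{m,n}(x,y)=S^{m,n}(x,y)-p_{t_n-t_m}(x,y)1(m<n)$, $\tilde I^{m,n}(x,y)=I^{m,n}(x,y)+F^{m,n}(x,y)$. Quaternions $q=q_0+q_1e_1+q_2e_2+q_3e_3$ are represented by $2\times2$ complex matrices via $C(1)=I$, $C(e_1)=\begin{pmatrix}0&-1\\1&0\end{pmatrix}$, $C(e_2)=\begin{pmatrix}0&-\sqrt{-1}\\-\sqrt{-1}&0\end{pmatrix}$, $C(e_3)=\begin{pmatrix}\sqrt{-1}&0\\0&-\sqrt{-1}\end{pmatrix}$. Let $q^{m,n}(x,y)$ be the quaternion with $C(q^{m,n}(x,y))=\begin{pmatrix}\tilde S^{m,n}(x,y)&\tilde I^{m,n}(x,y)\\ D^{m,n}(x,y)&\tilde S^{n,m}(y,x)\end{pmatrix}$,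 and let $Q({\bf x}^{(1)}_{N_1},\dots,{\bf x}^{(M+1)}_{N_{M+1}})$ be the self-dual $\sum_m N_m\times\sum_m N_m$ quaternion matrix with blocks $\big(q^{m,n}(x^{(m)}_i,x^{(n)}_j)\big)_{1\le i\le N_m,1\le j\le N_n}$. For an $N\times N$ self-dual quaternion matrix $Q=(q_{ab})$, Dyson's quaternion determinant is ${\rm Tdet}\,Q=\sum_{\pi\in S_N}(-1)^{N-\ell(\pi)}\prod_1^{\ell(\pi)}q_{ab}q_{bc}\cdots q_{da}$, where $\ell(\pi)$ is the number of cycles $(a\to b\to\cdots\to d\to a)$ of $\pi$. *)

(* Defs.v *)
From HB Require Import structures.
From mathcomp Require Import all_boot all_order all_algebra all_fingroup.
From mathcomp Require Import all_classical all_reals all_analysis.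
Set Implicit Arguments. Unset Strict Implicit. Unset Printing Implicit Defensive.
Import Order.TTheory GRing.Theory Num.Theory.
Import numFieldNormedType.Exports.
Local Open Scope classical_set_scope.
Local Open Scope ring_scope.

Section Defs.
Context {R : realType}.

Definition Leb (f : R -> R) : R := \int[(@lebesgue_measure R)]_(x in setT) f x.

Definition Gamma (s : R) : R :=
  \int[(@lebesgue_measure R)]_(x in `]0, +oo[) (x `^ (s - 1) * expR (- x)).

Definition pk (t x y : R) : R :=
  (Num.sqrt (2 * pi * t))^-1 * expR (- ((x - y) ^+ 2) / (2 * t)).

(* integration against p_t(x, y) dy, with the convention p_0(x,y) dy = delta_x(dy) *)
Definition heat (t x : R) (f : R -> R) : R :=
  if t == 0 then f x else Leb (fun y => pk t x y * f y).

Fixpoint hermite2 (n : nat) : {poly R} * {poly R} :=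
  match n with
  | 0 => (1, 0)
  | n'.+1 => let (h, hm) := hermite2 n' in
             ((2%:R *: 'X) * h - (2 * n'%:R) *: hm, h)
  end.
(* hermite2 n = (H_n, H_{n-1}) with H_{-1} = 0: H_0 = 1, H_{n+1} = 2x H_n - 2n H_{n-1} *)
Definition hermite (n : nat) : {poly R} := (hermite2 n).1.

Definition hN (N : nat) (x : 'I_N -> R) : R :=
  \prod_(i < N) \prod_(j < N | (i < j)%N) (x j - x i).

(* Dyson's quaternion determinant, quaternions represented as 2x2 matrices
   (C(1) = I, C(e_i) traceless, so the scalar part of q is tr(C(q))/2). *)
Definition cycle_scal (I : finType) (Q : I -> I -> 'M[R]_2) (s : {perm I})
  (c : {set I}) : R :=
  match [pick a in c] with
  | Some a => (\tr (\prod_(k < #|c|) Q (iter k s a) (iter k.+1 s a))) / 2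
  | None => 1
  end.

Definition Tdet (I : finType) (Q : I -> I -> 'M[R]_2) : R :=
  \sum_(s : {perm I})
     (-1) ^+ (#|I| - #|porbits s|) * \prod_(c in porbits s) cycle_scal Q s c.

Fixpoint iint (n : nat) (f : (nat -> R) -> R) : R :=
  match n with
  | 0 => f (fun _ => 0)
  | n'.+1 => Leb (fun x => iint n' (fun v => f (fun k => if k is k'.+1 then v k' else x)))
  end.

Variables (N : nat) (T : R) (M : nat) (t : nat -> R).
(* times t 0 = 0 < t 1 < ... < t M.+1 = T *)

Definition Cnorm (s : R) : R :=
  pi `^ (N%:R / 2) * (\prod_(j < N) Gamma (j.+1%:R / 2))^-1
  * T `^ ((N * N.-1)%:R / 4) * s `^ (- ((N * N.-1)%:R / 2)).

(* multitime transition density; x m i = x^{(m)}_{i+1}, m = 1..M+1 *)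
Definition density (x : nat -> 'I_N -> R) : R :=
  Cnorm (t 1) * hN (x 1%N) * Num.sg (hN (x M.+1))
  * \prod_(i < N) pk (t 1) 0 (x 1%N i)
  * \prod_(m < M) \det (\matrix_(i < N, j < N) pk (t m.+2 - t m.+1) (x m.+1 i) (x m.+2 j)).

(* Nm m = N_m; xs m i = x^{(m)}_{i+1} for i < N_m *)
Definition offs (Nm : nat -> nat) (m : nat) : nat := \sum_(1 <= m' < m) (N - Nm m').

Definition fullconf (Nm : nat -> nat) (xs : nat -> nat -> R) (z : nat -> R)
  (m : nat) (i : 'I_N) : R :=
  if (i < Nm m)%N then xs m i else z (offs Nm m + (i - Nm m))%N.

Definition corr (Nm : nat -> nat) (xs : nat -> nat -> R) : R :=
  (\prod_(1 <= m < M.+2) ((N - Nm m)`!)%:R)^-1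
  * iint (offs Nm M.+2) (fun z => density (fullconf Nm xs z)).

Definition F (m n : nat) (x y : R) : R :=
  heat (T - t m) x (fun z => heat (T - t n) y (fun w => (z <= w)%R%:R))
  - heat (T - t m) x (fun w => heat (T - t n) y (fun z => (z <= w)%R%:R)).

Definition c1 : R := Num.sqrt (t 1 * (2 * T - t 1) / T).
Definition z1 : R := Num.sqrt ((2 * T - t 1) / t 1).

Definition alpha (k j : nat) : R :=
  if odd k then 2^-k * c1 ^+ k * ((k == j)%:R - 2 * k.-1%:R * (j.+2 == k)%:R)
  else 2^-k * c1 ^+ k * (k == j)%:R.

Definition Rk (k : nat) (x : R) : R :=
  z1 ^- k * \sum_(j < k.+1) alpha k j * (hermite j).[x / c1] * z1 ^+ j.

Definition rj (j : nat) : R :=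
  Gamma (j%:R + 2^-1) * Gamma (j%:R + 1) / pi * (t 1 ^+ 2 / T) `^ (2 * j%:R + 2^-1).

Definition Rm (m k : nat) (x : R) : R := heat (t m - t 1) x (fun y => Rk k y * pk (t 1) 0 y).

Definition Phi (m k : nat) (x : R) : R := Leb (fun y => Rm m k y * F m m y x).

Definition Dk (m n : nat) (x y : R) : R :=
  \sum_(k < N./2) (rj k)^-1 * (Rm m k.*2 x * Rm n k.*2.+1 y - Rm m k.*2.+1 x * Rm n k.*2 y).
Definition Ik (m n : nat) (x y : R) : R :=
  - \sum_(k < N./2) (rj k)^-1 * (Phi m k.*2 x * Phi n k.*2.+1 y - Phi m k.*2.+1 x * Phi n k.*2 y).
Definition Sk (m n : nat) (x y : R) : R :=
  \sum_(k < N./2) (rj k)^-1 * (Phi m k.*2 x * Rm n k.*2.+1 y - Phi m k.*2.+1 x * Rm n k.*2 y).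
Definition St (m n : nat) (x y : R) : R := Sk m n x y - pk (t n - t m) x y * (m < n)%N%:R.
Definition It (m n : nat) (x y : R) : R := Ik m n x y + F m n x y.

Definition qmat (m n : nat) (x y : R) : 'M[R]_2 :=
  \matrix_(a < 2, b < 2)
    (if a == 0 :> nat then (if b == 0 :> nat then St m n x y else It m n x y)
     else (if b == 0 :> nat then Dk m n x y else St n m y x)).

(* index set of Q: pairs (m, i), m = 1..M+1 (stored as m-1), i < N_m *)
Definition Qidx (Nm : nat -> nat) := {m : 'I_M.+1 & 'I_(Nm m.+1)}.

Definition Qmat (Nm : nat -> nat) (xs : nat -> nat -> R) (u v : Qidx Nm) : 'M[R]_2 :=
  qmat (tag u).+1 (tag v).+1 (xs (tag u).+1 (tagged u)) (xs (tag v).+1 (tagged v)).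

End Defs.

Arguments Qmat {R} N T M t Nm xs u v.
Arguments Qidx M Nm.

(* Main.v *)
Require Import Defs.
From HB Require Import structures.
From mathcomp Require Import all_boot all_order all_algebra all_fingroup.
From mathcomp Require Import all_classical all_reals all_analysis.
From mathcomp Require Import measurable_realfun.
From mathcomp Require Import ring lra zify.
Set Implicit Arguments. Unset Strict Implicit. Unset Printing Implicit Defensive.
Import Order.TTheory GRing.Theory Num.Theory.
Local Open Scope ring_scope.

(** The whole process is encoded in one Pfaffian. Each particle [(m, x)] gets two indices,
    [inr (true, (m, x))] and [inr (false, (m, x))], and there are [N] border indices [inl k], one
    for each polynomial [R_k]. The antisymmetric kernel [KA] pairs border indices through the skew
    inner products of the [R_k], border and particle indices through [R^{(m)}_k] and [Phi^{(m)}_k],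
    and particle indices through [F] and the heat kernel.

    Density as a Pfaffian ([density_pfB]): the [true] indices of level 1 meet nonzero entries only
    at the border, and those of level [m+1] then only at the [false] indices of level [m]. The
    Pfaffian thus factors into a determinant of monic polynomials (a Vandermonde product times
    Gaussians), the transition determinants, and the Pfaffian of [sgn(x_j - x_i)] at time [T], which
    equals [sgn h_N] for even [N] ([pf_sg]).

    Integration ([Leb_pfB]): the entries of [KA] reproduce under convolution, because [p_t] is a
    semigroup and [F] is a heat-smoothed sign. Expanding along the two indices of a particle at
    level [m] and integrating its position multiplies the Pfaffian of the other particles by [N]
    minus the number of them at level [m] ([EE_diff], [rsum_rsum_pf]). Integrating all hidden
    particles produces the product of the [(N - N_m)!], which the definition of the correlation
    function divides out.

    Elimination of the border ([pfB_schur]): the [R_k] are skew-orthogonal with norms [r_k]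
    ([gram_Rpoly], [gramR_rj]), so removing border indices two at a time by Schur complements
    releases the product of the [r_k], cancelled by [C(N,T,t_1)] ([Cnorm_rj]). The kernel that
    remains has as entries exactly [D], [S~] and [I~] up to sign.

    Quaternions ([TdS_pf]): the Pfaffian of a kernel on pairs of indices is Dyson's determinant of
    the matrix of its 2x2 blocks, with the columns twisted by the symplectic form. *)

(** * Alternating sums over the extraction of an entry from a list *)

Section SignedRemoval.
Variables (T : eqType) (R : comNzRingType).
Implicit Types (g : T -> seq T -> R) (s r : seq T).

(* Alternating sum over the ways to extract one entry [u] of [s], leaving [r]. *)
Fixpoint rsum g s : R :=
  if s is u :: s' then g u s' - rsum (fun v r => g v (u :: r)) s' else 0.

Lemma eq_rsum_subseq g g' s :
  (forall u r, perm_eq s (u :: r) -> subseq r s -> g u r = g' u r) ->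
  rsum g s = rsum g' s.
Proof.
elim: s g g' => //= w s IH g g' H; rewrite (H w s) //; last exact: subseq_cons.
congr (_ - _).
apply: IH => v r pr sb; apply: H; last by rewrite /= eqxx.
by rewrite (perm_trans (y := w :: v :: r)) ?perm_cons // (perm_catCA [:: w] [:: v]).
Qed.

Lemma eq_rsum_perm g g' s :
  (forall u r, perm_eq s (u :: r) -> g u r = g' u r) -> rsum g s = rsum g' s.
Proof. by move=> H; apply: eq_rsum_subseq => u r /H. Qed.

Lemma eq_rsum_size g g' s :
  (forall u r, size s = (size r).+1 -> g u r = g' u r) -> rsum g s = rsum g' s.
Proof.
by move=> H; apply: eq_rsum_perm => u r /perm_size; apply: H.
Qed.

Lemma eq_rsum g g' s : (forall u r, g u r = g' u r) -> rsum g s = rsum g' s.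
Proof. by move=> H; apply: eq_rsum_size => u r _. Qed.

Lemma rsum0 s : rsum (fun _ _ => 0) s = 0.
Proof. by elim: s => //= w s ->; rewrite subr0. Qed.

Lemma rsumD g g' s : rsum (fun u r => g u r + g' u r) s = rsum g s + rsum g' s.
Proof. by elim: s g g' => /= [|w s IH] g g'; rewrite ?addr0 // IH; ring. Qed.

Lemma rsumZ c g s : rsum (fun u r => c * g u r) s = c * rsum g s.
Proof. by elim: s g => /= [|w s IH] g; rewrite ?mulr0 // IH; ring. Qed.

Lemma rsumN g s : rsum (fun u r => - g u r) s = - rsum g s.
Proof. by elim: s g => /= [|w s IH] g; rewrite ?oppr0 // IH; ring. Qed.

Lemma rsumB g g' s : rsum (fun u r => g u r - g' u r) s = rsum g s - rsum g' s.
Proof. by rewrite rsumD rsumN. Qed.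

Lemma rsum_cat g s1 s2 :
  rsum g (s1 ++ s2) = rsum (fun u r => g u (r ++ s2)) s1
    + (-1) ^+ size s1 * rsum (fun u r => g u (s1 ++ r)) s2.
Proof.
elim: s1 g => /= [|w s IH] g; first by rewrite add0r mul1r.
by rewrite IH exprS; ring.
Qed.

(** Exchanging the order in which two entries are extracted shifts the position of exactly one of
    them by one, hence the sign. *)
Lemma rsum_rsum_anti (g : T -> T -> seq T -> R) s :
  rsum (fun u r => rsum (fun v r' => g u v r') r) s
  = - rsum (fun u r => rsum (fun v r' => g v u r') r) s.
Proof.
elim: s g => /= [|w s IH] g; first by rewrite oppr0.
rewrite !rsumB (IH (fun u v r => g u v (w :: r))); ring.
Qed.

Definition alternating (f : seq T -> R) :=
  forall s1 a b s2, f (s1 ++ a :: b :: s2) = - f (s1 ++ b :: a :: s2).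

Lemma alternating_cons f a : alternating f -> alternating (fun s => f (a :: s)).
Proof. by move=> Hf s1 b c s2; apply: (Hf (a :: s1)). Qed.

Lemma alternating_cat f s : alternating f -> alternating (fun r => f (s ++ r)).
Proof. by move=> Hf s1 b c s2; rewrite !catA; apply: Hf. Qed.

Lemma alternating_front f a s1 s2 : alternating f ->
  f (s1 ++ a :: s2) = (-1) ^+ size s1 * f (a :: s1 ++ s2).
Proof.
elim: s1 f => /= [|b s1 IH] f Hf; first by rewrite mul1r.
rewrite (IH _ (alternating_cons b Hf)) exprS.
by rewrite (Hf [::] b a) /=; ring.
Qed.

Lemma alternating_block f s1 s2 s3 : alternating f ->
  f (s1 ++ s2 ++ s3) = (-1) ^+ (size s1 * size s2) * f (s2 ++ s1 ++ s3).
Proof.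
elim: s2 f => /= [|a s2 IH] f Hf; first by rewrite muln0 mul1r.
rewrite alternating_front // (IH _ (alternating_cons a Hf)) mulnS exprD; ring.
Qed.

(** The sign is chosen before [f']: it depends on the two lists only, so two alternating functions
    can be compared after sorting. *)
Lemma alternating_perm f s1 s2 : alternating f -> perm_eq s1 s2 ->
  exists b : bool, forall f', alternating f' -> f' s1 = (-1) ^+ b * f' s2.
Proof.
move=> _; elim: s1 s2 => [|a s1 IH] s2.
  by rewrite perm_sym => /perm_nilP ->; exists false => f' _; rewrite mul1r.
move=> Hp; have ain : a \in s2 by rewrite -(perm_mem Hp) mem_head.
case/splitPr: ain Hp => p1 p2 Hp.
have {}Hp : perm_eq s1 (p1 ++ p2).
  by rewrite -(perm_cons a) (perm_trans Hp) // perm_catC /= perm_cons perm_catC.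
have [b Hb] := IH _ Hp.
exists (odd (size p1) (+) b) => f' Hf'.
rewrite (alternating_front _ _ _ Hf') (Hb _ (alternating_cons a Hf')).
rewrite signr_addb signr_odd mulrA [X in _ = X * _]mulrAC -expr2 sqrr_sign.
by rewrite mul1r.
Qed.

(** Bringing the entry of position [i] to the front costs [(-1)^i], which cancels the sign carried
    by [rsum]. *)
Lemma rsum_alternating (X : T -> R) f s : alternating f ->
  rsum (fun u r => X u * f (u :: r)) s = (\sum_(u <- s) X u) * f s.
Proof.
elim: s f => /= [|w s IH] f Hf; first by rewrite big_nil mul0r.
rewrite big_cons -rsumN.
under eq_rsum => v r do rewrite (Hf [::] v w) /= mulrN opprK.
by rewrite (IH _ (alternating_cons w Hf)); ring.
Qed.

End SignedRemoval.

Lemma rsum_map (T T' : eqType) (R : comNzRingType) (h : T' -> T)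
    (g : T -> seq T -> R) s :
  rsum g (map h s) = rsum (fun u r => g (h u) (map h r)) s.
Proof. by elim: s g => //= w s IH g; rewrite IH. Qed.

(** * Pfaffians over lists, and their calculus by contractions *)

Section Pfaffian.
Variables (T : eqType) (R : comNzRingType).
Implicit Types (A : T -> T -> R) (s r : seq T).

(** Expansion of the Pfaffian along the first row. The fuel [n] is needed because the remaining list
    [r] is not a structural subterm. Only entries [A a u] with [a] before [u] are read, and lists of
    odd length give 0. *)
Fixpoint pfn n A s : R :=
  match n, s with
  | _, [::] => 1
  | n'.+1, a :: s' => rsum (fun u r => A a u * pfn n' A r) s'
  | 0, _ :: _ => 0
  end.

Definition pf A s := pfn (size s) A s.

Lemma pfnE n A s : (size s <= n)%N -> pfn n A s = pf A s.
Proof.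
rewrite /pf; elim/ltn_ind: n s => -[|n] IH [|a s] //= sn.
apply: eq_rsum_size => u r sr; congr (_ * _).
by rewrite (IH n) ?(IH (size s)) //; lia.
Qed.

Lemma pf_cons A a s : pf A (a :: s) = rsum (fun u r => A a u * pf A r) s.
Proof.
rewrite [LHS]/pf /=; apply: eq_rsum_size => u r sr.
by rewrite pfnE // sr.
Qed.

Lemma seq_size_ind (P : seq T -> Prop) :
  (forall s, (forall r, (size r < size s)%N -> P r) -> P s) -> forall s, P s.
Proof.
move=> H s; have [n] := ubnP (size s); elim: n s => // n IH s sn.
by apply: H => r rs; apply: IH; rewrite (leq_trans rs).
Qed.

Lemma eq_pf A A' s : {in s &, A =2 A'} -> pf A s = pf A' s.
Proof.
elim/seq_size_ind: s => -[|a s] IH H //; rewrite !pf_cons.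
apply: eq_rsum_perm => u r pr; have sub v : v \in r -> v \in a :: s.
  by move=> vr; rewrite inE (perm_mem pr) inE vr !orbT.
rewrite H ?inE ?eqxx //; last by rewrite (perm_mem pr) inE eqxx orbT.
congr (_ * _); apply: IH => [|v w vr wr]; first by move/perm_size: pr => /=; lia.
by apply: H; apply: sub.
Qed.

(** For a swap at the front, expanding two rows gives a double extraction, and [rsum_rsum_anti]
    applies; a deeper swap survives the expansion of the first row by induction. *)
Lemma pf_alternating A : (forall u v, A u v = - A v u) -> alternating (pf A).
Proof.
move=> AN s1 a b s2.
have [n] := ubnP (size s1 + size s2); elim: n s1 s2 => // n IH [|c s1] s2 /= sn.
  have E c d : rsum (fun v r => A c v * pf A (d :: r)) s2 =
      rsum (fun u r => rsum (fun v r' => A c u * A d v * pf A r') r) s2.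
    apply: eq_rsum => u r; rewrite pf_cons -rsumZ.
    by apply: eq_rsum => v r'; rewrite mulrA.
  rewrite !pf_cons /= !E [X in _ - X = _]rsum_rsum_anti (AN a b).
  under [X in _ - - X = _]eq_rsum => v r do
    under eq_rsum => w r' do rewrite (mulrC (A a _)).
  ring.
rewrite !pf_cons !rsum_cat /=.
have -> : rsum (fun u r => A c u * pf A (r ++ [:: a, b & s2])) s1 =
  - rsum (fun u r => A c u * pf A (r ++ [:: b, a & s2])) s1.
  rewrite -rsumN; apply: eq_rsum_size => u r sr; rewrite IH ?mulrN //.
  by rewrite sr in sn; rewrite -ltnS (leq_trans _ sn).
have -> : rsum (fun u r => A c u * pf A (s1 ++ [:: a, b & r])) s2 =
  - rsum (fun u r => A c u * pf A (s1 ++ [:: b, a & r])) s2.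
  rewrite -rsumN; apply: eq_rsum_size => u r sr; rewrite IH ?mulrN //.
  by rewrite sr addnS ltnS in sn; rewrite (leq_trans _ sn) // ltnS.
ring.
Qed.

(** The interior product by the linear form [b], that is, a fermionic annihilation operator. Row
    expansion of a Pfaffian is a contraction ([pf_contr]). *)
Definition contr (b : T -> R) (f : seq T -> R) s := rsum (fun u r => b u * f r) s.

Lemma contr_cons b f w s :
  contr b f (w :: s) = b w * f s - contr b (fun r => f (w :: r)) s.
Proof. by []. Qed.

Lemma eq_contr b b' f f' s : {in s, b =1 b'} ->
  (forall r, size s = (size r).+1 -> f r = f' r) -> contr b f s = contr b' f' s.
Proof.
move=> Hb Hf; apply: eq_rsum_perm => u r pr.
by rewrite Hb ?(perm_mem pr) ?mem_head // Hf ?(perm_size pr).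
Qed.

Lemma contr_eq0 b f s : {in s, forall u, b u = 0} -> contr b f s = 0.
Proof.
move=> Hb; rewrite -[RHS](rsum0 R s); apply: eq_rsum_perm => u r pr.
by rewrite Hb ?mul0r // (perm_mem pr) mem_head.
Qed.

Lemma contrD b f f' s : contr b (fun r => f r + f' r) s = contr b f s + contr b f' s.
Proof. by rewrite /contr -rsumD; apply: eq_rsum => u r; rewrite mulrDr. Qed.

Lemma contrZ b c f s : contr b (fun r => c * f r) s = c * contr b f s.
Proof. by rewrite /contr -rsumZ; apply: eq_rsum => u r; rewrite mulrCA. Qed.

Lemma contrDl b b' f s : contr (fun u => b u + b' u) f s = contr b f s + contr b' f s.
Proof. by rewrite /contr -rsumD; apply: eq_rsum => u r; rewrite mulrDl. Qed.

Lemma contrZl b c f s : contr (fun u => c * b u) f s = c * contr b f s.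
Proof. by rewrite /contr -rsumZ; apply: eq_rsum => u r; rewrite mulrA. Qed.

Lemma contr_contr b c f s : contr b (contr c f) s = - contr c (contr b f) s.
Proof.
have E b' c' : contr b' (contr c' f) s =
    rsum (fun u r => rsum (fun v r' => b' u * c' v * f r') r) s.
  apply: eq_rsum => u r; rewrite -rsumZ; apply: eq_rsum => v r'; exact: mulrA.
rewrite !E rsum_rsum_anti; congr (- _); apply: eq_rsum => u r; apply: eq_rsum => v r'.
by rewrite (mulrC (b v)).
Qed.

(** Proved by its own induction: anticommutation gives only that twice the value is 0, which does
    not suffice in a general commutative ring. *)
Lemma contr_contr_same b f s : contr b (contr b f) s = 0.
Proof.
elim: s f => [|w s IH] f //; rewrite contr_cons.
rewrite [X in _ - X](eq_contr (b' := b)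
    (f' := fun r => b w * f r + (-1) * contr b (fun r => f (w :: r)) r)) //.
  by rewrite contrD !contrZ IH; ring.
by move=> r _; rewrite contr_cons mulN1r.
Qed.

Lemma pf_contr A a s : pf A (a :: s) = contr (A a) (pf A) s.
Proof. exact: pf_cons. Qed.

(** In the exterior algebra this multiplies the exponential of [A] by that of [b] wedge [c]. The
    latter stops after its linear term, since contracting twice by the same form vanishes. *)
Lemma pf_rank2 A b c s :
  pf (fun u v => A u v + (b u * c v - b v * c u)) s
  = pf A s + contr b (contr c (pf A)) s.
Proof.
elim/seq_size_ind: s => -[|w s] IH; first by rewrite /contr /= addr0.
rewrite pf_contr (eq_contr (b' := fun u => A w u + (b w * c u + (- c w) * b u))
  (f' := fun r => pf A r + contr b (contr c (pf A)) r)); first last.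
- by move=> r sr; rewrite IH //= sr; lia.
- by move=> u _; ring.
rewrite !contrDl !contrZl !contrD contr_cons contr_contr_same.
have -> : contr c (contr b (contr c (pf A))) s = 0.
  rewrite contr_contr (eq_contr (b' := b) (f' := fun r => 0 * pf A r)) //.
    by rewrite contrZ mul0r oppr0.
  by move=> r _; rewrite contr_contr_same mul0r.
have -> : contr b (fun r => contr c (pf A) (w :: r)) s =
    c w * contr b (pf A) s - contr (A w) (contr b (contr c (pf A))) s.
  rewrite (eq_contr (b' := b) (f' := fun r => c w * pf A r +
      contr (A w) (contr c (pf A)) r)) //.
    by rewrite contrD contrZ (contr_contr b (A w)).
  move=> r _; rewrite contr_cons (contr_contr (A w)); congr (_ - _).
  by apply: eq_contr => // r' _; rewrite pf_contr.
by rewrite pf_contr; ring.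
Qed.

End Pfaffian.

(** * Schur complements, the integration identity, and peeling off determinants *)

Section PfaffianField.
Variables (T : eqType) (R : realFieldType).
Implicit Types (A : T -> T -> R) (s r : seq T).

(** Expanding along [b] and then [b'] leaves [pf A s] plus a double contraction, which [pf_rank2]
    recognises as a rank-two change of the kernel. *)
Lemma pf_schur A b b' s : A b b' != 0 ->
  pf A (b :: b' :: s) = A b b' *
    pf (fun u v => A u v - (A b u * A b' v - A b v * A b' u) / A b b') s.
Proof.
move=> nz; rewrite pf_contr contr_cons.
pose be u := - (A b b')^-1 * A b u.
have -> : pf (fun u v => A u v - (A b u * A b' v - A b v * A b' u) / A b b') s
  = pf (fun u v => A u v + (be u * A b' v - be v * A b' u)) s.
  by apply: eq_pf => u v _ _; rewrite /be; ring.
rewrite pf_rank2 /be contrZl.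
have -> : contr (A b) (fun r => pf A (b' :: r)) s = contr (A b) (contr (A b') (pf A)) s.
  by apply: eq_contr => // r _; exact: pf_contr.
by field.
Qed.

Lemma alternating_dup (f : seq T -> R) s a r :
  alternating f -> perm_eq s (a :: a :: r) -> f s = 0.
Proof.
move=> Hf /(alternating_perm Hf) [b Hb]; rewrite Hb //.
have := Hf [::] a a r => /= /eqP; rewrite -addr_eq0 -mulr2n mulrn_eq0 /=.
by move/eqP ->; rewrite mulr0.
Qed.

(** Algebraic core of the integration step. The hypothesis says that [E u v + X u * A u v] is
    symmetric, so its antisymmetric double extraction vanishes. What is left is the sum of
    [X u * A u v * pf A r], computed by [rsum_alternating]. *)
Lemma rsum_rsum_pf A (E : T -> T -> R) (X : T -> R) s :
  (forall u v, A u v = - A v u) ->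
  {in s &, forall u v, E u v - E v u = - ((X u + X v) * A u v)} ->
  - rsum (fun u r => rsum (fun v r' => E u v * pf A r') r) s
  = (\sum_(u <- s) X u) * pf A s.
Proof.
move=> AN EX; rewrite -(rsum_alternating X s (pf_alternating AN)).
pose S (g : T -> T -> R) :=
  rsum (fun u r => rsum (fun v r' => g u v * pf A r') r) s.
have SX : rsum (fun u r => X u * pf A (u :: r)) s = S (fun u v => X u * A u v).
  apply: eq_rsum => u r; rewrite pf_cons -rsumZ; apply: eq_rsum => v r'.
  exact: mulrA.
pose h u v := E u v + X u * A u v.
have Sh : S h = 0.
  suff : S h = - S h by move=> /eqP; rewrite -addr_eq0 -mulr2n mulrn_eq0 /= => /eqP.
  rewrite {1}/S rsum_rsum_anti; congr (- _).
  apply: eq_rsum_perm => u r pr; apply: eq_rsum_perm => v r' pr'.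
  have us : u \in s by rewrite (perm_mem pr) mem_head.
  have vs : v \in s by rewrite (perm_mem pr) inE (perm_mem pr') mem_head orbT.
  have /eqP := EX _ _ us vs; rewrite subr_eq => /eqP e; congr (_ * _).
  by rewrite /h e (AN v u); ring.
have -> : rsum (fun u r => rsum (fun v r' => E u v * pf A r') r) s = S E by [].
have -> : S E = S h - S (fun u v => X u * A u v).
  rewrite /S -rsumB; apply: eq_rsum => u r; rewrite -rsumB; apply: eq_rsum => v r'.
  by rewrite /h; ring.
by rewrite Sh sub0r opprK SX.
Qed.

(** Laplace expansion of the determinant of [A y b], in the form in which it comes out of a
    Pfaffian; see [dt_det]. *)
Fixpoint dt A ys bs : R := if ys is y :: ys' then contr (A y) (dt A ys') bs else 1.

Fixpoint dbl (ps : seq (T * T)) : seq T :=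
  if ps is p :: ps' then [:: p.1, p.2 & dbl ps'] else [::].

Lemma dbl_cat ps qs : dbl (ps ++ qs) = dbl ps ++ dbl qs.
Proof. by elim: ps => //= p ps ->. Qed.

Lemma size_dbl ps : size (dbl ps) = (size ps).*2.
Proof. by elim: ps => //= p ps IH; rewrite IH doubleS. Qed.

(** The first members of the pairs can be matched only inside [bs], and there are as many of them as
    entries of [bs]. Hence they use up [bs], and the Pfaffian splits off a determinant. *)
Lemma pf_peel A ps bs rest : (forall u v, A u v = - A v u) ->
  size ps = size bs ->
  (forall y u, y \in unzip1 ps -> u \in dbl ps ++ rest -> A y u = 0) ->
  pf A (dbl ps ++ bs ++ rest)
  = (-1) ^+ size ps * dt A (unzip1 ps) bs * pf A (unzip2 ps ++ rest).
Proof.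
move=> AN; elim: ps bs rest => [|[y x] ps IH] bs rest /= sz A0.
  by rewrite (size0nil (esym sz)) !mul1r.
rewrite pf_contr -cat_cons /contr rsum_cat -/(contr _ _ _).
rewrite contr_eq0 ?add0r; last first.
  move=> u us; apply: A0; rewrite ?mem_head // !inE mem_cat.
  by move: us; rewrite inE => /orP[] ->; rewrite ?orbT.
rewrite rsum_cat -/(contr _ _ rest) contr_eq0 ?mulr0 ?addr0; last first.
  by move=> u us; apply: A0; rewrite ?mem_head // !inE mem_cat us !orbT.
have aa := pf_alternating AN.
have H u r : size bs = (size r).+1 ->
    A y u * pf A ((x :: dbl ps) ++ r ++ rest) =
    - (-1) ^+ (size ps).+1 * pf A (x :: unzip2 ps ++ rest) *
      (A y u * dt A (unzip1 ps) r).
  move=> sr; have szr : size ps = size r by move: sz; rewrite sr => -[].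
  (* The induction hypothesis needs [x] next to [rest]. Moving it there on the left, and back to the
     front on the right, both cost a sign of parity [size ps]. *)
  have := IH r (x :: rest) szr.
  rewrite catA (alternating_front _ _ _ aa) -catA (alternating_front _ (unzip2 ps) _ aa).
  rewrite size_cat size_dbl size_map -szr exprD -mul2n exprM sqrrN !expr1n mul1r.
  move=> E; rewrite /= exprS mulN1r opprK.
  suff -> : pf A (x :: dbl ps ++ r ++ rest) =
      (-1) ^+ size ps * dt A (unzip1 ps) r * pf A (x :: unzip2 ps ++ rest) by ring.
  apply: (mulfI (x := (-1) ^+ size ps)); first by rewrite signr_eq0.
  rewrite E; first by ring.
  move=> y' u' y'in u'in; apply: A0; first by rewrite inE y'in orbT.
  move: u'in; rewrite /= !inE !mem_cat inE.
  by case: (u' \in dbl ps); case: (u' == x); rewrite ?orbT //= => ->; rewrite ?orbT.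
rewrite [X in _ * X](eq_rsum_size (g' := fun u r =>
   - (-1) ^+ (size ps).+1 * pf A (x :: unzip2 ps ++ rest) *
      (A y u * dt A (unzip1 ps) r))); last by move=> u r /H.
rewrite rsumZ /= size_dbl exprS -mul2n exprM sqrrN !expr1n mulr1.
by rewrite /contr; ring.
Qed.

Lemma rsum_mkseq n (f : 'I_n.+1 -> T) (g : T -> seq T -> R) :
  rsum g [seq f i | i <- enum 'I_n.+1] =
  \sum_(j < n.+1) (-1) ^+ j * g (f j) [seq f (lift j i) | i <- enum 'I_n].
Proof.
elim: n f g => [|n IH] f g.
  rewrite enum_ordSl big_ord1 enum_ord0 /= subr0 mul1r.
  by rewrite (_ : ord0 = 0) //; congr (g (f _) _); apply/val_inj.
rewrite enum_ordSl big_ord_recl [LHS]/= -map_comp mul1r.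
congr (_ + _).
rewrite (IH (fun i => f (lift ord0 i))) -sumrN; apply: eq_bigr => j _.
rewrite lift0 exprS mulN1r mulNr; congr (- (_ * g _ _)).
rewrite enum_ordSl /= -map_comp; congr (f _ :: _).
  by apply/val_inj.
by apply: eq_map => i /=; congr f; apply/val_inj; rewrite /= /bump /=; lia.
Qed.

Lemma dt_det A n (y b : 'I_n -> T) :
  dt A [seq y i | i <- enum 'I_n] [seq b i | i <- enum 'I_n] =
  \det (\matrix_(i < n, j < n) A (y i) (b j)).
Proof.
elim: n y b => [|n IH] y b; first by rewrite enum_ord0 det_mx00.
rewrite (expand_det_row _ ord0) [in map y _]enum_ordSl /= /contr rsum_mkseq.
apply: eq_bigr => j _; rewrite mxE /cofactor mulrCA; congr (_ * (_ * _)).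
rewrite -map_comp (IH (y \o lift ord0) (b \o lift j)).
by congr (\det _); apply/matrixP => i k; rewrite !mxE.
Qed.

Definition vdm_sgn (h : T -> T -> R) :=
  fix F s := if s is u :: s' then (\prod_(v <- s') h u v) * F s' else 1.

Lemma vdm_sgn_alternating h : (forall u v, h u v = - h v u) ->
  alternating (vdm_sgn h).
Proof.
move=> hN; elim=> [|c s1 IH] a b s2 /=; first by rewrite !big_cons (hN a b); ring.
rewrite IH mulrN; congr (- (_ * _)); apply: perm_big.
by rewrite perm_cat2l (perm_catCA [:: a] [:: b]).
Qed.

End PfaffianField.

(** * The Pfaffian of the sign kernel *)

Lemma uniqPn_perm (T : eqType) (s : seq T) :
  ~~ uniq s -> exists a r, perm_eq s (a :: a :: r).
Proof.
elim: s => //= a s IH; rewrite negb_and negbK => /orP[ain|/IH[b [r pr]]].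
  by exists a, (rem a s); rewrite perm_cons perm_to_rem.
exists b, (a :: r); rewrite (perm_trans (y := a :: b :: b :: r)) ?perm_cons //.
by rewrite (perm_catCA [:: a] [:: b; b]).
Qed.

Section PfaffianSign.
Variables (R : realFieldType).
Implicit Types (s : seq R).

Let sgk (u v : R) : R := Num.sg (v - u).

Let sgkN u v : sgk u v = - sgk v u.
Proof. by rewrite /sgk -opprB sgrN. Qed.

(** Every entry read is 1, and so by induction is every minor. The row expansion is then an
    alternating sum of an odd number of ones. *)
Lemma pf_sg_sorted s : sorted <%R s -> ~~ odd (size s) -> pf sgk s = 1.
Proof.
have alt1 s' : rsum (fun _ _ => 1) s' = (odd (size s'))%:R :> R.
  by elim: s' => //= w s' ->; case: (odd _); rewrite /= ?subr0 ?subrr.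
elim/seq_size_ind: s => -[|a s] IH //= srt; rewrite negbK => sz.
rewrite pf_cons -[RHS]/(true%:R) -sz -alt1; apply: eq_rsum_subseq => u r pr sb.
rewrite IH ?mulr1 //=.
- have : u \in s by rewrite (perm_mem pr) mem_head.
  by move/(allP (order_path_min lt_trans srt)) => au; rewrite /sgk gtr0_sg // subr_gt0.
- by rewrite (perm_size pr) /=; lia.
- exact: subseq_sorted lt_trans _ _ sb (path_sorted srt).
- by move: sz; rewrite (perm_size pr).
Qed.

Lemma vdm_sgn_sorted s : sorted <%R s -> vdm_sgn sgk s = 1.
Proof.
elim: s => //= a s IH srt; rewrite IH ?(path_sorted srt) // mulr1 big_seq big1 // => u us.
by rewrite /sgk gtr0_sg // subr_gt0 (allP (order_path_min lt_trans srt)).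
Qed.

(** Both sides are alternating: they vanish on a repeated entry, change by the same sign under
    sorting, and equal 1 on increasing lists. *)
Lemma pf_sg s : ~~ odd (size s) -> pf sgk s = vdm_sgn sgk s.
Proof.
move=> sz; have a1 := pf_alternating sgkN; have a2 := vdm_sgn_alternating sgkN.
have [us|] := boolP (uniq s); last first.
  case/uniqPn_perm => a [r pr].
  by rewrite (alternating_dup a1 pr) (alternating_dup a2 pr).
have ps : perm_eq s (sort <=%R s) by rewrite perm_sym perm_sort.
have [b Hb] := alternating_perm a1 ps.
have srt : sorted <%R (sort <=%R s).
  by rewrite lt_sorted_uniq_le sort_uniq us sort_le_sorted.
by rewrite !Hb // pf_sg_sorted ?vdm_sgn_sorted // size_sort.
Qed.

Lemma vdm_sgnE n (x : 'I_n -> R) :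
  vdm_sgn sgk [seq x i | i <- enum 'I_n] =
  Num.sg (\prod_(i < n) \prod_(j < n | (i < j)%N) (x j - x i)).
Proof.
elim: n x => [|n IH] x; first by rewrite enum_ord0 big_ord0 sgr1.
rewrite enum_ordSl big_ord_recl /= -map_comp IH sgrM; congr (_ * _).
  rewrite big_map big_enum /= [in RHS]big_mkcond big_ord_recl /= mul1r.
  by rewrite (big_morph _ (@sgrM R) (sgr1 R)).
congr Num.sg; apply: eq_bigr => i _.
by rewrite [in RHS]big_mkcond big_ord_recl /= mul1r -big_mkcond.
Qed.

End PfaffianSign.

(** * Averages over two-valued labels, used to write traces of matrix products as label sums *)

Lemma ord2P (a : 'I_2) : {a = 0} + {a = 1}.
Proof. by case: a => -[|[|//]] i; [left|right]; apply/val_inj. Qed.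

Lemma sum2E (V : nmodType) (F : 'I_2 -> V) : \sum_a F a = F 0 + F 1.
Proof. by rewrite big_ord_recl big_ord1; congr (F _ + F _); apply/val_inj. Qed.

Section SpinSums.
Variables (I : finType) (R : realFieldType).
Implicit Types (e : {ffun I -> 'I_2}) (h f g : {ffun I -> 'I_2} -> R).

Definition upd e x (a : 'I_2) : {ffun I -> 'I_2} := [ffun z => if z == x then a else e z].

Lemma upd_same e x a : upd e x a x = a.
Proof. by rewrite ffunE eqxx. Qed.

Lemma upd_other e x a z : z != x -> upd e x a z = e z.
Proof. by rewrite ffunE => /negbTE ->. Qed.

Lemma sum_upd h x : \sum_e h e = 2^-1 * \sum_e \sum_a h (upd e x a).
Proof.
pose phi e := upd e x (e x + 1).
have phiK : involutive phi.
  move=> e; apply/ffunP => z; rewrite /phi ffunE; have [->|zx] := eqVneq z x.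
    by rewrite upd_same; case: (ord2P (e x)) => ->; apply/val_inj.
  by rewrite upd_other.
have -> : \sum_e \sum_a h (upd e x a) = \sum_e (h e + h (phi e)).
  apply: eq_bigr => e _; rewrite sum2E /phi.
  have ee a : e x = a -> upd e x a = e.
    by move=> ea; apply/ffunP => z; rewrite ffunE; case: eqP => [->|].
  case: (ord2P (e x)) => ex; rewrite ex (ee _ ex); first by rewrite add0r.
  by rewrite addrC (_ : 1 + 1 = 0) //; apply/val_inj.
have -> : \sum_e (h e + h (phi e)) = \sum_e h e + \sum_e h e.
  by rewrite big_split /=; congr (_ + _); rewrite [RHS](reindex_inj (can_inj phiK)).
lra.
Qed.

(** Normalised as an expectation, so that labels on which [h] does not depend contribute a factor
    1. *)
Definition spinE h := (2 ^+ #|I|)^-1 * \sum_e h e.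

Lemma eq_spinE h h' : h =1 h' -> spinE h = spinE h'.
Proof. by move=> E; rewrite /spinE; congr (_ * _); apply: eq_bigr. Qed.

Lemma spinE_upd h x : spinE h = 2^-1 * \sum_a spinE (fun e => h (upd e x a)).
Proof. by rewrite /spinE (sum_upd h x) -mulr_sumr exchange_big /= mulrCA. Qed.

Lemma spinEZ c h : spinE (fun e => c * h e) = c * spinE h.
Proof. by rewrite /spinE -mulr_sumr mulrCA. Qed.

Lemma spinE_sum (J : finType) (F : J -> {ffun I -> 'I_2} -> R) :
  spinE (fun e => \sum_j F j e) = \sum_j spinE (F j).
Proof. by rewrite /spinE exchange_big mulr_sumr. Qed.

Lemma spinE_cst c : spinE (fun _ => c) = c.
Proof.
rewrite /spinE sumr_const card_ffun card_ord.
by rewrite -[c *+ _]mulr_natl natrX mulKf // expf_neq0 // pnatr_eq0.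
Qed.

(** Independence of the labels in [A] and outside [A]: on pairs of labellings, exchanging the parts
    outside [A] is an involution that turns [f e * g e'] into [f e * g e]. *)
Lemma spinE_indep (A : {set I}) f g :
  (forall e e', {in A, e =1 e'} -> f e = f e') ->
  (forall e e', {in ~: A, e =1 e'} -> g e = g e') ->
  spinE (fun e => f e * g e) = spinE f * spinE g.
Proof.
move=> fA gA.
pose mix e e' : {ffun I -> 'I_2} := [ffun z => if z \in A then e z else e' z].
pose mm (p : {ffun I -> 'I_2} * {ffun I -> 'I_2}) := (mix p.1 p.2, mix p.2 p.1).
have mmK : involutive mm.
  by case=> e e'; rewrite /mm /=; apply: f_equal2; apply/ffunP => z; rewrite !ffunE /=; case: (z \in A).
have key : spinE (fun e => spinE (fun e' => f e * g e')) =
           spinE (fun e => spinE (fun e' => f e * g e)).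
  rewrite /spinE; congr (_ * _).
  rewrite -[LHS](mulr_sumr _ _ _ (2 ^+ #|I|)^-1) -[RHS](mulr_sumr _ _ _ (2 ^+ #|I|)^-1).
  rewrite !pair_big /=; congr (_ * _).
  rewrite [RHS](reindex_inj (can_inj mmK)) /=; apply: eq_bigr => -[e e'] _ /=.
  congr (_ * _); first by apply: fA => z zA; rewrite ffunE zA.
  by apply: gA => z; rewrite inE => /negbTE zA; rewrite ffunE zA.
have -> : spinE (fun e => f e * g e) = spinE (fun e => spinE (fun e' => f e * g e)).
  by apply: eq_spinE => e; rewrite spinE_cst.
rewrite -key -[RHS]mulrC -spinEZ; apply: eq_spinE => e.
by rewrite spinEZ mulrC.
Qed.

Lemma spinE_prod (P : seq {set I}) (F : {set I} -> {ffun I -> 'I_2} -> R) :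
  uniq P -> {in P &, forall A B : {set I}, A != B -> [disjoint A & B]} ->
  (forall A e e', A \in P -> {in A, e =1 e'} -> F A e = F A e') ->
  spinE (fun e => \prod_(A <- P) F A e) = \prod_(A <- P) spinE (F A).
Proof.
elim: P => [|A P IH] /= => [_ _ _|/andP[AP uP] dP FP].
  by rewrite big_nil -[RHS](spinE_cst 1); apply: eq_spinE => e; rewrite big_nil.
rewrite big_cons -IH //.
- rewrite -(spinE_indep (A := A)).
  + by apply: eq_spinE => e; rewrite big_cons.
  + by move=> e e'; apply: FP; rewrite mem_head.
  move=> e e' ee; rewrite big_seq [RHS]big_seq; apply: eq_bigr => B BP.
  apply: FP; first by rewrite inE BP orbT.
  move=> z zB; apply: ee; rewrite inE; apply/negP => zA.
  have /disjointFr : [disjoint A & B].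
    by apply: dP; rewrite ?mem_head ?inE ?BP ?orbT //; apply: contraNneq AP => ->.
  by move=> /(_ _ zA); rewrite zB.
- by move=> B C BP CP; apply: dP; rewrite inE ?BP ?CP orbT.
by move=> B e e' BP; apply: FP; rewrite inE BP orbT.
Qed.

(* Sum over the two-valued labels along a path of distinct points is a matrix product. *)
Lemma spinE_path n (a : nat -> I) (B : nat -> 'M[R]_2) (i : 'I_2) (phi : 'I_2 -> R) :
  {in [pred k | (k <= n)%N] &, injective a} ->
  spinE (fun e => (e (a 0%N) == i)%:R * (\prod_(k < n) B k (e (a k)) (e (a k.+1)))
                  * phi (e (a n)))
  = (2 ^+ n.+1)^-1 * \sum_l (\prod_(k < n) B k) i l * phi l.
Proof.
elim: n phi => [|n IH] phi inj.
  rewrite (spinE_upd _ (a 0%N)) expr1 big_ord0 !sum2E; congr (_ * (_ + _)).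
    by rewrite -[RHS]spinE_cst; apply: eq_spinE => e; rewrite big_ord0 upd_same !mxE mulr1 eq_sym.
  by rewrite -[RHS]spinE_cst; apply: eq_spinE => e; rewrite big_ord0 upd_same !mxE mulr1 eq_sym.
have neq k : (k <= n)%N -> a k != a n.+1.
  move=> kn; apply/negP => /eqP /inj; rewrite !inE; move=> H.
  by have := H (leqW kn) (leqnn _); lia.
rewrite (spinE_upd _ (a n.+1)) -spinE_sum.
have -> : spinE (fun e => \sum_l
      ((upd e (a n.+1) l (a 0%N) == i)%:R *
       (\prod_(k < n.+1) B k (upd e (a n.+1) l (a k)) (upd e (a n.+1) l (a k.+1)))
       * phi (upd e (a n.+1) l (a n.+1)))) =
   spinE (fun e => (e (a 0%N) == i)%:R * (\prod_(k < n) B k (e (a k)) (e (a k.+1)))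
                  * (\sum_l B n (e (a n)) l * phi l)).
  apply: eq_spinE => e; rewrite mulr_sumr; apply: eq_bigr => l _.
  rewrite upd_same upd_other ?neq // big_ord_recr /= upd_same upd_other ?neq //.
  rewrite -!mulrA; congr (_ * (_ * _)); apply: eq_bigr => k _.
  by rewrite !upd_other // neq // ltnW.
rewrite (IH (fun j => \sum_l B n j l * phi l)); last by move=> k l; rewrite !inE => kn ln; apply: inj; rewrite inE leqW.
rewrite mulrA -invfM -exprS; congr (_ * _).
have -> : \prod_(k < n.+1) B k = (\prod_(k < n) B k) * B n by rewrite big_ord_recr.
under eq_bigr do rewrite mulr_sumr.
rewrite exchange_big /=; apply: eq_bigr => l _.
by rewrite mxE mulr_suml; apply: eq_bigr => l' _; rewrite mulrA.
Qed.

End SpinSums.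

(** * Dyson's determinant as a sum over permutations and labels *)

Section TdetSpin.
Variables (I : finType) (R : realType).
Implicit Types (Q : I -> I -> 'M[R]_2) (s : {perm I}) (e : {ffun I -> 'I_2}).

Lemma big_porbit s a (F : I -> R) :
  \prod_(x in porbit s a) F x = \prod_(k < #|porbit s a|) F (iter k s a).
Proof.
rewrite (eq_bigl (mem (traject s a #|porbit s a|))); last first.
  by move=> x; rewrite porbit_traject.
rewrite -big_uniq ?uniq_traject_porbit //=.
elim: #|_| => [|n IH]; first by rewrite big_nil big_ord0.
by rewrite trajectSr big_rcons big_ord_recr /= IH.
Qed.

Lemma cycle_trace Q s a :
  \tr (\prod_(k < #|porbit s a|) Q (iter k s a) (iter k.+1 s a)) =
  2 ^+ #|porbit s a| *
    spinE (fun e => \prod_(x in porbit s a) Q x (s x) (e x) (e (s x))).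
Proof.
under eq_spinE => e do rewrite big_porbit.
have it : iter #|porbit s a| s a = a by rewrite iter_porbit.
have un := uniq_traject_porbit s a.
have : (0 < #|porbit s a|)%N by rewrite lt0n; apply/pred0Pn; exists a; exact: porbit_id.
case: #|porbit s a| it un => // n it un _.
pose B k := Q (iter k s a) (iter k.+1 s a).
transitivity (2 ^+ n.+1 * \sum_i spinE (fun e => (e (iter 0 s a) == i)%:R *
   (\prod_(k < n) B k (e (iter k s a)) (e (iter k.+1 s a))) * B n (e (iter n s a)) i)).
  have inj : {in [pred k | (k <= n)%N] &, injective (fun k => iter k s a)}.
    move=> k l; rewrite !inE => kn ln; rewrite -(nth_traject s (kn : (k < n.+1)%N)) -(nth_traject s (ln : (l < n.+1)%N)).
    by move/eqP; rewrite nth_uniq ?size_traject // => /eqP.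
  rewrite (eq_bigr (fun i => (2 ^+ n.+1)^-1 * \sum_l (\prod_(k < n) B k) i l * B n l i));
    last by move=> i _; rewrite (spinE_path B i (fun l => B n l i) inj).
  rewrite -mulr_sumr mulVKf ?expf_neq0 ?pnatr_eq0 // /mxtrace.
  apply: eq_bigr => i _.
  have -> : \prod_(k < n.+1) Q (iter k s a) (iter k.+1 s a) =
    (\prod_(k < n) B k) * B n by rewrite big_ord_recr.
  by rewrite mxE.
congr (_ * _); rewrite -spinE_sum; apply: eq_spinE => e.
rewrite (bigD1 (e a)) //= eqxx mul1r [X in _ + X]big1 ?addr0; last first.
  by move=> i ne /=; rewrite eq_sym (negbTE ne) !mul0r.
by rewrite big_ord_recr /= /B -/(iter n.+1 s a) it.
Qed.

Lemma porbits_disjoint s :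
  {in porbits s &, forall A B : {set I}, A != B -> [disjoint A & B]}.
Proof.
move=> A B /imsetP[x _ ->] /imsetP[y _ ->]; apply: contraR => /pred0Pn[z /=].
by rewrite -!eq_porbit_mem => /andP[/eqP <- /eqP <-].
Qed.

Lemma cycle_scal_spin Q s c : c \in porbits s ->
  cycle_scal Q s c =
  2 ^+ #|c| / 2 * spinE (fun e => \prod_(x in c) Q x (s x) (e x) (e (s x))).
Proof.
move=> cin; rewrite /cycle_scal; case: pickP => [a ac|c0]; last first.
  by case/imsetP: cin c0 => a _ -> /(_ a); rewrite porbit_id.
have -> : c = porbit s a.
  by case/imsetP: cin ac => b _ -> ab; apply/eqP; rewrite eq_sym eq_porbit_mem.
by rewrite cycle_trace; ring.
Qed.

Lemma signr_porbits s : (-1) ^+ (#|I| - #|porbits s|) = (-1) ^+ s :> R.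
Proof.
rewrite -signr_odd oddB //; exact: leq_imset_card.
Qed.

(** The trace along each cycle is a label sum over that cycle. Cycles are disjoint, so the product
    of the label averages is the average of the product, and one factor 1/2 per cycle remains from
    the scalar part. *)
Lemma TdetE Q : Tdet Q = \sum_(s : {perm I}) (-1) ^+ s * (2 ^+ #|porbits s|)^-1 *
   \sum_(e : {ffun I -> 'I_2}) \prod_x Q x (s x) (e x) (e (s x)).
Proof.
rewrite /Tdet; apply: eq_bigr => s _; rewrite signr_porbits -mulrA; congr (_ * _).
rewrite (eq_bigr _ (fun c cin => cycle_scal_spin Q cin)) big_split /= big_split /=.
have triv : finset.trivIset (porbits s) by apply/finset.trivIsetP; exact: porbits_disjoint.
have cov : finset.cover (porbits s) = [set: I].
  apply/setP => x; rewrite inE; apply/finset.bigcupP; exists (porbit s x); last exact: porbit_id.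
  exact: imset_f.
have -> : \prod_(c in porbits s) 2 ^+ #|c| = 2 ^+ #|I| :> R.
  rewrite -(big_morph _ (exprD 2) (expr0 2)) -cardsT -cov.
  by move: triv; rewrite /finset.trivIset => /eqP ->.
have -> : \prod_(c in porbits s)
    spinE (fun e => \prod_(x in c) Q x (s x) (e x) (e (s x))) =
  (2 ^+ #|I|)^-1 * \sum_(e : {ffun I -> 'I_2}) \prod_x Q x (s x) (e x) (e (s x)).
  rewrite -big_enum /= -spinE_prod ?enum_uniq //; first last.
  - move=> A e e'; rewrite mem_enum => /imsetP[a _ ->] ee; apply: eq_bigr => x xa.
    rewrite !ee //; move: xa; rewrite -!eq_porbit_mem => /eqP <-.
    by rewrite -[X in _ == X](porbit_perm s 1) expg1.
  - by move=> A B; rewrite !mem_enum; apply: porbits_disjoint.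
  rewrite /spinE; congr (_ * _); apply: eq_bigr => e _.
  by rewrite big_enum /= -finset.big_trivIset // cov; apply: eq_bigl => x; rewrite inE.
by rewrite prodr_const exprVn mulrACA mulfV ?mul1r // expf_neq0 // pnatr_eq0.
Qed.

End TdetSpin.

(** * Removing one index from Dyson's determinant *)

Section TdetRecursion.
Variables (I : finType) (R : realFieldType).
Implicit Types (Q : I -> I -> 'M[R]_2) (s : {perm I}) (e : {ffun I -> 'I_2}) (S : {set I}).

(** Dyson's determinant restricted to [S], still over permutations and labels of all of [I]: each
    fixed point outside [S] counts as a cycle, with factor 1/2, and its free label gives back a
    factor 2. *)
Definition TdS S Q := \sum_(s : {perm I} | perm_on S s) (-1) ^+ s * (2 ^+ #|porbits s|)^-1 *
   \sum_(e : {ffun I -> 'I_2}) \prod_(x in S) Q x (s x) (e x) (e (s x)).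

Lemma perm_onP S s : reflect (forall z, z \notin S -> s z = z) (perm_on S s).
Proof.
apply: (iffP fintype.subsetP) => H z.
  by move=> zS; apply/eqP; apply: contraNT zS => /H.
by apply: contraR => /H sz; apply/eqP.
Qed.

Lemma eq_TdS S Q Q' : {in S &, Q =2 Q'} -> TdS S Q = TdS S Q'.
Proof.
move=> QQ; apply: eq_bigr => s ps; congr (_ * _); apply: eq_bigr => e _.
by apply: eq_bigr => x xS; rewrite QQ // (perm_closed _ ps).
Qed.

Lemma TdS0 Q : TdS finset.set0 Q = 1.
Proof.
rewrite /TdS (big_pred1 1%g); last first.
  move=> s /=; apply/idP/eqP => [/perm_onP H|->]; last exact: perm_on1.
  by apply/permP => z; rewrite H ?inE // perm1.
rewrite odd_perm1 expr0 mul1r (eq_bigr (fun _ => 1)); last by move=> e _; rewrite big_set0.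
have -> : #|porbits (1%g : {perm I})| = #|I|.
  apply: card_imset => x y /eqP; rewrite eq_porbit_mem => /porbitP[k ->].
  by rewrite expg1n perm1.
exact: (spinE_cst _ 1).
Qed.

(** Either [x] is fixed, or it has a predecessor [y] in its cycle. In the second case the two steps
    through [x] collapse into the single step [Q y x *m Q x w], and the sign of the permutation
    changes. *)
Lemma TdS_rec S Q x : x \in S ->
  TdS S Q = 2^-1 * \tr (Q x x) * TdS (S :\ x) Q
  - \sum_(y in S :\ x)
      TdS (S :\ x) (fun z w => if z == y then Q y x *m Q x w else Q z w).
Proof.
move=> xS.
have notx s z : s x = x -> z != x -> s z != x.
  by move=> sx zx; rewrite -[X in _ != X]sx (inj_eq perm_inj).
rewrite {1}/TdS (partition_big (fun s : {perm I} => s^-1%g x) (mem S)); last first.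
  by move=> s ps /=; rewrite (perm_closed _ (perm_onV ps)).
rewrite (bigD1 x) //=; congr (_ + _).
  rewrite mulr_sumr; apply: eq_big => [s|s /andP[ps /eqP sx]].
    apply/andP/perm_onP => [[/perm_onP H /eqP sx]|H].
      move=> z; rewrite !inE negb_and negbK => /orP[/eqP ->|/H //].
      by rewrite -{1}sx permKV.
    have sx : s x = x by apply: H; rewrite !inE eqxx.
    split; last by rewrite -{1}sx permK.
    by apply/perm_onP => z zS; apply: H; rewrite !inE negb_and zS orbT.
  have sx' : s x = x by rewrite -{1}sx permKV.
  rewrite [RHS]mulrCA; congr (_ * _); rewrite (sum_upd _ x) -[RHS]mulrA; congr (_ * _).
  rewrite [RHS]mulr_sumr; apply: eq_bigr => e _.
  rewrite /mxtrace mulr_suml; apply: eq_bigr => a _.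
  rewrite (big_setD1 x) //= sx' upd_same; congr (_ * _); apply: eq_bigr => z.
  by rewrite !inE => /andP[zx zS]; rewrite !upd_other // notx.
rewrite -sumrN; apply: eq_big => [y|y]; first by rewrite !inE andbC.
move=> /andP[yS yx].
pose t := tperm y x.
have tS z : z \notin S -> t z = z.
  by move=> zS; rewrite tpermD //; apply: contraNneq zS => <-.
(* Multiplying by the transposition of [y] and [x] cuts [x] out of its cycle, so the new [s] fixes
   [x]. *)
rewrite (reindex_inj (mulgI t)) /= -sumrN; apply: eq_big => [s|s].
  apply/andP/perm_onP => [[/perm_onP H /eqP sx]|H].
    have sxx : s x = x by rewrite -{1}(tpermL y x) -permM -/t -{1}sx permKV.
    move=> z; rewrite !inE negb_and negbK => /orP[/eqP ->//|zS].
    by have := H z zS; rewrite permM tS.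
  split.
    by apply/perm_onP => z zS; rewrite permM tS // H // !inE negb_and zS orbT.
  apply/eqP; apply: (perm_inj (s := (t * s)%g)).
  by rewrite permKV permM tpermL H // !inE eqxx.
move=> /andP[/perm_onP ps /eqP sy].
have sxx : s x = x.
  have : (t * s)%g y = x by rewrite -sy permKV.
  by rewrite permM tpermL.
have -> : (-1) ^+ (t * s)%g = - (-1) ^+ s :> R.
  by rewrite odd_permM odd_tperm yx signr_addb expr1 mulN1r.
(* The extra cycle is the singleton of [x]; its factor 1/2 is matched by the average over the label
   of [x]. *)
have cyc : #|porbits s| = #|porbits (t * s)|.+1.
  have := porbits_mul_tperm s y x; rewrite yx /= -/t.
  have -> : y \notin porbit s x.
    apply/porbitP => -[k] E; move: yx; rewrite E => /eqP; apply.
    by elim: k {E} => [|k IH]; rewrite ?perm1 // expgSr permM IH.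
  by rewrite /=; lia.
rewrite cyc exprS invfM !mulNr; congr (- _).
rewrite -[RHS]mulrA -[in RHS]mulrA -!mulrA; congr (_ * _).
rewrite [RHS]mulrCA; congr (_ * _).
rewrite (sum_upd _ x); congr (_ * _); apply: eq_bigr => e _.
have yS' : y \in S :\ x by rewrite !inE yx yS.
rewrite [RHS](big_setD1 y) //= eqxx mxE mulr_suml; apply: eq_bigr => a _.
rewrite (big_setD1 x) //= (big_setD1 y) //= !permM tpermL tpermR sxx.
rewrite !upd_same !upd_other ?notx // mulrCA mulrA; congr (_ * _).
apply: eq_bigr => z; rewrite !inE => /and3P[zy zx zS].
have tz : t z = z by rewrite tpermD // eq_sym.
by rewrite permM tz !upd_other ?notx // (negbTE zy).
Qed.

End TdetRecursion.

(** * Dyson's determinant of 2x2 blocks is a Pfaffian *)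

Section TdetPf.
Variables (I : finType) (T : eqType) (R : realFieldType).
Variables (p1 p2 : I -> T) (B : T -> T -> R).
Hypothesis BN : forall u v, B u v = - B v u.

Definition pts (s : seq I) := dbl [seq (p2 x, p1 x) | x <- s].

Let l (a : 'I_2) z := if a == 0 then p1 z else p2 z.
Let r (b : 'I_2) z := if b == 0 then p2 z else p1 z.
Let sg (b : 'I_2) : R := if b == 0 then -1 else 1.

(** The block of [B] on [p1, p2], multiplied on the right by the symplectic matrix with rows
    [(0, 1)] and [(-1, 0)]. *)
Definition QofB (z w : I) : 'M[R]_2 := \matrix_(a, b) (sg b * B (l a z) (r b w)).

(** Pfaffian counterpart of an open chain: it collects the signed products of blocks from [x0] to
    [x] through points of [s], together with the closed cycles on the remaining points. *)
Let G x0 x s : 'M[R]_2 := \matrix_(a, b) (sg b * pf B [:: l a x0, r b x & pts s]).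

Let contr_pts v u s : uniq s -> rsum (fun w r' => B v w * pf B (u :: r')) (pts s) =
  \sum_(y <- s) (B v (p2 y) * pf B [:: u, p1 y & pts (rem y s)]
                 - B v (p1 y) * pf B [:: u, p2 y & pts (rem y s)]).
Proof.
suff H (f : seq T -> R) : alternating f -> uniq s ->
    rsum (fun w r' => B v w * f r') (pts s) =
    \sum_(y <- s) (B v (p2 y) * f [:: p1 y & pts (rem y s)]
                 - B v (p1 y) * f [:: p2 y & pts (rem y s)]).
  by apply: H; apply: alternating_cons; apply: pf_alternating.
elim: s f => [|x s IH] f Hf /=; first by rewrite big_nil.
move=> /andP[xs us].
rewrite big_cons /= eqxx opprB addrA addrAC; congr (_ + _).
rewrite (IH (fun r' => f [:: p2 x, p1 x & r'])) //; last exact: (alternating_cons (p1 x) (alternating_cons (p2 x) Hf)).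
rewrite big_seq [RHS]big_seq; apply: eq_bigr => y ys.
have -> : (x == y) = false by apply: contraNF xs => /eqP ->.
rewrite /=.
have E w : f [:: p2 x, p1 x, w & pts (rem y s)] = f [:: w, p2 x, p1 x & pts (rem y s)].
  by rewrite (Hf [:: p2 x] (p1 x) w) (Hf [::] (p2 x) w) /= opprK.
by rewrite !E.
Qed.

(** Expansion along the index of [x]. It is matched either with the index of [x0], or with one index
    of some [y], whose other index becomes the new end of the chain. *)
Let G_rec x0 x s : uniq s ->
  G x0 x s = pf B (pts s) *: QofB x0 x - \sum_(y <- s) G x0 y (rem y s) *m QofB y x.
Proof.
move=> us; apply/matrixP => a b; rewrite !mxE summxE.
rewrite (pf_alternating BN [::]) /= pf_contr contr_cons /contr contr_pts //.
rewrite mulrN mulrBr opprB addrC (BN (r b x) (l a x0)); congr (_ + _); last by ring.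
rewrite mulr_sumr -sumrN; apply: eq_bigr => y _.
rewrite mxE sum2E !mxE /l /r /sg /= (BN (p1 y)) (BN (p2 y)); ring.
Qed.

(** The induction needs open chains as well as the closed statement: [M] is the product of the steps
    already collapsed and [x0] is the point whose row closes it. [TdS_rec] at [x] and [G_rec] are
    then the same recursion. *)
Let TdS_pf_aux n s : size s = n -> uniq s ->
  (TdS [set x in s] QofB = pf B (pts s)) /\
  (forall x0 x M, x \notin s ->
    TdS (x |: [set y in s]) (fun z w => if z == x then M *m QofB x0 w else QofB z w)
    = 2^-1 * \tr (M *m G x0 x s)).
Proof.
elim/ltn_ind: n s => n IH s sn us.
have I1 : TdS [set x in s] QofB = pf B (pts s).
  case: s sn us => [|x s] sn /=; first by rewrite finset.set_nil TdS0.
  move=> /andP[xs us]; have [|_ H] := IH (size s) _ s erefl us; first by rewrite -sn /=.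
  have -> : [set y in x :: s]%SET = (x |: [set y in s])%SET by apply/finset.setP => z; rewrite !inE.
  (* The trivial chain [M = 1], [x0 = x]. Both diagonal entries of [G x x s] are the wanted
     Pfaffian, the sign in the first being undone by a swap; the factor 1/2 averages them. *)
  rewrite (eq_TdS (Q' := fun z w => if z == x then 1%:M *m QofB x w else QofB z w)).
    rewrite H // mul1mx /mxtrace sum2E !mxE /l /r /sg /=.
    by rewrite (pf_alternating BN [::] (p1 x)) /=; lra.
  by move=> z w _ _; rewrite mul1mx; case: eqP => [->|].
split=> // x0 x M xs.
have Sx : (x |: [set y in s]) :\ x = [set y in s].
  by rewrite setU1K // inE.
rewrite (TdS_rec _ (x := x)) ?setU11 // Sx eqxx.
rewrite G_rec // mulmxBr raddfB mulrBr /=; congr (_ - _).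
  rewrite -scalemxAr mxtraceZ (eq_TdS (Q' := QofB)) ?I1; first by ring.
  by move=> z w zs ws; case: eqP zs => // ->; rewrite inE (negbTE xs).
rewrite mulmx_sumr raddf_sum mulr_sumr /=.
rewrite (eq_bigl (mem s)) => [|y]; last by rewrite inE.
rewrite -big_uniq //= big_seq [RHS]big_seq; apply: eq_bigr => y ys.
have yx : y == x = false by apply: contraNF xs => /eqP <-.
have [|_ H] := IH (size s).-1 _ (rem y s) (size_rem ys) (rem_uniq y us).
  by rewrite -sn; case: (s) ys.
have Sy : [set z in s] = y |: [set z in rem y s].
  by apply/finset.setP => z; rewrite !inE mem_rem_uniq // !inE; case: eqP => // ->.
rewrite Sy mulmxA mxtrace_mulC mulmxA -H ?mem_rem_uniqF //; apply: eq_TdS => z w.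
rewrite -Sy !inE => zs ws; rewrite yx.
case: eqP => // zy; first by rewrite mulmxA.
by case: eqP zs => // ->; rewrite (negbTE xs).
Qed.

Lemma TdS_pf s : uniq s -> TdS [set x in s] QofB = pf B (pts s).
Proof. by move=> us; case: (TdS_pf_aux erefl us). Qed.

End TdetPf.

Import numFieldNormedType.Exports.
Local Open Scope classical_set_scope.
Local Open Scope ring_scope.

(** * Real-valued Lebesgue integrals: reflection, translation, and Fubini for dominated kernels *)

Section Lebesgue.
Context {R : realType}.
Implicit Types (f g a b : R -> R).
Notation mu := (@lebesgue_measure R).

Definition itg f := mu.-integrable setT (EFin \o f).
Definition msr f := measurable_fun (setT : set R) f.
Definition bdd C f := forall x, `|f x| <= C.

Lemma eq_Leb f g : f =1 g -> Leb f = Leb g.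
Proof. by move=> fg; congr Leb; apply/funext. Qed.

Lemma itg_msr f : itg f -> msr f.
Proof. by move=> /measurable_int/measurable_EFinP. Qed.

Lemma Leb_EFin f : itg f -> (\int[mu]_x (f x)%:E)%E = (Leb f)%:E.
Proof. by move=> itf; rewrite /Leb /Rintegral fineK //; apply: integrable_fin_num. Qed.

Lemma itg_le f g : msr f -> (forall x, `|f x| <= g x) -> itg g -> itg f.
Proof.
move=> mf fg; apply: le_integrable => //; first exact/measurable_EFinP.
by move=> x _ /=; rewrite lee_fin (le_trans (fg x)) // ler_norm.
Qed.

Lemma itg_bddM a b C : msr a -> bdd C a -> itg b -> itg (fun x => a x * b x).
Proof.
move=> ma aC ib; apply: (itg_le (g := fun x => C * `|b x|)).
- by apply: measurable_funM => //; exact: itg_msr.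
- by move=> x; rewrite normrM ler_wpM2r.
have : itg (fun x => `|b x|) by apply: integrable_norm.
by move=> /(integrableZl measurableT C).
Qed.

Lemma itgB f g : itg f -> itg g -> itg (fun x => f x - g x).
Proof. by move=> /integrableB/[apply]; apply. Qed.

Lemma itgZ c f : itg f -> itg (fun x => c * f x).
Proof. by move=> /(integrableZl measurableT c). Qed.

Lemma itg0 : itg (fun _ => 0).
Proof. exact: integrable0. Qed.

Lemma LebD f g : itg f -> itg g -> Leb (fun x => f x + g x) = Leb f + Leb g.
Proof. by move=> ? ?; rewrite /Leb RintegralD. Qed.

Lemma LebB f g : itg f -> itg g -> Leb (fun x => f x - g x) = Leb f - Leb g.
Proof. by move=> ? ?; rewrite /Leb RintegralB. Qed.

Lemma LebZ c f : itg f -> Leb (fun x => c * f x) = c * Leb f.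
Proof. by move=> ?; rewrite /Leb RintegralZl. Qed.

Lemma LebN f : itg f -> Leb (fun x => - f x) = - Leb f.
Proof.
by move=> /(LebZ (-1)); rewrite mulN1r => <-; apply: eq_Leb => x; rewrite mulN1r.
Qed.

Lemma Leb0 : Leb (fun _ : R => 0) = 0.
Proof. by rewrite /Leb /Rintegral integral0. Qed.

Lemma le_Leb f g : itg f -> itg g -> (forall x, f x <= g x) -> Leb f <= Leb g.
Proof. by move=> ? ? fg; apply: le_Rintegral. Qed.

Lemma norm_Leb f : itg f -> `|Leb f| <= Leb (fun x => `|f x|).
Proof. by move=> ?; apply: le_normr_Rintegral. Qed.

Lemma lebesgue_measure_reflect (c : R) (A : set R) : measurable A ->
  pushforward mu ((fun x => c - x) : _ -> measurableTypeR R) A = mu A.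
Proof.
move=> mA; apply/esym/lebesgue_measure_unique => //=.
  exact: measurable_funB.
move=> mc _ [[u v]] _ <-.
have -> : pushforward mu ((fun x => c - x) : _ -> measurableTypeR R) `]u, v] =
    mu `[c - v, c - u[.
  rewrite /pushforward; congr (mu _); apply/seteqP; split => x /=;
    rewrite !in_itv /= => /andP[? ?]; apply/andP; split; lra.
rewrite !lebesgue_measure_itv /= !lte_fin ltrD2l ltrN2; case: ifP => // _.
by rewrite -!EFinD; congr EFin; ring.
Qed.

Lemma msr_reflect c f : msr f -> msr (fun x => f (c - x)).
Proof. by move=> mf; apply: measurableT_comp mf _; exact: measurable_funB. Qed.

Lemma ge0_integral_reflect c (g : R -> \bar R) : measurable_fun setT g ->
  (forall x, (0 <= g x)%E) -> (\int[mu]_x g (c - x)%R = \int[mu]_x g x)%E.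
Proof.
move=> mg g0.
have mc : measurable_fun setT ((fun x => c - x) : measurableTypeR R -> measurableTypeR R).
  exact: measurable_funB.
pose phi : measurableTypeR R -> measurableTypeR R := fun x => c - x.
transitivity (\int[pushforward mu phi]_x g x)%E.
  by rewrite ge0_integral_pushforward.
by apply: eq_measure_integral => A mA _; exact: lebesgue_measure_reflect.
Qed.

Lemma integral_reflect c f : msr f ->
  (\int[mu]_x (f (c - x))%:E = \int[mu]_x (f x)%:E)%E.
Proof.
move=> /measurable_EFinP mf; rewrite integralE [RHS]integralE.
have := ge0_integral_reflect c (measurable_funepos mf) (funepos_ge0 _).
have := ge0_integral_reflect c (measurable_funeneg mf) (funeneg_ge0 _).
move=> <- <-; congr (_ - _)%E; apply: eq_integral => x _.
  by rewrite -[RHS]/(((EFin \o f)^\+%E \o (fun x => c - x)) x) -funepos_comp.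
by rewrite -[RHS]/(((EFin \o f)^\-%E \o (fun x => c - x)) x) -funeneg_comp.
Qed.

Lemma Leb_reflect c f : msr f -> Leb (fun x => f (c - x)) = Leb f.
Proof. by move=> mf; rewrite /Leb /Rintegral integral_reflect. Qed.

(** A translation is a composition of two reflections. *)
Lemma Leb_shift c f : msr f -> Leb (fun x => f (x + c)) = Leb f.
Proof.
move=> mf; rewrite -(Leb_reflect 0 mf) -(Leb_reflect (- c) (msr_reflect 0 mf)).
by apply: eq_Leb => x; congr f; ring.
Qed.

Lemma itg_reflect c f : itg f -> itg (fun x => f (c - x)).
Proof.
move=> itf; have mf := itg_msr itf; case/integrableP: itf => _ fin.
apply/integrableP; split; first by apply/measurable_EFinP; apply: (msr_reflect c mf).
have mnf : msr (fun x => `|f x|) by exact: measurableT_comp.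
by have := integral_reflect c mnf => /= ->.
Qed.

Lemma fubini_kernel (k : R * R -> R) (K : R -> R -> R) b C :
  measurable_fun setT k -> (forall x y, `|k (x, y)| <= K x y) ->
  (forall y, itg (K ^~ y)) -> (forall y, Leb (K ^~ y) <= C) ->
  (forall x, exists C', forall y, K x y <= C') ->
  itg b ->
  itg (fun x => Leb (fun y => k (x, y) * b y)) /\
  Leb (fun x => Leb (fun y => k (x, y) * b y)) =
  Leb (fun y => Leb (fun x => k (x, y)) * b y).
Proof.
move=> mk kK iK LK bK ib.
have mb := itg_msr ib.
pose f (p : R * R) := (k p * b p.2)%:E.
have mf : measurable_fun setT f.
  apply/measurable_EFinP; apply: measurable_funM => //.
  by apply: measurableT_comp.
have mk1 x : msr (fun y => k (x, y)).
  by apply: measurableT_comp mk _.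
have mk2 y : msr (fun x => k (x, y)).
  by apply: measurableT_comp mk _.
have i1 x : itg (fun y => k (x, y) * b y).
  have [C' HC] := bK x.
  by apply: (itg_bddM (C := C')) => // y; exact: le_trans (kK _ _) _.
have i2 y : itg (fun x => k (x, y)) by apply: (itg_le (g := K ^~ y)).
have itf : (mu \x mu)%E.-integrable setT f.
  apply/integrable21ltyP => //.
  apply: (@le_lt_trans _ _ (\int[mu]_y (C * `|b y|)%:E)%E).
    apply: ge0_le_integral => //.
    - by move=> y _; apply: integral_ge0.
    - have maf : measurable_fun setT (abse \o f) by exact: measurableT_comp.
      have := @measurable_fun_fubini_tonelli_G _ _ _ _ R mu _ maf.
      by move=> H; exact: (H (fun p => abse_ge0 _)).
    - apply/measurable_EFinP; apply: measurable_funM => //; exact: measurableT_comp.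
    move=> y _.
    have -> : (\int[mu]_x `|f (x, y)| = (\int[mu]_x (`|b y| * `|k (x, y)|)%:E))%E.
      by apply: eq_integral => x _; rewrite /f /= normrM mulrC.
    have ik : itg (fun x => `|k (x, y)|) by exact: (integrable_norm (i2 y)).
    rewrite Leb_EFin; last exact: itgZ.
    rewrite LebZ // lee_fin mulrC ler_wpM2r //.
    by apply: le_trans (LK y); apply: le_Leb.
  have : itg (fun y => C * `|b y|) by apply: itgZ; apply: integrable_norm.
  by move=> ic; rewrite Leb_EFin // ltry.
split.
  move: (integrable_fubini_F itf); apply: eq_integrable => // x _.
  by rewrite /fubini_F [LHS]Leb_EFin.
have H := Fubini itf.
rewrite [LHS](_ : _ = fine (\int[mu]_x \int[mu]_y f (x, y))%E); last first.
  rewrite /Leb /Rintegral; congr fine; apply: eq_integral => x _.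
  by rewrite -Leb_EFin.
rewrite [RHS](_ : _ = fine (\int[mu]_y \int[mu]_x f (x, y))%E); last first.
  rewrite /Leb /Rintegral; congr fine; apply: eq_integral => y _.
  transitivity (\int[mu]_x ((b y * k (x, y))%:E))%E.
    by rewrite (Leb_EFin (itgZ (b y) (i2 y))) (LebZ (b y) (i2 y)) mulrC.
  by apply: eq_integral => x _; rewrite mulrC.
by rewrite H.
Qed.

End Lebesgue.

(** * The heat semigroup and the smoothed sign function *)

Section HeatKernel.
Context {R : realType}.
Implicit Types (f g a b : R -> R) (s v x y z : R).
Notation mu := (@lebesgue_measure R).

(** Tonelli gives measurability for nonnegative kernels; the signed [k] is the difference of [k + K]
    and [K], both nonnegative. *)
Lemma msr_Leb_kernel (k K : R * R -> R) :
  measurable_fun setT k -> measurable_fun setT K ->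
  (forall p, `|k p| <= K p) -> (forall y, itg (fun x => K (x, y))) ->
  msr (fun y => Leb (fun x => k (x, y))).
Proof.
move=> mk mK kK iK.
have mk2 y : msr (fun x => k (x, y)) by apply: measurableT_comp mk _.
have ik y : itg (fun x => k (x, y)) by apply: (itg_le (g := fun x => K (x, y))).
have tonelli (h : R * R -> R) : measurable_fun setT h -> (forall p, 0 <= h p) ->
    msr (fun y => Leb (fun x => h (x, y))).
  move=> mh h0; have meh : measurable_fun setT (EFin \o h) by exact/measurable_EFinP.
  have H := @measurable_fun_fubini_tonelli_G _ _ _ _ R mu _ meh (fun p => h0 p).
  exact: measurableT_comp (fine_measurable measurableT) H.
rewrite (_ : (fun y => _) = (fun y => Leb (fun x => k (x, y) + K (x, y))
    - Leb (fun x => K (x, y)))).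
  apply: measurable_funB.
    apply: (tonelli (fun p => k p + K p)); first exact: measurable_funD.
    by move=> p; have := kK p; rewrite ler_norml => /andP[]; lra.
  by apply: tonelli => // p; apply: le_trans (kK p).
by apply/funext => y; rewrite LebD // addrK.
Qed.

Lemma msr_cst (c : R) : msr (fun _ => c).
Proof. by rewrite /msr; exact: measurable_cst. Qed.

Lemma pk_sym s x y : pk s x y = pk s y x.
Proof. by rewrite /pk -sqrrN opprB. Qed.

Lemma pkB s x y : pk s x y = pk s (x - y) 0.
Proof. by rewrite /pk subr0. Qed.

Lemma pk_ge0 s x y : 0 <= pk s x y.
Proof. by rewrite /pk mulr_ge0 ?invr_ge0 ?sqrtr_ge0 ?expR_ge0. Qed.

Lemma pk_ub s x y : 0 < s -> pk s x y <= (Num.sqrt (2 * pi * s))^-1.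
Proof.
move=> s0; rewrite /pk ler_piMr ?invr_ge0 ?sqrtr_ge0 // -[leRHS]expR0 ler_expR.
by rewrite mulNr oppr_le0 divr_ge0 ?sqr_ge0 // mulr_ge0 // ltW.
Qed.

Lemma pk_normal s x : 0 < s -> pk s x = normal_pdf x (Num.sqrt s).
Proof.
move=> s0; apply/funext => y; rewrite normal_pdfE ?gt_eqF ?sqrtr_gt0 //.
rewrite /normal_peak /normal_fun sqr_sqrtr ?(ltW s0) // /pk.
congr ((Num.sqrt _)^-1 * expR _); first by rewrite -mulr_natl; ring.
by rewrite -[x - y]opprB sqrrN -[s *+ 2]mulr_natl.
Qed.

Lemma itg_pk s x : 0 < s -> itg (pk s x).
Proof. by move=> s0; rewrite pk_normal //; exact: integrable_normal_pdf. Qed.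

Lemma itg_pk_l s y : 0 < s -> itg (pk s ^~ y).
Proof.
move=> s0; rewrite (_ : pk s ^~ y = pk s y); first exact: itg_pk.
by apply/funext => x; rewrite pk_sym.
Qed.

Lemma Leb_pk s x : 0 < s -> Leb (pk s x) = 1.
Proof.
by move=> s0; rewrite pk_normal // /Leb /Rintegral integral_normal_pdf.
Qed.

Lemma msr2_pk s : measurable_fun setT (fun p : R * R => pk s p.1 p.2).
Proof.
apply: measurable_funM => //; apply: measurableT_comp => //.
apply: measurable_funM => //; apply: measurableT_comp => //.
by apply: measurable_funX; exact: measurable_funB.
Qed.

Lemma bdd_pk s x : 0 < s -> bdd (Num.sqrt (2 * pi * s))^-1 (pk s x).
Proof. by move=> s0 y; rewrite ger0_norm ?pk_ge0 ?pk_ub. Qed.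

Lemma msr_pk s x : 0 < s -> msr (pk s x).
Proof. by move=> /(itg_pk x)/itg_msr. Qed.

(** Completing the square in [y]: the second factor is the law of the Brownian bridge at the
    intermediate time, of total mass 1, so the semigroup law [pk_conv] follows at once. *)
Lemma pk_mul s v x y z : 0 < s -> 0 < v ->
  pk s x y * pk v y z =
  pk (s + v) x z * pk (s * v / (s + v)) ((v * x + s * z) / (s + v)) y.
Proof.
move=> s0 v0; have sv0 : 0 < s + v by lra.
have pi0 := @pi_gt0 R.
rewrite /pk mulrACA [RHS]mulrACA -!invfM -!expRD; congr (_^-1 * expR _).
  have pos (u : R) : 0 < u -> 0 <= 2 * pi * u by move=> u0; rewrite ltW // !mulr_gt0.
  rewrite -(sqrtrM _ (pos _ s0)) -(sqrtrM _ (pos _ sv0)).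
  by congr Num.sqrt; field; rewrite gt_eqF.
by field; rewrite !gt_eqF.
Qed.

Lemma pk_conv s v x z : 0 < s -> 0 < v ->
  Leb (fun y => pk s x y * pk v y z) = pk (s + v) x z.
Proof.
move=> s0 v0; have w0 : 0 < s * v / (s + v) by rewrite divr_gt0 ?mulr_gt0 //; lra.
rewrite (eq_Leb (fun y => pk_mul x y z s0 v0)) LebZ ?Leb_pk ?mulr1 //.
exact: itg_pk.
Qed.

Lemma heat0 x f : heat 0 x f = f x.
Proof. by rewrite /heat eqxx. Qed.

Lemma heatE s x f : 0 < s -> heat s x f = Leb (fun y => pk s x y * f y).
Proof. by move=> s0; rewrite /heat gt_eqF. Qed.

Lemma eq_heat s x f g : f =1 g -> heat s x f = heat s x g.
Proof. by move=> /funext ->. Qed.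

Lemma itg_pkM s x f C : 0 < s -> msr f -> bdd C f -> itg (fun y => pk s x y * f y).
Proof.
move=> s0 mf fC; have : itg (fun y => f y * pk s x y) by apply: itg_bddM (itg_pk x s0).
by apply: eq_integrable => // y _ /=; rewrite mulrC.
Qed.

Lemma itg_pkM' s x f : 0 < s -> itg f -> itg (fun y => pk s x y * f y).
Proof. by move=> s0; apply: itg_bddM (bdd_pk x s0); exact: msr_pk. Qed.

Lemma bdd_heat s f C : 0 <= s -> msr f -> bdd C f -> bdd C (fun x => heat s x f).
Proof.
rewrite le_eqVlt => /predU1P[<- _ fC x|s0 mf fC x]; first by rewrite heat0.
rewrite heatE // (le_trans (norm_Leb (itg_pkM x s0 mf fC))) //.
have -> : C = Leb (fun y => C * pk s x y) by rewrite LebZ ?Leb_pk ?mulr1 //; exact: itg_pk.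
apply: le_Leb; first exact: (integrable_norm (itg_pkM x s0 mf fC)).
  by apply: itgZ; exact: itg_pk.
by move=> y; rewrite normrM mulrC [X in _ * X]ger0_norm ?pk_ge0 // ler_wpM2r ?pk_ge0.
Qed.

Lemma bdd_ge0 f C : bdd C f -> 0 <= C.
Proof. by move=> /(_ 0); apply: le_trans. Qed.

Lemma msr_heat s f C : 0 <= s -> msr f -> bdd C f -> msr (fun x => heat s x f).
Proof.
rewrite le_eqVlt => /predU1P[<- mf _|s0 mf fC].
  by rewrite (_ : (fun x => _) = f) //; apply/funext => x; rewrite heat0.
rewrite (_ : (fun x => _) = (fun x => Leb (fun y => f y * pk s y x))); last first.
  by apply/funext => x; rewrite heatE //; apply: eq_Leb => y; rewrite mulrC pk_sym.
apply: (@msr_Leb_kernel (fun p => f p.1 * pk s p.1 p.2) (fun p => C * pk s p.1 p.2)).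
- by apply: measurable_funM; [exact: measurableT_comp|exact: msr2_pk].
- by apply: measurable_funM => //; exact: msr2_pk.
- by move=> p; rewrite normrM [`|pk _ _ _|]ger0_norm ?pk_ge0 // ler_wpM2r ?pk_ge0.
by move=> y; apply: itgZ; exact: itg_pk_l.
Qed.

(** Self-adjointness of the heat operator, by Fubini and the symmetry of the kernel. Most later
    identities move [heat] from one factor to the other in this way. *)
Lemma heat_dual s a b C : 0 <= s -> msr a -> bdd C a -> itg b ->
  itg (fun x => a x * heat s x b) /\
  Leb (fun x => a x * heat s x b) = Leb (fun y => heat s y a * b y).
Proof.
rewrite le_eqVlt => /predU1P[<- ma aC ib|s0 ma aC ib].
  split; last by apply: eq_Leb => x; rewrite !heat0.
  by apply: eq_integrable (itg_bddM ma aC ib) => // x _ /=; rewrite heat0.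
have C0 := bdd_ge0 aC.
have [] := @fubini_kernel R (fun p => a p.1 * pk s p.1 p.2)
  (fun x y => C * pk s x y) b C _ _ _ _ _ ib.
- by apply: measurable_funM; [exact: measurableT_comp|exact: msr2_pk].
- by move=> x y /=; rewrite normrM [`|pk _ _ _|]ger0_norm ?pk_ge0 // ler_wpM2r ?pk_ge0.
- by move=> y; apply: itgZ; exact: itg_pk_l.
- move=> y; rewrite LebZ; last exact: itg_pk_l.
  by rewrite (eq_Leb (fun x => pk_sym s x y)) Leb_pk // mulr1.
- move=> x; exists (C * (Num.sqrt (2 * pi * s))^-1) => y.
  by rewrite ler_wpM2l ?pk_ub.
have E x : Leb (fun y => a x * pk s x y * b y) = a x * heat s x b.
  rewrite heatE // -LebZ; last exact: itg_pkM'.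
  by apply: eq_Leb => y; rewrite mulrA.
move=> /= i1 e; split.
  by apply: eq_integrable i1 => // x _ /=; rewrite E.
rewrite (eq_Leb (g := fun x => Leb (fun y => a x * pk s x y * b y))) // e.
apply: eq_Leb => y; congr (_ * _); rewrite heatE //; apply: eq_Leb => x.
by rewrite mulrC pk_sym.
Qed.

Lemma itg_heat s b : 0 <= s -> itg b -> itg (fun x => heat s x b).
Proof.
move=> s0 ib; have b1 : bdd 1 (fun _ : R => 1) by move=> x; rewrite normr1.
have [+ _] := heat_dual s0 (msr_cst 1) b1 ib.
by apply: eq_integrable => // x _ /=; rewrite mul1r.
Qed.

Lemma heat_pk s v x z : 0 < s -> 0 < v -> heat v z (pk s x) = pk (s + v) x z.
Proof.
move=> s0 v0; rewrite (heatE _ _ v0) -(pk_conv _ _ s0 v0); apply: eq_Leb => y.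
by rewrite mulrC (pk_sym v).
Qed.

Lemma heat_heat s v x f C : 0 <= s -> 0 <= v -> msr f -> bdd C f ->
  heat s x (fun y => heat v y f) = heat (s + v) x f.
Proof.
rewrite le_eqVlt => /predU1P[<-|s0]; first by rewrite heat0 add0r.
rewrite le_eqVlt => /predU1P[<- _ _|v0 mf fC].
  by rewrite addr0; apply: eq_heat => y; rewrite heat0.
have [_ H] := heat_dual (ltW v0) mf fC (itg_pk x s0).
rewrite heatE // (eq_Leb (g := fun y => heat v y f * pk s x y)); last by move=> y; rewrite mulrC.
rewrite -H heatE ?addr_gt0 //; apply: eq_Leb => y.
by rewrite heat_pk // mulrC.
Qed.

Lemma heat_heat_itg s v x g : 0 <= s -> 0 <= v -> itg g ->
  heat s x (fun y => heat v y g) = heat (s + v) x g.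
Proof.
rewrite le_eqVlt => /predU1P[<-|s0]; first by rewrite heat0 add0r.
rewrite le_eqVlt => /predU1P[<- _|v0 ig].
  by rewrite addr0; apply: eq_heat => y; rewrite heat0.
have [_ H] := heat_dual (ltW v0) (msr_pk x s0) (bdd_pk x s0) ig.
rewrite heatE // H heatE ?addr_gt0 //; apply: eq_Leb => y.
by rewrite heat_pk.
Qed.

Lemma heatB s x f g C D : 0 <= s -> msr f -> bdd C f -> msr g -> bdd D g ->
  heat s x (fun y => f y - g y) = heat s x f - heat s x g.
Proof.
rewrite le_eqVlt => /predU1P[<-|s0 mf fC mg gD]; first by rewrite !heat0.
rewrite !heatE // -LebB; [|exact: itg_pkM fC|exact: itg_pkM gD].
by apply: eq_Leb => y; rewrite mulrBr.
Qed.

Lemma heat_shift s x c f C : 0 <= s -> msr f -> bdd C f ->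
  heat s x (fun y => f (y - c)) = heat s (x - c) f.
Proof.
rewrite le_eqVlt => /predU1P[<-|s0 mf fC]; first by rewrite !heat0.
rewrite !heatE // -[RHS](Leb_shift (- c)); last exact: itg_msr (itg_pkM _ s0 mf fC).
apply: eq_Leb => y; rewrite pkB [pk _ (x - c) _]pkB.
by have -> : x - c - (y - c) = x - y by ring.
Qed.

Lemma heat_reflect s x c f C : 0 <= s -> msr f -> bdd C f ->
  heat s x (fun y => f (c - y)) = heat s (c - x) f.
Proof.
rewrite le_eqVlt => /predU1P[<-|s0 mf fC]; first by rewrite !heat0.
rewrite !heatE // -[RHS](Leb_reflect c); last exact: itg_msr (itg_pkM _ s0 mf fC).
apply: eq_Leb => y; rewrite pk_sym pkB [pk _ (c - x) _]pkB.
by have -> : c - x - (c - y) = y - x by ring.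
Qed.

(** The mean of the sign of a normal variable of mean [d] and variance [v], an error function; at
    [v = 0] it is the sign itself. *)
Definition psi v d : R := heat v d Num.sg.

Lemma msr_le0 : msr (fun u : R => (0 <= u)%R%:R).
Proof.
rewrite (_ : (fun u => _) = \1_(`[0, +oo[ : set R)).
  exact: measurable_indic.
by apply/funext => u; rewrite indicE mem_setE in_itv /= andbT.
Qed.

Lemma msr_ge0 : msr (fun u : R => (u <= 0)%R%:R).
Proof.
rewrite (_ : (fun u => _) = \1_(`]-oo, 0] : set R)).
  exact: measurable_indic.
by apply/funext => u; rewrite indicE mem_setE in_itv /=.
Qed.

Lemma bdd_bool (P : R -> bool) : bdd 1 (fun u => (P u)%:R).
Proof. by move=> u; case: (P u); rewrite ?normr1 ?normr0. Qed.

Lemma sg_le (u : R) : Num.sg u = (0 <= u)%R%:R - (u <= 0)%R%:R.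
Proof. by case: sgrP => //; rewrite ?subr0 ?sub0r ?subrr. Qed.

Lemma msr_sg : msr (Num.sg : R -> R).
Proof.
rewrite (_ : Num.sg = fun u : R => (0 <= u)%R%:R - (u <= 0)%R%:R).
  by apply: measurable_funB; [exact: msr_le0|exact: msr_ge0].
by apply/funext => u; rewrite sg_le.
Qed.

Lemma bdd_sg : bdd 1 (Num.sg : R -> R).
Proof. by move=> u; rewrite normr_sg; case: eqP => _; rewrite ?ler01. Qed.

Lemma msr_psi v : 0 <= v -> msr (psi v).
Proof. by move=> v0; apply: msr_heat v0 msr_sg bdd_sg. Qed.

Lemma bdd_psi v : 0 <= v -> bdd 1 (psi v).
Proof. by move=> v0; apply: bdd_heat v0 msr_sg bdd_sg. Qed.

Lemma heat_psi s v x : 0 <= s -> 0 <= v -> heat s x (psi v) = psi (s + v) x.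
Proof. by move=> s0 v0; rewrite /psi (heat_heat _ s0 v0 msr_sg bdd_sg). Qed.

Lemma psiN v d : 0 <= v -> psi v (- d) = - psi v d.
Proof.
move=> v0; rewrite /psi -[- d]add0r -(heat_reflect _ _ v0 msr_sg bdd_sg).
have -> : heat v d (fun y => Num.sg (0 - y)) = heat v d (fun y => 0 - Num.sg y).
  by apply: eq_heat => y; rewrite !sub0r sgrN.
rewrite (heatB _ v0 (C := 0) (D := 1)).
- have -> : heat v d (fun _ => 0) = 0; last by rewrite sub0r.
  move: v0; rewrite le_eqVlt => /predU1P[<-|v0]; first by rewrite heat0.
  by rewrite heatE // -[RHS](@Leb0 R); apply: eq_Leb => y; rewrite mulr0.
- exact: msr_cst.
- by move=> x; rewrite normr0.
- exact: msr_sg.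
- exact: bdd_sg.
Qed.

(** [F] is the mean of [sgn(w - z)] for independent normal [z] and [w] of means [x] and [y]; the
    difference [w - z] has mean [y - x] and the sum of the variances. Variance 0 is included. *)
Lemma F_psi (T : R) (t : nat -> R) m n x y : t m <= T -> t n <= T ->
  F T t m n x y = psi ((T - t m) + (T - t n)) (y - x).
Proof.
rewrite -(subr_ge0 (t m)) -(subr_ge0 (t n)) /F.
set a := T - t m; set b := T - t n => a0 b0.
have E1 z : heat b y (fun w => (z <= w)%R%:R) = heat b (y - z) (fun u => (0 <= u)%R%:R).
  rewrite -(heat_shift _ _ b0 msr_le0 (bdd_bool _)); apply: eq_heat => w.
  by rewrite subr_ge0.
have E2 w : heat b y (fun z => (z <= w)%R%:R) = heat b (y - w) (fun u => (u <= 0)%R%:R).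
  rewrite -(heat_shift _ _ b0 msr_ge0 (bdd_bool _)); apply: eq_heat => z.
  by rewrite subr_le0.
rewrite (eq_heat _ _ E1) (eq_heat _ _ E2).
have mU := msr_heat b0 msr_le0 (bdd_bool _).
have mV := msr_heat b0 msr_ge0 (bdd_bool _).
have bU := bdd_heat b0 msr_le0 (bdd_bool _).
have bV := bdd_heat b0 msr_ge0 (bdd_bool _).
have -> : heat a x (fun z => heat b (y - z) (fun u => (0 <= u)%R%:R)) = _ :=
  heat_reflect x y a0 mU bU.
have -> : heat a x (fun z => heat b (y - z) (fun u => (u <= 0)%R%:R)) = _ :=
  heat_reflect x y a0 mV bV.
have <- : _ = _ - _ := heatB (y - x) a0 mU bU mV bV.
rewrite -heat_psi //; apply: eq_heat => u; rewrite /psi.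
have <- : _ = _ - _ := heatB u b0 msr_le0 (bdd_bool _) msr_ge0 (bdd_bool _).
by apply: eq_heat => z; rewrite sg_le.
Qed.

End HeatKernel.

(** * Integrals of derivatives over the line and half-lines *)

Section Ftc.
Context {R : realType}.
Implicit Types (f h : R -> R) (s v x y z c : R).
Notation mu := (@lebesgue_measure R).

(** Fundamental theorem on each [[u n, v n]], then dominated convergence: at every point the
    indicator of the interval is eventually that of [J]. *)
Lemma Leb_deriv f h (u v : nat -> R) (J : R -> bool) (l : R) :
  (forall x, is_derive x 1 f (h x)) -> continuous h -> itg h ->
  (forall n, u n < v n) ->
  (forall x, exists N, forall n, (N <= n)%N -> (u n <= x <= v n) = J x) ->
  (fun n => f (v n) - f (u n)) @ \oo --> l ->
  Leb (fun y => h y * (J y)%:R) = l.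
Proof.
move=> df ch ih uv uJ fl.
have mh := itg_msr ih.
have dfx x : derivable f x 1 by have [] := df x.
have cf : continuous f by move=> x; apply: differentiable_continuous; apply/derivable1_diffP.
pose g n y := (h y * (u n <= y <= v n)%R%:R)%:E.
have mg n : measurable_fun setT (g n).
  apply/measurable_EFinP; apply: measurable_funM => //.
  rewrite (_ : (fun y => _) = \1_(`[u n, v n] : set R)); first exact: measurable_indic.
  by apply/funext => y; rewrite indicE mem_setE in_itv.
have cvg_g y : g ^~ y @ \oo --> (h y * (J y)%:R)%:E.
  have [N HN] := uJ y; apply: cvg_near_cst; exists N => // n /= Nn.
  by rewrite /g HN.
have mJ : measurable_fun setT (fun y => (h y * (J y)%:R)%:E).
  by apply: (emeasurable_fun_cvg g) => // y _; exact: cvg_g.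
have intg n : (\int[mu]_y g n y = (f (v n) - f (u n))%:E)%E.
  have <- : (\int[mu]_(x in `[u n, v n]) (h x)%:E = (f (v n) - f (u n))%:E)%E.
    rewrite (@continuous_FTC2 R h f) //.
    - exact: continuous_subspaceT.
    - split=> [x _|//|]; first exact: dfx.
      + by apply: cvg_at_right_filter; exact: cf.
      + by apply: cvg_at_left_filter; exact: cf.
    - by move=> x _; rewrite derive1E; exact: derive_val.
  rewrite [RHS]integral_mkcond; apply: eq_integral => y _.
  rewrite /g patchE mem_setE in_itv /=.
  by case: ifP => _; rewrite ?mulr1 ?mulr0.
have bg : {ae mu, forall y n, [set: R] y -> (`|g n y| <= (EFin \o (fun z => `|h z|)%R) y)%E}.
  apply: aeW => y n _; rewrite /g /= lee_fin normrM.
  by case: (_ <= _ <= _); rewrite ?normr1 ?normr0 ?mulr1 ?mulr0.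
have cg : {ae mu, forall y, [set: measurableTypeR R] y ->
    g ^~ y @ \oo --> (h y * (J y)%:R)%:E} by apply: aeW => y _; exact: cvg_g.
have [iJ _ H] := @dominated_convergence _ (measurableTypeR R) R mu setT measurableT
  g (fun y => (h y * (J y)%:R)%:E) (EFin \o (fun z => `|h z|)%R) mg mJ
  cg (integrable_norm ih) bg.
have H2 : (fun n => (f (v n) - f (u n))%:E) @ \oo --> (Leb (fun y => h y * (J y)%:R))%:E.
  rewrite -Leb_EFin //.
  by move: H; rewrite (_ : (fun n => _) = (fun n => (f (v n) - f (u n))%:E)) //;
    apply/funext => n; rewrite -intg.
have H3 : (fun n => (f (v n) - f (u n))%:E) @ \oo --> l%:E by apply: cvg_EFin => //; exact: nearW.
apply/eqP; rewrite -eqe; apply/eqP.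
exact: (cvg_unique (@ereal_hausdorff R) H2 H3).
Qed.

Lemma decay_cvg f C c (e : R) : `|e| = 1 -> (forall x, `|x * f x| <= C) ->
  (fun n => f (e * (`|c| + n.+1%:R))) @ \oo --> (0 : R).
Proof.
move=> e1 fC; have C0 : 0 <= C by apply: le_trans (fC 0).
have H n : `|f (e * (`|c| + n.+1%:R))| <= C * n.+1%:R^-1.
  have n0 : 0 < n.+1%:R :> R by rewrite ltr0n.
  rewrite ler_pdivlMr // mulrC; apply: le_trans (fC (e * (`|c| + n.+1%:R))).
  have c0 := normr_ge0 c; have c1 : 0 <= `|c| + n.+1%:R by lra.
  rewrite normrM normrM e1 mul1r ler_wpM2r // (ger0_norm c1); lra.
have cC : (fun n => C * n.+1%:R^-1) @ \oo --> (0 : R).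
  by rewrite -[X in _ --> X](mulr0 C); apply: cvgMr; exact: cvg_harmonic.
apply: (@squeeze_cvgr _ _ _ _ (fun n => - (C * n.+1%:R^-1)) (fun n => C * n.+1%:R^-1)) => //.
- by near=> n; rewrite -ler_norml.
- by rewrite -[X in _ --> X]oppr0; apply: cvgN.
Unshelve. all: by end_near. Qed.

Lemma Leb_deriv_decay f h C : (forall x, is_derive x 1 f (h x)) -> continuous h ->
  itg h -> (forall x, `|x * f x| <= C) ->
  [/\ forall c, Leb (fun y => h y * (c <= y)%R%:R) = - f c,
      forall c, Leb (fun y => h y * (y <= c)%R%:R) = f c & Leb h = 0].
Proof.
move=> df ch ih fC.
have up c : (fun n => f (`|c| + n.+1%:R)) @ \oo --> (0 : R).
  have := decay_cvg c (normr1 R) fC.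
  by rewrite (_ : (fun n => _) = (fun n => f (`|c| + n.+1%:R))) //; apply/funext => n; rewrite mul1r.
have down c : (fun n => f (- (`|c| + n.+1%:R))) @ \oo --> (0 : R).
  have := decay_cvg c (normrN1 R) fC.
  by rewrite (_ : (fun n => _) = (fun n => f (- (`|c| + n.+1%:R)))) //; apply/funext => n; rewrite mulN1r.
have bnd x : exists N, forall n, (N <= n)%N -> `|x| <= n.+1%:R.
  exists (Num.bound `|x|) => n Nn; rewrite (le_trans (ltW (archi_boundP _))) // ler_nat; lia.
have lt1 (c : R) n : c < `|c| + n.+1%:R.
  by rewrite (le_lt_trans (ler_norm c)) // ltrDl ltr0n.
have lt2 (c : R) n : - (`|c| + n.+1%:R) < c.
  by have := lt1 (- c) n; rewrite normrN; lra.
split=> [c|c|].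
- apply: (Leb_deriv (f := f) (u := fun => c) (v := fun n => `|c| + n.+1%:R)) => //.
    move=> x; have [N HN] := bnd x; exists N => n /HN xn.
    by case: (c <= x) => //=; have := ler_norm x; have := normr_ge0 c; lra.
  by rewrite -[X in _ --> X]sub0r; apply: cvgB; [exact: up|exact: cvg_cst].
- apply: (Leb_deriv (f := f) (u := fun n => - (`|c| + n.+1%:R)) (v := fun => c)) => //.
    move=> x; have [N HN] := bnd x; exists N => n /HN xn.
    rewrite andb_idl // => _.
    by have := ler_norm (- x); rewrite normrN; have := normr_ge0 c; lra.
  by rewrite -[X in _ --> X]subr0; apply: cvgB; [exact: cvg_cst|exact: down].
rewrite -(eq_Leb (f := fun y => h y * true%:R)); last by move=> y; rewrite mulr1.
apply: (Leb_deriv (f := f) (u := fun n => - (`|0| + n.+1%:R)) (v := fun n => `|0| + n.+1%:R)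
  (J := fun => true)) => //.
- by move=> n; apply: lt_trans (lt2 0 n) (lt1 0 n).
- move=> x; have [N HN] := bnd x; exists N => n /HN xn.
  by rewrite normr0 add0r -ler_norml.
by rewrite -[X in _ --> X]subr0; apply: cvgB; [exact: up|exact: down].
Qed.

End Ftc.

(** * Polynomials times a Gaussian: bounds and integration by parts *)

Section GaussianPoly.
Context {R : realType}.
Implicit Types (p q u : {poly R}) (s v x y c : R).

Definition pg s p x : R := p.[x] * pk s 0 x.

Lemma is_derive_continuous (f h : R -> R) : (forall x, is_derive x 1 f (h x)) -> continuous f.
Proof.
move=> df x; have [dfx _] := df x.
by apply: differentiable_continuous; apply/derivable1_diffP.
Qed.

(** For [|x| > 1] the power is at most [|x|^(2n+2)], which is compared with the term of degree [n+1]
    of the exponential series; the summand 1 covers [|x| <= 1]. *)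
Lemma monomial_expR_bound s n x : 0 < s ->
  `|x| ^+ n <= (1 + (4 * s) ^+ n.+1 * (n.+1)`!%:R) * expR (x ^+ 2 / (4 * s)).
Proof.
move=> s0; set y := x ^+ 2 / _.
have y0 : 0 <= y by rewrite divr_ge0 ?sqr_ge0 //; lra.
have fac : 0 < (n.+1)`!%:R :> R by rewrite ltr0n fact_gt0.
have e1 : 1 <= expR y by rewrite -[leLHS]expR0 ler_expR.
have H := expR_ge1Dxn n y0.
have Hy : `|x| ^+ (n.+1).*2 <= (4 * s) ^+ n.+1 * (n.+1)`!%:R * expR y.
  have -> : `|x| ^+ (n.+1).*2 = (4 * s) ^+ n.+1 * (n.+1)`!%:R * (y ^+ n.+1 / (n.+1)`!%:R).
    rewrite -mul2n exprM real_normK ?num_real // /y expr_div_n.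
    by field; rewrite expf_neq0 ?gt_eqF //; lra.
  rewrite ler_wpM2l //; last by lra.
  by rewrite mulr_ge0 ?exprn_ge0 //; lra.
rewrite mulrDl mul1r; have [x1|x1] := leP `|x| 1.
  have := exprn_ile1 n (normr_ge0 x) x1.
  by have := le_trans (exprn_ge0 _ (normr_ge0 x)) Hy; lra.
have : `|x| ^+ n <= `|x| ^+ (n.+1).*2 by rewrite ler_eXn2l //; lia.
by lra.
Qed.

Lemma pg_bound s p : 0 < s -> exists C, forall x, `|pg s p x| <= C * pk (2 * s) 0 x.
Proof.
move=> s0.
pose K i := `|p`_i| * (1 + (4 * s) ^+ i.+1 * (i.+1)`!%:R).
have pi0 := @pi_gt0 R.
exists ((\sum_(i < size p) K i) * ((Num.sqrt (2 * pi * s))^-1 * Num.sqrt (2 * pi * (2 * s)))) => x.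
have Hp : `|p.[x]| <= (\sum_(i < size p) K i) * expR (x ^+ 2 / (4 * s)).
  rewrite horner_coef mulr_suml (le_trans (ler_norm_sum _ _ _)) //.
  apply: ler_sum => i _; rewrite normrM normrX /K -mulrA ler_wpM2l //.
  exact: monomial_expR_bound.
rewrite /pg normrM [`|pk _ _ _|]ger0_norm ?pk_ge0 //.
apply: (le_trans (ler_wpM2r (pk_ge0 _ _ _) Hp)).
set S := \sum_(_ < _) _; set d := Num.sqrt (2 * pi * (2 * s)).
have S0 : 0 <= S.
  by apply: sumr_ge0 => i _; rewrite mulr_ge0 // addr_ge0 // mulr_ge0 // exprn_ge0 //; lra.
have d0 : d != 0 by rewrite gt_eqF // sqrtr_gt0 !mulr_gt0.
(* The exponent [x^2/(4s) - x^2/(2s)] is that of variance [2s], so only the normalising constants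
   differ. *)
suff H : expR (x ^+ 2 / (4 * s)) * pk s 0 x <=
    ((Num.sqrt (2 * pi * s))^-1 * d) * pk (2 * s) 0 x.
  by rewrite -(mulrA S) -(mulrA S); apply: ler_wpM2l.
rewrite /pk -/d !sub0r !sqrrN -[leRHS]mulrA mulVKf //.
rewrite mulrCA -expRD ler_wpM2l ?invr_ge0 ?sqrtr_ge0 // ler_expR.
by rewrite le_eqVlt; apply/orP; left; apply/eqP; field; rewrite gt_eqF.
Qed.

End GaussianPoly.

Section GaussianIbp.
Context {R : realType}.
Implicit Types (p q u : {poly R}) (s v x y c : R).
Notation mu := (@lebesgue_measure R).

Lemma is_derive_pk v y x : 0 < v -> is_derive x 1 (pk v y) (pk v y x * ((y - x) / v)).
Proof.
move=> v0; pose P : {poly R} := (- (2 * v)^-1) *: ((y%:P - 'X) * (y%:P - 'X)).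
have E : pk v y = (Num.sqrt (2 * pi * v))^-1 \*: (expR \o horner P).
  apply/funext => z; rewrite -[RHS]/((Num.sqrt (2 * pi * v))^-1 * expR P.[z]).
  rewrite /pk; congr (_ * expR _); rewrite /P hornerZ hornerM hornerD hornerN hornerX hornerC.
  by field; rewrite gt_eqF.
have dP : P^`().[x] = (y - x) / v.
  rewrite /P derivZ derivM derivB derivC derivX !hornerE.
  by field; rewrite gt_eqF.
rewrite E.
have D := is_deriveZ ((Num.sqrt (2 * pi * v))^-1)
  (is_derive1_comp (is_derive_expR P.[x]) (is_derive_poly P x)).
apply: is_derive_eq D _; rewrite dP; exact: mulrA.
Qed.

Lemma pgD s p q x : pg s (p + q) x = pg s p x + pg s q x.
Proof. by rewrite /pg hornerD mulrDl. Qed.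

Lemma pgZ s c p x : pg s (c *: p) x = c * pg s p x.
Proof. by rewrite /pg hornerZ -mulrA. Qed.

Lemma pgN s p x : pg s (- p) x = - pg s p x.
Proof. by rewrite /pg hornerN mulNr. Qed.

Lemma pgC s c p x : pg s (c%:P * p) x = c * pg s p x.
Proof. by rewrite mul_polyC pgZ. Qed.

Lemma pgX s p x : pg s ('X * p) x = x * pg s p x.
Proof. by rewrite /pg hornerM hornerX -mulrA. Qed.

Lemma is_derive_pg s p x : 0 < s ->
  is_derive x 1 (pg s p) (pg s (p^`() - s^-1 *: ('X * p)) x).
Proof.
move=> s0; have D := is_deriveM (is_derive_poly p x) (is_derive_pk 0 x s0).
apply: is_derive_eq D _.
rewrite pgD pgN pgZ pgX /pg.
rewrite -[LHS]/(p.[x] * (pk s 0 x * ((0 - x) / s)) + pk s 0 x * p^`().[x]); ring.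
Qed.

Lemma continuous_pg s p : 0 < s -> continuous (pg s p).
Proof. by move=> s0; apply: is_derive_continuous (fun x => is_derive_pg p x s0). Qed.

Lemma msr_pg s p : 0 < s -> msr (pg s p).
Proof. by move=> s0; apply: continuous_measurable_fun; exact: continuous_pg. Qed.

Lemma itg_pg s p : 0 < s -> itg (pg s p).
Proof.
move=> s0; have [C HC] := pg_bound p s0.
apply: (itg_le (g := fun x => C * pk (2 * s) 0 x)) => //; first exact: msr_pg.
by apply: itgZ; apply: itg_pk; rewrite mulr_gt0.
Qed.

Lemma bdd_pg s p : 0 < s -> exists C, bdd C (pg s p).
Proof.
move=> s0; have [C HC] := pg_bound p s0.
have s20 : 0 < 2 * s by rewrite mulr_gt0.
have C0 : 0 <= C.
  have := le_trans (normr_ge0 _) (HC 0); rewrite pmulr_lge0 //.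
  by rewrite /pk mulr_gt0 ?expR_gt0 // invr_gt0 sqrtr_gt0 !mulr_gt0 // pi_gt0.
exists (C * (Num.sqrt (2 * pi * (2 * s)))^-1) => x.
by rewrite (le_trans (HC x)) // ler_wpM2l ?pk_ub.
Qed.

Lemma Leb_deriv_pg s p : 0 < s ->
  let h := pg s (p^`() - s^-1 *: ('X * p)) in
  [/\ forall c, Leb (fun y => h y * (c <= y)%R%:R) = - pg s p c,
      forall c, Leb (fun y => h y * (y <= c)%R%:R) = pg s p c & Leb h = 0].
Proof.
move=> s0 /=; have [C HC] := bdd_pg ('X * p) s0.
apply: (@Leb_deriv_decay R _ _ C) => [x||| x].
- exact: is_derive_pg.
- exact: continuous_pg.
- exact: itg_pg.
by rewrite -pgX.
Qed.

(* Gaussian integration by parts against the heat kernel. *)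
Lemma heat_pg_ibp s v p y : 0 < s -> 0 < v ->
  heat v y (pg s ((s^-1 + v^-1) *: ('X * p) - p^`())) = v^-1 * (y * heat v y (pg s p)).
Proof.
move=> s0 v0; pose q : {poly R} := p^`() - s^-1 *: ('X * p) + v^-1 *: ((y%:P - 'X) * p).
have D (u : {poly R}) x : is_derive x 1 (fun z => pk v y z * pg s u z)
    (pk v y x * pg s (u^`() - s^-1 *: ('X * u) + v^-1 *: ((y%:P - 'X) * u)) x).
  apply: is_derive_eq (is_deriveM (is_derive_pk y x v0) (is_derive_pg u x s0)) _.
  rewrite -[LHS]/(pk v y x * pg s (u^`() - s^-1 *: ('X * u)) x +
    pg s u x * (pk v y x * ((y - x) / v))).
  rewrite (mulrBl u) !(pgD, pgN, pgZ, pgX, pgC); ring.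
have [C HC] := bdd_pg ('X * p) s0.
have iM (u : {poly R}) : itg (fun z => pk v y z * pg s u z).
  by apply: itg_pkM' => //; exact: itg_pg.
have bd x : `|x * (pk v y x * pg s p x)| <= (Num.sqrt (2 * pi * v))^-1 * C.
  by rewrite mulrCA normrM -pgX; apply: ler_pM => //; exact: bdd_pk.
(* The identity says that the derivative of [pk v y * pg s p] has integral 0. *)
have [_ _ H0] := Leb_deriv_decay (D p) (is_derive_continuous (D q)) (iM q) bd.
have H : heat v y (pg s q) = 0 by rewrite heatE.
have E : pg s q =1 (fun z => v^-1 * (y * pg s p z) -
    pg s ((s^-1 + v^-1) *: ('X * p) - p^`()) z).
  by move=> z; rewrite /q (mulrBl p) !(pgD, pgN, pgZ, pgX, pgC); ring.
move: H; rewrite (eq_heat _ _ E) !heatE //.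
rewrite (eq_Leb (g := fun z => v^-1 * (y * (pk v y z * pg s p z)) -
    pk v y z * pg s ((s^-1 + v^-1) *: ('X * p) - p^`()) z)); last by move=> z; ring.
rewrite LebB; [|by do 2!apply: itgZ|by []].
by rewrite LebZ ?LebZ //; [lra|apply: itgZ].
Qed.

(* The heat kernel turns the sign function into an antiderivative of itself. *)
Lemma Leb_deriv_psi s v p x : 0 < s -> 0 < v ->
  Leb (fun y => pg s (p^`() - s^-1 *: ('X * p)) y * psi v (y - x)) =
  - 2 * heat v x (pg s p).
Proof.
move=> s0 v0; set h := pg s _.
have [Hge Hle _] := Leb_deriv_pg p s0; rewrite -/h in Hge Hle.
have ih : itg h by exact: itg_pg.
have ipg := itg_pg p s0.
have ishift (P : R -> R) c : msr P -> bdd 1 P -> itg (fun y => h y * P (y - c)).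
  move=> mP bP; have mPc : msr (fun y => P (y - c)).
    by apply: measurableT_comp mP _; exact: measurable_funB.
  have := itg_bddM mPc (fun y => bP (y - c)) ih.
  by apply: eq_integrable => // y _ /=; rewrite mulrC.
have isg c := ishift _ c (@msr_sg R) (@bdd_sg R).
have Hsg c : Leb (fun y => h y * Num.sg (y - c)) = -2 * pg s p c.
  rewrite (eq_Leb (g := fun y => h y * (c <= y)%R%:R - h y * (y <= c)%R%:R)).
    rewrite LebB ?Hge ?Hle; first by ring.
      apply: eq_integrable (ishift _ c (@msr_le0 R) (bdd_bool _)) => // y _ /=.
      by rewrite subr_ge0.
    apply: eq_integrable (ishift _ c (@msr_ge0 R) (bdd_bool _)) => // y _ /=.
    by rewrite subr_le0.
  by move=> y; rewrite sg_le subr_ge0 subr_le0 mulrBr.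
have psiE y : psi v (y - x) = Leb (fun w => Num.sg (y - (x - w)) * pk v 0 w).
  rewrite /psi heatE // -[LHS](Leb_shift (y - x)); last first.
    exact: itg_msr (itg_pkM _ v0 (@msr_sg R) (@bdd_sg R)).
  apply: eq_Leb => w; rewrite mulrC pkB [pk v 0 w]pkB.
  have -> : y - x - (w + (y - x)) = 0 - w by ring.
  by have -> : y - (x - w) = w + (y - x) by ring.
have [] := @fubini_kernel R (fun r : R * R => Num.sg (r.2 - (x - r.1)) * pk v 0 r.1)
  (fun w _ => pk v 0 w) h 1 _ _ _ _ _ ih.
- apply: measurable_funM.
    apply: measurableT_comp (@msr_sg R) _; apply: measurable_funB => //.
    by apply: measurable_funB.
  exact: measurableT_comp (msr_pk 0 v0) _.
- move=> w y /=; rewrite normrM [`|pk _ _ _|]ger0_norm ?pk_ge0 //.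
  by rewrite ler_piMl ?pk_ge0 ?bdd_sg.
- by move=> y; exact: itg_pk.
- by move=> y; rewrite Leb_pk.
- by move=> w; exists (pk v 0 w).
move=> /= _ H.
rewrite (eq_Leb (g := fun y => Leb (fun w => Num.sg (y - (x - w)) * pk v 0 w) * h y)); last first.
  by move=> y; rewrite psiE mulrC.
rewrite -H heatE //.
rewrite (eq_Leb (g := fun w => -2 * (pk v 0 w * pg s p (x - w)))); last first.
  move=> w; rewrite (eq_Leb (g := fun y => pk v 0 w * (h y * Num.sg (y - (x - w))))).
    by rewrite LebZ // Hsg; ring.
  by move=> y; ring.
have E : (fun z => pk v x z * pg s p z) \o (fun w => x - w) = (fun w => pk v 0 w * pg s p (x - w)).
  apply/funext => w /=; rewrite pkB [pk v 0 w]pk_sym [pk v w 0]pkB.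
  by have -> : x - (x - w) = w - 0 by ring.
have ipp := itg_pkM' x v0 ipg.
have iE : itg (fun w => pk v 0 w * pg s p (x - w)) by rewrite -E; exact: (itg_reflect x ipp).
by rewrite (LebZ _ iE) -E (Leb_reflect x (itg_msr ipp)).
Qed.

End GaussianIbp.

(** * Monic Hermite polynomials of variance [w] and the polynomials [R_k] *)

Section MonicHermite.
Context {R : realType}.
Implicit Types (w rho x c : R).

Fixpoint he2 w n : {poly R} * {poly R} :=
  if n is n'.+1 then
    let (h, hm) := he2 w n' in ('X * h - (w * n'%:R) *: hm, h)
  else (1, 0).

Definition he w n := (he2 w n).1.

Lemma he0 w : he w 0 = 1. Proof. by []. Qed.

Lemma heS w n : he w n.+1 = 'X * he w n - (w * n%:R) *: he w n.-1.
Proof.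
rewrite /he /=; case E : (he2 w n) => [h hm] /=; congr (_ - _).
case: n E => [|n] E; first by rewrite mulr0 !scale0r.
by move: E => /=; case: (he2 w n) => h' hm' [_ <-].
Qed.

Lemma deriv_he w n : (he w n)^`() = n%:R *: he w n.-1.
Proof.
elim/ltn_ind: n => -[|n] IH; first by rewrite he0 derivC scale0r.
rewrite heS derivB derivM derivX derivZ mul1r IH //.
case: n IH => [|n] IH; first by rewrite he0 mulr0 !scale0r mulr0 addr0 subr0 scale1r.
rewrite IH /=; last by lia.
rewrite heS -!mul_polyC !polyCM !polyC_natr; ring.
Qed.

Lemma he_opp w n x : (he w n).[- x] = (-1) ^+ n * (he w n).[x].
Proof.
elim/ltn_ind: n => -[|n] IH; first by rewrite he0 !hornerC mul1r.
rewrite heS !hornerD !hornerN !hornerZ !hornerM !hornerX IH //.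
case: n IH => [|n] IH; first by rewrite mulr0 !mul0r expr0 expr1; ring.
by rewrite IH /=; [rewrite !exprS; ring|lia].
Qed.

Lemma he_monic w n : (he w n \is monic) && (size (he w n) == n.+1).
Proof.
elim/ltn_ind: n => -[|n] IH; first by rewrite he0 monic1 size_poly1.
have /andP[mn /eqP sn] := IH n (ltnSn n).
have sX : size ('X * he w n) = n.+2 by rewrite mulrC size_mulX ?sn // monic_neq0.
have mX : lead_coef ('X * he w n) = 1 by rewrite lead_coefM lead_coefX mul1r (monicP mn).
have lt : (size (- ((w * n%:R) *: he w n.-1))%R < size ('X * he w n)%R)%N.
  rewrite sX size_polyN (leq_ltn_trans (size_scale_leq _ _)) //.
  case: n IH {mn sn sX mX} => [|n] IH /=; first by rewrite he0 size_poly1.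
  by have /andP[_ /eqP ->] := IH n (leqW (ltnSn n)); rewrite ltnS leqW.
by rewrite heS monicE lead_coefDl // mX eqxx size_polyDl // sX eqxx.
Qed.

Lemma he_hermite c n x : c != 0 ->
  (he (c ^+ 2 / 2) n).[x] = (c / 2) ^+ n * (hermite n).[x / c].
Proof.
move=> c0.
have hS m : hermite m.+1 = (2%:R *: 'X) * hermite m - (2 * m%:R) *: hermite m.-1 :> {poly R}.
  rewrite /hermite /=; case E : (hermite2 m) => [h hm] /=; congr (_ - _).
  case: m E => [|m] E; first by rewrite mulr0 !scale0r.
  by move: E => /=; case: (hermite2 m) => h' hm' [_ <-].
elim/ltn_ind: n => -[|n] IH; first by rewrite he0 /hermite /= !hornerC mul1r.
rewrite heS hS !hornerD !hornerN !(hornerM, hornerZ, hornerX) IH //.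
case: n IH => [|n] IH; first by rewrite !mulr0 !mul0r !subr0 expr0 expr1; field.
rewrite IH /=; last by lia.
rewrite !exprS; field.
by rewrite c0.
Qed.

(** [R_k] in monic Hermite form. The product [w * rho] will be the covariance of two correlated
    Gaussians of variance [w]. *)
Definition Rpoly w rho k : {poly R} :=
  if odd k then he w k - (k.-1%:R * (w * rho)) *: he w k.-2 else he w k.

Lemma Rpoly_monic w rho k : (Rpoly w rho k \is monic) && (size (Rpoly w rho k) == k.+1).
Proof.
have /andP[mk /eqP sk] := he_monic w k.
rewrite /Rpoly; case: ifP => // ok; last by rewrite mk sk eqxx.
have lt : (size (- ((k.-1%:R * (w * rho)) *: he w k.-2))%R < size (he w k))%N.
  rewrite size_polyN (leq_ltn_trans (size_scale_leq _ _)) // sk.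
  have /andP[_ /eqP ->] := he_monic w k.-2; case: k ok {mk sk} => //= k _.
  by rewrite ltnS; lia.
by rewrite monicE lead_coefDl // (monicP mk) eqxx size_polyDl // sk eqxx.
Qed.

(** The Kronecker deltas of [alpha] keep only degrees [k] and, for odd [k], [k-2]; rescaling the
    Hermite polynomials to variance [c1^2/2] leaves [z1^-2] on the second. *)
Lemma Rk_poly (T : R) (t : nat -> R) k x : 0 < t 1%N -> t 1%N < T ->
  Rk T t k x = (Rpoly (c1 T t ^+ 2 / 2) (z1 T t ^- 2) k).[x].
Proof.
move=> t0 tT.
have c0 : c1 T t != 0.
  by rewrite gt_eqF // /c1 sqrtr_gt0 divr_gt0 ?mulr_gt0 //; lra.
have z0 : z1 T t != 0 by rewrite gt_eqF // /z1 sqrtr_gt0 divr_gt0 //; lra.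
have delta n m (f : nat -> R) : (m < n)%N -> \sum_(j < n) (m == j)%:R * f j = f m.
  move=> mn; rewrite (bigD1 (Ordinal mn)) //= eqxx mul1r big1 ?addr0 // => j jm.
  suff -> : (m == j) = false by rewrite mul0r.
  by apply: contraNF jm => /eqP e; apply/eqP/val_inj.
rewrite /Rk /Rpoly /alpha; case: ifP => ok.
  rewrite hornerD hornerN hornerZ !he_hermite //.
  pose f j := 2 ^- k * c1 T t ^+ k * (hermite j).[x / c1 T t] * z1 T t ^+ j.
  rewrite (eq_bigr (fun j : 'I_k.+1 => (k == j)%:R * f j -
     2 * k.-1%:R * ((j.+2 == k)%:R * f j))); last by move=> j _; rewrite /f; ring.
  rewrite sumrB -mulr_sumr delta //.
  case: k ok @f => [|[|k]] // ok f.
    rewrite !(mulr0, mul0r, subr0) /f !(expr1, expr0); field.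
    by rewrite ?c0 ?z0.
  rewrite (eq_bigr (fun j : 'I_k.+3 => (k == j)%:R * f j)); last by move=> j _; rewrite !eqSS eq_sym.
  rewrite delta; last by lia.
  rewrite /f /= !expr_div_n !exprS; field.
  by rewrite ?c0 ?z0 ?expf_neq0.
pose f j := 2 ^- k * c1 T t ^+ k * (hermite j).[x / c1 T t] * z1 T t ^+ j.
rewrite (eq_bigr (fun j : 'I_k.+1 => (k == j)%:R * f j)); last by move=> j _; rewrite /f; ring.
rewrite delta // he_hermite // /f expr_div_n; field.
by rewrite ?expf_neq0.
Qed.

End MonicHermite.

(** * Skew-orthogonality of the [R_k] with respect to the smoothed sign *)

Lemma two_ibp_solve (R : comNzRingType) (a b xp px dp dq : R) :
  a * px - dq = b * xp -> a * xp - dp = b * px ->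
  (a ^+ 2 - b ^+ 2) * xp = a * dp + b * dq.
Proof.
move=> /eqP; rewrite subr_eq addrC -subr_eq => /eqP <-.
by move=> /eqP; rewrite subr_eq addrC -subr_eq => /eqP <-; ring.
Qed.

Section GaussianGram.
Context {R : realType}.
Variables (s v : R).
Hypotheses (s0 : 0 < s) (v0 : 0 < v).
Implicit Types (p q : {poly R}) (x y : R).
Local Opaque Leb.

Variables (al be w wr : R).
Hypotheses (al_def : al = s^-1 + v^-1) (be_def : be = v^-1).
Hypotheses (w_def : w = al / (al ^+ 2 - be ^+ 2)) (wr_def : wr = be / (al ^+ 2 - be ^+ 2)).

Let den : 0 < al ^+ 2 - be ^+ 2.
Proof.
have is0 : 0 < s^-1 by rewrite invr_gt0.
have iv0 : 0 < v^-1 by rewrite invr_gt0.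
by rewrite al_def be_def; nra.
Qed.

(** Up to normalisation, the mean of [p(X) q(Y)] for a Gaussian pair with precision matrix [al] on
    the diagonal and [-be] off it. Accordingly [w] is the common variance and [wr] the
    covariance. *)
Definition bform p q := Leb (fun x => pg s p x * heat v x (pg s q)).

Lemma itg_bform p q : itg (fun x => pg s p x * heat v x (pg s q)).
Proof.
have [C HC] := bdd_pg p s0.
by have [] := heat_dual (ltW v0) (msr_pg p s0) HC (itg_pg q s0).
Qed.

Lemma bformC p q : bform p q = bform q p.
Proof.
have [C HC] := bdd_pg p s0.
have [_ H] := heat_dual (ltW v0) (msr_pg p s0) HC (itg_pg q s0).
by rewrite /bform H; apply: eq_Leb => x; rewrite mulrC.
Qed.

Lemma bformDl p p' q : bform (p + p') q = bform p q + bform p' q.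
Proof.
rewrite /bform -LebD; [|exact: itg_bform|exact: itg_bform].
by apply: eq_Leb => x; rewrite pgD mulrDl.
Qed.

Lemma bformZl a p q : bform (a *: p) q = a * bform p q.
Proof.
rewrite /bform -LebZ; last exact: itg_bform.
by apply: eq_Leb => x; rewrite pgZ mulrA.
Qed.

Lemma bformBl p p' q : bform (p - p') q = bform p q - bform p' q.
Proof. by rewrite bformDl -scaleN1r bformZl mulN1r. Qed.

Lemma bformZr a p q : bform p (a *: q) = a * bform p q.
Proof. by rewrite bformC bformZl bformC. Qed.

Lemma bformBr p q q' : bform p (q - q') = bform p q - bform p q'.
Proof. by rewrite bformC bformBl !(bformC p). Qed.

Lemma bform_ibp p q : bform p (al *: ('X * q) - q^`()) = be * bform ('X * p) q.
Proof.
rewrite /bform -LebZ; last exact: itg_bform.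
by apply: eq_Leb => x; rewrite al_def heat_pg_ibp // pgX be_def; ring.
Qed.

Local Opaque bform.

(** Stein's identity for the Gaussian pair. Integration by parts in either variable gives two linear
    equations, solved for the unknown with ['X * p]. *)
Lemma bformX p q : bform ('X * p) q = w * bform p^`() q + wr * bform p q^`().
Proof.
have E1 := bform_ibp p q; have E2 := bform_ibp q p.
rewrite bformBr bformZr in E1; rewrite bformBr bformZr !(bformC q) (bformC ('X * q)) in E2.
have E : (al ^+ 2 - be ^+ 2) * bform ('X * p) q = al * bform p^`() q + be * bform p q^`().
  exact: two_ibp_solve E1 E2.
have d0 := den.
apply: (mulfI (x := al ^+ 2 - be ^+ 2)); first by rewrite gt_eqF.
by move: E; move: (bform _ _) (bform _ _) (bform _ _) => X Y Z ->;
  rewrite w_def wr_def; field; rewrite gt_eqF.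
Qed.

Lemma bform_heS n q : bform (he w n.+1) q = wr * bform (he w n) q^`().
Proof.
rewrite heS bformBl bformX deriv_he !bformZl.
by move: (bform _ _) (bform _ _) => X Y; ring.
Qed.

(** Mehler orthogonality: by [bform_heS], lowering one degree on the left differentiates on the
    right, which lowers its degree as well. *)
Lemma bform_he n m : bform (he w n) (he w m) = (n == m)%:R * (n`!%:R * wr ^+ n * bform 1 1).
Proof.
elim: n m => [|n IH] [|m].
- by rewrite eqxx !he0 expr0 fact0 !mul1r.
- by rewrite he0 bformC bform_heS derivC -(scale0r 0) bformZr !mul0r mulr0.
- by rewrite he0 bform_heS derivC -(scale0r 0) bformZr !mul0r mulr0.
rewrite bform_heS deriv_he bformZr IH eqSS; case: eqP => [->|_]; last by rewrite !(mul0r, mulr0).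
by rewrite !mul1r factS natrM exprS; ring.
Qed.

Local Transparent bform.

Lemma bform11 : bform 1 1 = pk (2 * s + v) 0 0.
Proof.
have E x : pg s 1 x = pk s 0 x by rewrite /pg hornerC mul1r.
rewrite /bform (eq_Leb (g := fun x => pk s 0 x * pk (s + v) x 0)).
  by rewrite pk_conv ?addr_gt0 //; congr pk; ring.
by move=> x; rewrite E (eq_heat _ _ E) heat_pk // (pk_sym (s + v)).
Qed.

(** The skew inner product; with [s = t_1] and [v = 2(T - t_1)] it is the one for which the [R_k]
    are skew-orthogonal. *)
Definition gram p q := Leb (fun x => pg s p x * Leb (fun y => pg s q y * psi v (y - x))).

Let fubini_gram p q :
  itg (fun x => pg s p x * Leb (fun y => pg s q y * psi v (y - x))) /\
  gram p q = Leb (fun y => Leb (fun x => pg s p x * psi v (y - x)) * pg s q y).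
Proof.
have [Cp bp] := bdd_pg p s0.
have ip := itg_pg p s0; have iq := itg_pg q s0.
have inp : itg (fun x => `|pg s p x|) by exact: (integrable_norm ip).
have bps y : bdd 1 (fun x => psi v (y - x)) by move=> x; exact: (bdd_psi (ltW v0)).
have mps y : msr (fun x => psi v (y - x)).
  exact: (msr_reflect y (msr_psi (ltW v0))).
have bps' x : bdd 1 (fun y => psi v (y - x)) by move=> y; exact: (bdd_psi (ltW v0)).
have mps' x : msr (fun y => psi v (y - x)).
  by apply: measurableT_comp (msr_psi (ltW v0)) _; exact: measurable_funB.
have iin f x : itg f -> itg (fun y => f y * psi v (y - x)).
  move=> /(itg_bddM (mps' x) (bps' x)); apply: eq_integrable => // y _ /=.
  by rewrite mulrC.
have [] := @fubini_kernel R (fun r : R * R => pg s p r.1 * psi v (r.2 - r.1))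
  (fun x _ => `|pg s p x|) (pg s q) (Leb (fun x => `|pg s p x|)) _ _ _ _ _ iq.
- apply: measurable_funM; first exact: measurableT_comp (msr_pg p s0) _.
  by apply: measurableT_comp (msr_psi (ltW v0)) _; exact: measurable_funB.
- by move=> x y /=; rewrite normrM ler_piMr // bdd_psi // ltW.
- by [].
- by [].
- by move=> x; exists `|pg s p x|.
have E x : Leb (fun y => pg s p x * psi v (y - x) * pg s q y) =
    pg s p x * Leb (fun y => pg s q y * psi v (y - x)).
  by rewrite -LebZ; [apply: eq_Leb => y; ring|exact: iin].
move=> /= i1 e; split; first by apply: eq_integrable i1 => // x _ /=; rewrite E.
by rewrite /gram (eq_Leb (g := fun x => Leb (fun y => pg s p x * psi v (y - x) * pg s q y))) // e.
Qed.

Let itg_psi (f : R -> R) x : itg f -> itg (fun y => f y * psi v (y - x)).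
Proof.
move=> itf; have mps : msr (fun y => psi v (y - x)).
  by apply: measurableT_comp (msr_psi (ltW v0)) _; exact: measurable_funB.
have := itg_bddM mps (fun y => bdd_psi (ltW v0) (y - x)) itf.
by apply: eq_integrable => // y _ /=; rewrite mulrC.
Qed.

Let psiNB x y : psi v (y - x) = - psi v (x - y).
Proof. by have <- := psiN (x - y) (ltW v0); congr psi; rewrite opprB. Qed.

Lemma gram_anti p q : gram p q = - gram q p.
Proof.
have [_ ->] := fubini_gram p q; have [iqp _] := fubini_gram q p.
rewrite /gram -LebN //; apply: eq_Leb => y; rewrite -mulrN mulrC; congr (_ * _).
rewrite -LebN; last exact: itg_psi (itg_pg p s0).
by apply: eq_Leb => x; rewrite -mulrN -psiNB.
Qed.

Let rho := wr / w.

Let w_rho : w * rho = wr.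
Proof.
have is0 : 0 < s^-1 by rewrite invr_gt0.
have iv0 : 0 < v^-1 by rewrite invr_gt0.
rewrite /rho mulrC divfK // w_def mulf_neq0 ?invr_neq0 ?gt_eqF //.
by rewrite al_def addr_gt0.
Qed.

(** The reason for the correction term in the odd [R_k]: since [w + wr = s], it makes [R_{2l+1}]
    times the Gaussian an exact derivative, namely of [- s] times the Gaussian times [he w l.*2]. *)
Lemma Rpoly_odd l : Rpoly w rho l.*2.+1 = - s *: ((he w l.*2)^`() - s^-1 *: ('X * he w l.*2)).
Proof.
have ws : w + wr = s.
  have is0 : 0 < s^-1 by rewrite invr_gt0.
  have iv0 : 0 < v^-1 by rewrite invr_gt0.
  have d0 := den; rewrite w_def wr_def -mulrDl subr_sqr.
  have -> : al - be = s^-1 by rewrite al_def be_def addrK.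
  rewrite invfM invrK mulrCA mulfV ?mulr1 // gt_eqF // al_def be_def; lra.
rewrite /Rpoly oddS odd_double /= w_rho heS deriv_he.
rewrite scalerBr !scalerA !mulNr (mulfV (lt0r_neq0 s0)) scaleN1r opprK.
by rewrite -!mul_polyC -{}ws !(polyCM, polyCN, polyCD, polyC_natr); ring.
Qed.

(** Integrating the exact derivative against the smoothed sign gives [-2] times a heat convolution,
    so the skew form reduces to the symmetric one. *)
Lemma gram_odd p l : gram p (Rpoly w rho l.*2.+1) = 2 * s * bform p (he w l.*2).
Proof.
rewrite /bform -LebZ; last exact: itg_bform.
apply: eq_Leb => x; rewrite [RHS]mulrCA; congr (_ * _).
rewrite Rpoly_odd; set h := _ - _.
have ih : itg (fun y => pg s h y * psi v (y - x)) by exact: itg_psi (itg_pg h s0).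
rewrite (eq_Leb (g := fun y => - s * (pg s h y * psi v (y - x)))).
  by rewrite LebZ // Leb_deriv_psi //; move: (heat _ _ _) => z; ring.
by move=> y; rewrite pgZ -mulrA.
Qed.

(** Reflecting both variables preserves the Gaussian factors and negates the odd function [psi]. *)
Lemma gram_even p q : (forall x, p.[- x] = p.[x]) -> (forall x, q.[- x] = q.[x]) ->
  gram p q = 0.
Proof.
have pgE u x : (forall x, u.[- x] = u.[x]) -> pg s u (0 - x) = pg s u x.
  move=> uE; rewrite /pg sub0r uE; congr (_ * _).
  by rewrite /pk !sub0r opprK sqrrN.
move=> pE qE; suff : gram p q = - gram p q.
  by move/eqP; rewrite -addr_eq0 -mulr2n mulrn_eq0 /= => /eqP.
have [ipq _] := fubini_gram p q.
rewrite {1}/gram -(Leb_reflect 0 (itg_msr ipq)) /gram -LebN //.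
apply: eq_Leb => x; rewrite pgE // -mulrN; congr (_ * _).
have iq := itg_psi x (itg_pg q s0); have iq' := itg_psi (0 - x) (itg_pg q s0).
rewrite -(Leb_reflect 0 (itg_msr iq')) -LebN //.
apply: eq_Leb => y; rewrite pgE // -mulrN; congr (_ * _).
by rewrite -psiNB; congr psi; ring.
Qed.

Definition skew_norm k : R := 2 * s * ((k.*2)`!%:R * wr ^+ k.*2 * pk (2 * s + v) 0 0).

Lemma gram_Rpoly k l :
  [/\ gram (Rpoly w rho k.*2) (Rpoly w rho l.*2) = 0,
      gram (Rpoly w rho k.*2.+1) (Rpoly w rho l.*2.+1) = 0 &
      gram (Rpoly w rho k.*2) (Rpoly w rho l.*2.+1) = (k == l)%:R * skew_norm k].
Proof.
have Re j : Rpoly w rho j.*2 = he w j.*2 by rewrite /Rpoly odd_double.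
split.
- by rewrite !Re; apply: gram_even => x; rewrite he_opp -signr_odd odd_double mul1r.
- rewrite gram_odd /Rpoly oddS odd_double /= bformBl bformZl !bform_he.
  have -> : (k.*2.+1 == l.*2) = false by lia.
  (* The degrees can agree only through truncated subtraction at [k = 0], where the coefficient of
     the correction term is 0. *)
  have -> : (k.*2.-1 == l.*2) = ((k == 0%N) && (l == 0%N)) by lia.
  by case: k => [|k]; rewrite !(mul0r, mulr0, subr0).
rewrite gram_odd Re bform_he bform11 mulrCA.
by have -> : (k.*2 == l.*2) = (k == l) by lia.
Qed.

End GaussianGram.

(** * Gamma at half-integers through Gaussian moments *)

Section GammaHalf.
Context {R : realType}.
Notation mu := (@lebesgue_measure R).

(** Compact intervals exhausting the positive half-line; squaring maps those of [e = 0] onto those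
    of [e = 1]. *)
Let ibc (e : nat) k : set R := `[k.+1%:R^-1 ^+ e.+1, k.+1%:R ^+ e.+1].

Let ibc_cvg (e : nat) (f : R -> \bar R) : measurable_fun (`]0, +oo[%classic : set R) f ->
  (forall x, 0 < x -> (0 <= f x)%E) ->
  (\int[mu]_(x in ibc e i) f x @[i --> \oo] --> \int[mu]_(x in `]0%R, +oo[) f x)%E.
Proof.
move=> mf f0.
have U : (`]0, +oo[%classic : set R) = \bigcup_i ibc e i.
  apply/seteqP; split => x /=.
    rewrite in_itv /= andbT => x0.
    have xi0 : 0 < x^-1 by rewrite invr_gt0.
    have N0 := archi_boundP (ltW x0); have N1 := archi_boundP (ltW xi0).
    exists (maxn (Num.bound x) (Num.bound x^-1)) => //=; set N := maxn _ _.
    have xN : x <= N.+1%:R.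
      by rewrite (le_trans (ltW N0)) // ler_nat leqW // leq_maxl.
    have xiN : x^-1 <= N.+1%:R.
      by rewrite (le_trans (ltW N1)) // ler_nat leqW // leq_maxr.
    have N1' : 1 <= N.+1%:R :> R by rewrite ler1n.
    have Np : 0 < N.+1%:R :> R by rewrite ltr0n.
    rewrite /ibc /= in_itv /=; apply/andP; split.
      apply: (@le_trans _ _ N.+1%:R^-1).
        have i0 : 0 <= N.+1%:R^-1 :> R by rewrite invr_ge0 ltW.
        have i1 : N.+1%:R^-1 <= 1 :> R by rewrite invf_le1.
        by rewrite exprS ler_piMr // exprn_ile1.
      by rewrite -[leRHS]invrK lef_pV2 // posrE invr_gt0.
    by apply: (le_trans xN); rewrite -[leLHS]expr1 ler_weXn2l.
  move=> [i _]; rewrite /ibc /= !in_itv /= => /andP[x1 _]; rewrite andbT.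
  by apply: lt_le_trans x1; rewrite exprn_gt0 // invr_gt0 ltr0n.
have sub i x : ibc e i x -> 0 < x.
  move=> xi; suff : (`]0, +oo[%classic : set R) x by rewrite /= in_itv /= andbT.
  by rewrite U; exists i.
rewrite [X in _ --> (\int[_]_(x in X) _)%E]U.
apply: ge0_nondecreasing_set_cvg_integral.
- apply/nondecreasing_seqP => n; rewrite subsetEset => x; rewrite /ibc /= !in_itv /=.
  move=> /andP[x1 x2]; apply/andP; split.
    apply: le_trans x1; rewrite lerXn2r ?nnegrE ?invr_ge0 ?ler0n //.
    by rewrite lef_pV2 ?posrE ?ltr0n // ler_nat.
  by apply: le_trans x2 _; rewrite lerXn2r ?nnegrE ?ler0n // ler_nat.
- by move=> i; exact: measurable_itv.
- move=> i; apply: measurable_funS mf; first exact: measurable_itv.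
  by move=> x /sub x0; rewrite /= in_itv /= x0.
- by move=> i x /sub; exact: f0.
Qed.

Let gauss n (y : R) := y ^+ n * expR (- y ^+ 2).

Let gauss_pg n y : gauss n y = Num.sqrt pi * pg (2^-1) 'X^n y.
Proof.
rewrite /gauss /pg hornerXn /pk sub0r sqrrN mulfV //.
have -> : 2 * pi / 2 = pi :> R by field.
rewrite divr1 mulrCA mulVKf // gt_eqF // sqrtr_gt0; exact: pi_gt0.
Qed.

Let half_gt0 : 0 < 2^-1 :> R. Proof. by rewrite invr_gt0. Qed.

Let itg_gauss n : itg (gauss n).
Proof.
rewrite (_ : gauss n = fun y => Num.sqrt pi * pg 2^-1 'X^n y).
  by apply: itgZ; exact: itg_pg.
by apply/funext => y; exact: gauss_pg.
Qed.

Let itg_half (f : R -> R) : itg f -> itg (fun y => f y * (0 <= y)%R%:R).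
Proof.
move=> /(itg_bddM (@msr_le0 R) (bdd_bool (fun y => 0 <= y))).
by apply: eq_integrable => // y _ /=; rewrite mulrC.
Qed.

Definition hmom n := Leb (fun y => gauss n y * (0 <= y)%R%:R).

Let integral_half (f : R -> R) : itg f ->
  (\int[mu]_(x in `]0%R, +oo[) (f x)%:E = (Leb (fun y => f y * (0 <= y)%R%:R))%:E)%E.
Proof.
move=> itf; rewrite -Leb_EFin; last exact: itg_half.
rewrite integral_itv_obnd_cbnd; last first.
  by apply/measurable_EFinP; apply: measurable_funTS; exact: itg_msr.
rewrite integral_mkcond; apply: eq_integral => y _; rewrite patchE mem_setE in_itv /= andbT.
by case: (0 <= y); rewrite ?mulr1 ?mulr0.
Qed.

Lemma Gamma_half n : Gamma (n.+1%:R / 2) = 2 * hmom n.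
Proof.
pose G (x : R) := x `^ (n.+1%:R / 2 - 1) * expR (- x).
have G0 x : 0 <= G x by rewrite mulr_ge0 ?powR_ge0 ?expR_ge0.
have h0 x : 0 < x -> 0 <= 2 * gauss n x.
  by move=> x0; rewrite !mulr_ge0 ?expR_ge0 ?exprn_ge0 // ltW.
have mG : measurable_fun setT G.
  apply: measurable_funM; first exact: measurable_powR.
  by apply: measurableT_comp.
have ih : itg (fun y => 2 * gauss n y) by apply: itgZ; exact: itg_gauss.
have mh := itg_msr ih.
have c1 := @ibc_cvg 1 (EFin \o G).
have c2 := @ibc_cvg 0 (fun y => (2 * gauss n y)%:E).
(* The substitution [x = y^2] is made on compact intervals away from 0; monotone convergence then
   gives the improper integrals. *)
suff E k : (\int[mu]_(x in ibc 1 k) (EFin \o G) x = \int[mu]_(x in ibc 0 k) (2 * gauss n x)%:E)%E.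
  have EE : (\int[mu]_(x in `]0%R, +oo[) (EFin \o G) x =
             \int[mu]_(x in `]0%R, +oo[) (2 * gauss n x)%:E)%E.
    have meG : measurable_fun setT (EFin \o G) by exact/measurable_EFinP.
    have meh : measurable_fun setT (fun y => (2 * gauss n y)%:E) by exact/measurable_EFinP.
    have {}c1 := c1 (measurable_funTS meG) (fun x _ => G0 x).
    have {}c2 := c2 (measurable_funTS meh) h0.
    apply: (cvg_unique (@ereal_hausdorff R) c1).
    by rewrite (_ : (fun i => _) = (fun i => (\int[mu]_(x in ibc 0 i) (2 * gauss n x)%:E)%E)) //;
      apply/funext => k; rewrite E.
  rewrite /Gamma [LHS](congr1 fine EE) integral_half //= /hmom -LebZ; last exact: itg_half.
  by apply: eq_Leb => y; rewrite mulrA.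
pose F : R -> R := horner 'X^2.
have FE (y : R) : F y = y ^+ 2 by rewrite /F hornerXn.
have dF (y : R) : is_derive y 1 F (2 * y).
  by apply: is_derive_eq (is_derive_poly _ _) _; rewrite derivXn /= hornerMn hornerXn expr1 mulr_natl.
have F'E : F^`()%classic = fun y => 2 * y.
  by apply/funext => y; rewrite derive1E; exact: derive_val.
have cF : continuous F := is_derive_continuous dF.
have c2y : continuous (fun y : R => 2 * y) by move=> y; apply: cvgMr; exact: cvg_id.
have kp : 0 < k.+1%:R^-1 :> R by rewrite invr_gt0 ltr0n.
have kk : k.+1%:R^-1 <= k.+1%:R :> R.
  by apply: (@le_trans _ _ 1); rewrite ?invf_le1 ?ltr0n // ler1n.
have -> : ibc 1 k = `[F k.+1%:R^-1, F k.+1%:R]%classic by rewrite /ibc !FE.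
rewrite (@integration_by_substitution_increasing R F G _ _ kk).
- rewrite /ibc !expr1; apply: eq_integral => y.
  rewrite inE /= in_itv /= => /andP[ky _]; have y0 : 0 < y := lt_le_trans kp ky.
  congr EFin; rewrite F'E -[LHS]/(G (F y) * (2 * y)) FE /G /gauss.
  have pw : (y ^+ 2) `^ (n.+1%:R / 2 - 1) * y = y ^+ n.
    rewrite -(powR_mulrn 2 (ltW y0)) -powRrM -[X in _ * X]powRr1 ?ltW //.
    rewrite -powRD ?(gt_eqF y0) ?implybT // -powR_mulrn ?ltW //; congr (_ `^ _).
    by rewrite -natr1; field.
  by rewrite -pw; move: (_ `^ _) => z; ring.
- move=> x y; rewrite !in_itv /= => /andP[kx _] _ xy; have x0 := lt_le_trans kp kx.
  by rewrite !FE !expr2; nra.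
- by rewrite F'E => x _; exact: c2y.
- by rewrite F'E; apply/cvg_ex; exists (2 * k.+1%:R^-1); apply: cvg_at_right_filter; exact: c2y.
- by rewrite F'E; apply/cvg_ex; exists (2 * k.+1%:R); apply: cvg_at_left_filter; exact: c2y.
- split=> [x _||].
  + by have [] := dF x.
  + by apply: cvg_at_right_filter; exact: cF.
  + by apply: cvg_at_left_filter; exact: cF.
- have Fk : 0 < F k.+1%:R^-1 by rewrite FE exprn_gt0.
  apply: derivable_within_continuous => x; rewrite in_itv /= => /andP[kx _].
  have x0 : 0 < x := lt_le_trans Fk kx.
  apply: derivableM; last first.
    rewrite (_ : (fun x => _) = expR \o horner (- 'X : {poly R})).
      by have [] := is_derive1_comp (is_derive_expR (- 'X : {poly R}).[x]) (is_derive_poly (- 'X) x).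
    by apply/funext => z; rewrite /= hornerN hornerX.
  by have [] := is_derive1_powR (n.+1%:R / 2 - 1) x0.
Qed.

Lemma hmom0 : hmom 0 = Num.sqrt pi / 2.
Proof.
apply/eqP; rewrite -eqe -[X in X == _]integral_half // -integral0y_gauss integral_itv_obnd_cbnd.
  by apply/eqP; apply: eq_integral => y _; rewrite /gauss expr0 mul1r.
by apply/measurable_EFinP; apply: measurable_funTS; exact: itg_msr.
Qed.

Lemma hmom_deriv (p : {poly R}) :
  Leb (fun y => pg 2^-1 (p^`() - 2 *: ('X * p)) y * (0 <= y)%R%:R) = - pg 2^-1 p 0.
Proof. by have [H _ _] := Leb_deriv_pg p half_gt0; rewrite -H invrK. Qed.

Lemma hmom1 : hmom 1 = 2^-1.
Proof.
have := hmom_deriv 1; rewrite derivC sub0r mulr1.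
have -> : pg 2^-1 1 0 = (Num.sqrt pi)^-1 :> R.
  rewrite /pg hornerC mul1r /pk subr0 expr0n oppr0 mul0r expR0 mulr1.
  by congr (Num.sqrt _)^-1; field.
rewrite (eq_Leb (g := fun y => (- 2 * (Num.sqrt pi)^-1) * (gauss 1 y * (0 <= y)%R%:R))).
  rewrite LebZ; last exact: itg_half.
  have sp : Num.sqrt pi != 0 :> R by rewrite gt_eqF // sqrtr_gt0 pi_gt0.
  rewrite -/(hmom 1) => H; apply: (mulfI (x := - 2 / Num.sqrt pi)).
    by rewrite mulf_neq0 ?invr_neq0 // oppr_eq0.
  by rewrite H; field.
move=> y; rewrite gauss_pg pgN pgZ expr1; field.
by rewrite gt_eqF // sqrtr_gt0 pi_gt0.
Qed.

Lemma hmomSS n : hmom n.+2 = n.+1%:R / 2 * hmom n.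
Proof.
have := hmom_deriv 'X^(n.+1).
have -> : pg 2^-1 'X^(n.+1) 0 = 0 :> R by rewrite /pg hornerXn expr0n mul0r.
rewrite oppr0 derivXn -exprS.
have sp : Num.sqrt pi != 0 :> R by rewrite gt_eqF // sqrtr_gt0 pi_gt0.
rewrite (eq_Leb (g := fun y => (n.+1%:R / Num.sqrt pi) * (gauss n y * (0 <= y)%R%:R) -
   (2 / Num.sqrt pi) * (gauss n.+2 y * (0 <= y)%R%:R))); last first.
  move=> y; rewrite !gauss_pg pgD pgN pgZ /= -['X^n *+ _]scaler_nat pgZ.
  move: (pg _ _ _) (pg _ _ _) => u w; field; by rewrite ?sp.

rewrite LebB; [|by apply: itgZ; exact: itg_half|by apply: itgZ; exact: itg_half].
rewrite !LebZ; [|exact: itg_half|exact: itg_half].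
rewrite -!/(hmom _) => /eqP; rewrite subr_eq0 => /eqP H.
apply: (mulfI (x := 2 / Num.sqrt pi)); first by rewrite mulf_neq0 ?invr_neq0.
by rewrite -H; move: (hmom n) => z; field.
Qed.

End GammaHalf.

(** * The constants [r_k] and [C(N,T,t_1)] *)

Section Normalization.
Context {R : realType}.
Variables (T : R) (t : nat -> R).
Hypotheses (t0 : 0 < t 1%N) (tT : t 1%N < T).
Let T0 : 0 < T. Proof. by apply: lt_trans tT. Qed.

Let halfS k : k%:R + 2^-1 = k.*2.+1%:R / 2 :> R.
Proof. by rewrite -[k.*2.+1%:R]natr1 -muln2 natrM; field. Qed.

Let halfSS k : k%:R + 1 = k.*2.+2%:R / 2 :> R.
Proof. by rewrite -[k.*2.+2%:R]natr1 -[k.*2.+1%:R]natr1 -muln2 natrM; field. Qed.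

(** Legendre duplication at integers, by induction from the recurrence of the Gaussian moments. *)
Lemma Gamma_mul k : Gamma (k%:R + 2^-1) * Gamma (k%:R + 1) =
  (k.*2)`!%:R / 4 ^+ k * Num.sqrt (pi : R).
Proof.
rewrite halfS halfSS.
rewrite !Gamma_half; elim: k => [|k IH].
  by rewrite hmom0 hmom1 fact0 expr0; field.
have -> : 2 * hmom k.+1.*2 * (2 * hmom k.+1.*2.+1) =
  (k.*2.+1%:R / 2) * (k.*2.+2%:R / 2) * (2 * hmom k.*2 * (2 * hmom k.*2.+1)) :> R.
  by rewrite doubleS !hmomSS; move: (hmom _) (hmom _) => x y; field.
rewrite IH doubleS !factS !natrM exprS; move: (Num.sqrt _) (_`!%:R) => x y; field.
by rewrite expf_neq0.
Qed.

Lemma rjE k : rj T t k = (k.*2)`!%:R / 4 ^+ k * (t 1%N ^+ 2 / T) ^+ k.*2 * (t 1%N / Num.sqrt (pi * T)).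
Proof.
have a0 : 0 <= t 1%N ^+ 2 / T by rewrite divr_ge0 ?sqr_ge0 // ltW.
have a1 : 0 < t 1%N ^+ 2 / T by rewrite divr_gt0 ?exprn_gt0.
rewrite /rj Gamma_mul powRD; last by rewrite gt_eqF ?implybT.
have -> : 2 * k%:R = k.*2%:R :> R by rewrite -mul2n natrM.
rewrite powR_mulrn // powR12_sqrt // sqrtrM ?sqr_ge0 // sqrtr_sqr gtr0_norm //.
rewrite sqrtrV ?(ltW T0) // sqrtrM ?pi_ge0 //.
have p0 := @pi_gt0 R.
have sp : Num.sqrt pi != 0 :> R by rewrite gt_eqF // sqrtr_gt0.
have sT : Num.sqrt T != 0 by rewrite gt_eqF // sqrtr_gt0.
have pE : Num.sqrt pi / pi = (Num.sqrt pi)^-1 :> R.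
  by rewrite -[X in _ / X](sqr_sqrtr (ltW p0)) expr2 invfM mulVKf.
rewrite -[_ * _ / pi]mulrA pE; move: (_ ^+ k.*2) => z; move: (_`!%:R) => y.
move: sp sT; move: (Num.sqrt pi) (Num.sqrt T) => u w u0 w0; field.
by rewrite ?u0 ?w0 ?expf_neq0.
Qed.

Lemma rj_gt0 k : 0 < rj T t k.
Proof.
rewrite rjE; apply: mulr_gt0; last by rewrite divr_gt0 ?sqrtr_gt0 ?mulr_gt0 ?pi_gt0.
apply: mulr_gt0; last by rewrite exprn_gt0 // divr_gt0 ?exprn_gt0.
by apply: divr_gt0; rewrite ?exprn_gt0 // ltr0n fact_gt0.
Qed.

Lemma skew_norm_rj k (v wr : R) : v = (T - t 1%N) + (T - t 1%N) -> wr = t 1%N ^+ 2 / (2 * T) ->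
  skew_norm (t 1%N) v wr k = rj T t k.
Proof.
move=> vE wE; rewrite rjE /skew_norm wE.
have -> : 2 * t 1%N + v = 2 * T by rewrite vE; ring.
have -> : pk (2 * T) 0 0 = (2 * Num.sqrt (pi * T))^-1.
  rewrite /pk subr0 expr0n oppr0 mul0r expR0 mulr1.
  have -> : 2 * pi * (2 * T) = 2 ^+ 2 * (pi * T) by ring.
  by rewrite sqrtrM ?sqr_ge0 // sqrtr_sqr ger0_norm.
have -> : t 1%N ^+ 2 / (2 * T) = 2^-1 * (t 1%N ^+ 2 / T) by field; rewrite gt_eqF.
rewrite exprMn exprVn -[in 2 ^+ k.*2]mul2n exprM.
have -> : 2 ^+ 2 = 4 :> R by ring.
have s0 : Num.sqrt (pi * T) != 0 by rewrite gt_eqF // sqrtr_gt0 mulr_gt0 ?pi_gt0.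
move: s0; move: (Num.sqrt _) => u u0; move: (_ ^+ k.*2) => z; move: (_`!%:R) => y.
by field; rewrite u0 expf_neq0.
Qed.

(** Passing from [2n] to [2n+2] particles adds exactly the two Gamma factors of [r_n]; the powers of
    [pi], [T] and [t_1] are compared as exponentials of logarithms. *)
Lemma Cnorm_rj n : Cnorm n.*2 T (t 1%N) = \prod_(k < n) (rj T t k)^-1.
Proof.
have powE (a x : R) : 0 < a -> a `^ x = expR (x * ln a) by move=> a0; rewrite /powR gt_eqF.
elim: n => [|n IH].
  rewrite /Cnorm big_ord0 !big_ord0 double0 mul0n !mul0r oppr0 !powRr0 invr1; ring.
rewrite big_ord_recr -IH /= /Cnorm doubleS !big_ord_recr /=.
rewrite -halfS -halfSS.
have p0 := @pi_gt0 R.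
have e1 : n.*2%:R / 2 = n%:R :> R by rewrite -muln2 natrM; field.
rewrite e1 /rj !powE //; last by rewrite divr_gt0 ?exprn_gt0.
have -> : ln (t 1%N ^+ 2 / T) = 2 * ln (t 1%N) - ln T.
  by rewrite lnM ?posrE ?exprn_gt0 ?invr_gt0 // lnV ?posrE // lnXn // mulr_natl.
have gen (E1 P a b E2 E3 x1 x2 x3 pp E4 : R) : E1 * E2 * E3 = x1 * x2 * x3 * (pp * E4) ->
    E1 * (P * a * b) * E2 * E3 = x1 * P * x2 * x3 * (a * b * pp * E4).
  by move=> H; transitivity (P * a * b * (E1 * E2 * E3)); [ring|rewrite H; ring].
rewrite !invfM invrK; apply: gen.
have dE : n.*2%:R = 2 * n%:R :> R by rewrite -mul2n natrM.
have E1 : (n.*2 * n.*2.-1)%:R = 2 * n%:R * (2 * n%:R - 1) :> R.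
  by case: (n) => [|m]; rewrite ?mul0n ?mulr0 ?mul0r // natrM doubleS /= -[m.*2.+2%:R]natr1
    -[m.*2.+1%:R]natr1 -[m.+1%:R]natr1 -mul2n natrM; ring.
have E2 : (n.*2.+2 * n.*2.+1)%:R = (2 * n%:R + 2) * (2 * n%:R + 1) :> R.
  by rewrite natrM -[n.*2.+2%:R]natr1 -[n.*2.+1%:R]natr1 dE; ring.
rewrite E1 E2 -[X in _ = _ * (X * _)]lnK ?posrE // -expRN -!expRD; congr expR.
by move: (ln T) (ln (t 1%N)) (ln pi) => B D A; field.
Qed.

End Normalization.

(** * Convolution with the smoothed sign *)

Section Convolution.
Context {R : realType}.
Local Opaque Leb heat psi.
Implicit Types (f g : R -> R) (s v x y z : R).

Lemma psiBC v x y : 0 <= v -> psi v (x - y) = - psi v (y - x).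
Proof. by move=> v0; rewrite -(psiN _ v0) opprB. Qed.

Lemma heat_psi_reflect s v x z : 0 <= s -> 0 <= v ->
  heat s x (fun y => psi v (z - y)) = psi (s + v) (z - x).
Proof.
by move=> s0 v0; rewrite (heat_reflect _ _ s0 (msr_psi v0) (bdd_psi v0)) heat_psi.
Qed.

Lemma heat_psi_shift s v x z : 0 <= s -> 0 <= v ->
  heat s x (fun y => psi v (y - z)) = psi (s + v) (x - z).
Proof.
by move=> s0 v0; rewrite (heat_shift _ _ s0 (msr_psi v0) (bdd_psi v0)) heat_psi.
Qed.

Lemma msr_psi_reflect v z : 0 <= v -> msr (fun y => psi v (z - y)).
Proof. by move=> v0; apply: (msr_reflect z (msr_psi v0)). Qed.

Lemma Leb_heat_psi s v g z : 0 <= s -> 0 <= v -> itg g ->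
  Leb (fun y => heat s y g * psi v (z - y)) = Leb (fun y => g y * psi (s + v) (z - y)).
Proof.
move=> s0 v0 ig.
have [_ H] := heat_dual s0 (msr_psi_reflect z v0) (fun y => bdd_psi v0 (z - y)) ig.
rewrite (eq_Leb (g := fun y => psi v (z - y) * heat s y g)); last by move=> y; exact: mulrC.
by rewrite H; apply: eq_Leb => y; rewrite heat_psi_reflect // mulrC.
Qed.

Definition cpsi v g z := Leb (fun y => g y * psi v (z - y)).

Lemma itg_cpsi v g z : 0 <= v -> itg g -> itg (fun y => g y * psi v (z - y)).
Proof.
move=> v0 ig; have := itg_bddM (msr_psi_reflect z v0) (fun y => bdd_psi v0 (z - y)) ig.
by apply: eq_integrable => // y _ /=; rewrite mulrC.
Qed.

Lemma bdd_cpsi v g : 0 <= v -> itg g -> bdd (Leb (fun y => `|g y|)) (cpsi v g).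
Proof.
move=> v0 ig z; have ic := itg_cpsi z v0 ig; apply: le_trans (norm_Leb ic) _.
apply: le_Leb; [exact: (integrable_norm ic)|exact: (integrable_norm ig)|].
by move=> y; rewrite normrM ler_piMr ?bdd_psi.
Qed.

Lemma msr_cpsi v g : 0 <= v -> itg g -> msr (cpsi v g).
Proof.
move=> v0 ig; have mg := itg_msr ig.
apply: (@msr_Leb_kernel R (fun p => g p.1 * psi v (p.2 - p.1)) (fun p => `|g p.1|)).
- apply: measurable_funM; first exact: measurableT_comp mg _.
  by apply: measurableT_comp (msr_psi v0) _; exact: measurable_funB.
- by apply: measurableT_comp => //; exact: measurableT_comp mg _.
- by move=> p; rewrite normrM ler_piMr ?bdd_psi.
- by move=> y; exact: (integrable_norm ig).
Qed.

Lemma Leb_heat_psi' s v g x : 0 <= s -> 0 <= v -> itg g ->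
  Leb (fun y => heat s y g * psi v (y - x)) = Leb (fun y => g y * psi (s + v) (y - x)).
Proof.
move=> s0 v0 ig; have sv0 := addr_ge0 s0 v0.
transitivity (Leb (fun y => - (heat s y g * psi v (x - y)))).
  by apply: eq_Leb => y; rewrite (psiBC y x v0) mulrN.
rewrite (LebN (itg_cpsi x v0 (itg_heat s0 ig))) (Leb_heat_psi x s0 v0 ig).
rewrite -(LebN (itg_cpsi x sv0 ig)); apply: eq_Leb => y.
by rewrite (psiBC y x sv0) mulrN.
Qed.

Lemma Leb_cpsi v f g : 0 <= v -> itg f -> itg g ->
  Leb (fun y => f y * cpsi v g y) = Leb (fun x => g x * Leb (fun y => f y * psi v (y - x))).
Proof.
move=> v0 itf ig; have mf := itg_msr itf.
have [] := @fubini_kernel R (fun r : R * R => f r.1 * psi v (r.1 - r.2))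
  (fun y _ => `|f y|) g (Leb (fun y => `|f y|)) _ _ _ _ _ ig.
- apply: measurable_funM; first exact: measurableT_comp mf _.
  by apply: measurableT_comp (msr_psi v0) _; exact: measurable_funB.
- by move=> y x /=; rewrite normrM ler_piMr ?bdd_psi.
- by move=> _; exact: (integrable_norm itf).
- by [].
- by move=> y; exists `|f y|.
move=> _; set q := (X in _ = X) => e.
transitivity q.
  rewrite -e; apply: eq_Leb => y; rewrite /cpsi -LebZ; last exact: itg_cpsi.
  by apply: eq_Leb => x; rewrite mulrA mulrAC.
by apply: eq_Leb => x; exact: mulrC.
Qed.

End Convolution.

(** * The extended antisymmetric kernel and its reproducing identities *)

Section Kernel.
Context {R : realType}.
Local Opaque Leb heat psi pk Phi Rm F Rpoly.
Variables (T : R) (t : nat -> R) (M : nat).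
Hypotheses (M1 : (1 <= M)%N) (t00 : t 0%N = 0).
Hypotheses (tS : forall m, (m <= M)%N -> t m < t m.+1) (tM : t M.+1 = T).

Lemma t_lt m n : (m < n <= M.+1)%N -> t m < t n.
Proof.
case/andP; elim: n => // n IH; rewrite ltnS leq_eqVlt => /predU1P[->|mn] nM; first exact: tS.
by apply: lt_trans (IH mn _) (tS nM); exact: leqW.
Qed.

Lemma t_le m n : (m <= n <= M.+1)%N -> t m <= t n.
Proof.
case/andP; rewrite leq_eqVlt => /predU1P[->//|mn] nM.
by rewrite ltW // t_lt // mn.
Qed.

Lemma t_leT m : (m <= M.+1)%N -> t m <= T.
Proof. by move=> mM; rewrite -tM t_le // mM leqnn. Qed.

Lemma t1_gt0 : 0 < t 1%N.
Proof. by rewrite -t00 t_lt. Qed.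

Lemma t1_ltT : t 1%N < T.
Proof. by rewrite -tM t_lt // ltnS M1 leqnn. Qed.

Definition level m := (1 <= m <= M.+1)%N.

Definition gk k := pg (t 1%N) (Rpoly (c1 T t ^+ 2 / 2) (z1 T t ^- 2) k).

Let igk k : itg (gk k). Proof. by apply: itg_pg; exact: t1_gt0. Qed.

Definition dT m := T - t m.

Let dT_ge0 m : level m -> 0 <= dT m.
Proof. by move=> /andP[_ mM]; rewrite subr_ge0 t_leT. Qed.

Let dt_ge0 m : level m -> 0 <= t m - t 1%N.
Proof. by rewrite subr_ge0; apply: t_le. Qed.

Lemma RmE m k x : Rm T t m k x = heat (t m - t 1%N) x (gk k).
Proof.
apply: eq_heat => y; rewrite /gk /pg Rk_poly //; [exact: t1_gt0|exact: t1_ltT].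
Qed.

Lemma FE m n x y : level m -> level n -> F T t m n x y = psi (dT m + dT n) (y - x).
Proof. by move=> /andP[_ mM] /andP[_ nM]; rewrite F_psi ?t_leT. Qed.

Lemma itg_Rm m k : level m -> itg (Rm T t m k).
Proof.
move=> lm; rewrite (_ : Rm T t m k = fun x => heat (t m - t 1%N) x (gk k)).
  exact: itg_heat (dt_ge0 lm) (igk k).
by apply/funext => x; rewrite RmE.
Qed.

Lemma Rm1 k x : Rm T t 1 k x = gk k x.
Proof. by rewrite RmE subrr heat0. Qed.

(** Moving the heat flow of [R^{(m)}_k] onto [F] adds [t_m - t_1] to the variance, so the result no
    longer depends on [m]. *)
Lemma Leb_Rm_F m n k z : level m -> level n ->
  Leb (fun y => Rm T t m k y * F T t m n y z) = cpsi (dT 1 + dT n) (gk k) z.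
Proof.
move=> lm ln; rewrite (eq_Leb (g := fun y => heat (t m - t 1%N) y (gk k) * psi (dT m + dT n) (z - y))).
  rewrite Leb_heat_psi; [|exact: dt_ge0 lm|by rewrite addr_ge0 ?dT_ge0|exact: igk].
  by have -> : t m - t 1%N + (dT m + dT n) = dT 1 + dT n by rewrite /dT; ring.
by move=> y; rewrite RmE FE.
Qed.

Lemma PhiE m k z : level m -> Phi T t m k z = cpsi (dT 1 + dT m) (gk k) z.
Proof. by move=> lm; exact: Leb_Rm_F. Qed.

Let v_ge0 m : level m -> 0 <= dT 1 + dT m.
Proof. by move=> lm; rewrite addr_ge0 ?dT_ge0. Qed.

Lemma msr_Phi m k : level m -> msr (Phi T t m k).
Proof.
move=> lm; rewrite (_ : Phi T t m k = cpsi (dT 1 + dT m) (gk k)).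
  exact: msr_cpsi (v_ge0 lm) (igk k).
by apply/funext => z; exact: PhiE.
Qed.

Lemma bdd_Phi m k : level m -> bdd (Leb (fun y => `|gk k y|)) (Phi T t m k).
Proof. by move=> lm z; rewrite PhiE // bdd_cpsi // v_ge0. Qed.

Definition gramR k l := gram (t 1%N) (dT 1 + dT 1)
  (Rpoly (c1 T t ^+ 2 / 2) (z1 T t ^- 2) k) (Rpoly (c1 T t ^+ 2 / 2) (z1 T t ^- 2) l).

Lemma Leb_Rm_psi m k x : level m ->
  Leb (fun y => Rm T t m k y * psi (dT 1 + dT m) (y - x)) =
  Leb (fun y => gk k y * psi (dT 1 + dT 1) (y - x)).
Proof.
move=> lm; rewrite (eq_Leb (g := fun y => heat (t m - t 1%N) y (gk k) * psi (dT 1 + dT m) (y - x))).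
  rewrite (Leb_heat_psi' x (dt_ge0 lm) (v_ge0 lm) (igk k)).
  by have -> : t m - t 1%N + (dT 1 + dT m) = dT 1 + dT 1 by rewrite /dT; ring.
by move=> y; rewrite RmE.
Qed.

(** By duality all the heat evolution is again brought back to time [t_1], so the skew inner
    products are the same at every level. *)
Lemma Leb_Rm_Phi m k l : level m ->
  Leb (fun y => Rm T t m k y * Phi T t m l y) = gramR l k.
Proof.
move=> lm; rewrite (eq_Leb (g := fun y => Rm T t m k y * cpsi (dT 1 + dT m) (gk l) y)); last first.
  by move=> y; rewrite PhiE.
rewrite (Leb_cpsi (v_ge0 lm) (itg_Rm k lm) (igk l)).
by rewrite /gramR /gram; apply: eq_Leb => x; rewrite Leb_Rm_psi.
Qed.

Lemma Leb_pk_Phi n m k z : level n -> level m -> (n < m)%N ->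
  Leb (fun y => pk (t m - t n) z y * Phi T t m k y) = Phi T t n k z.
Proof.
move=> ln lm nm; have s0 : 0 < t m - t n.
  by rewrite subr_gt0 t_lt // nm; case/andP: lm.
rewrite (eq_Leb (g := fun y => pk (t m - t n) z y * cpsi (dT 1 + dT m) (gk k) y)); last first.
  by move=> y; rewrite PhiE.
rewrite (Leb_cpsi (v_ge0 lm) (itg_pk z s0) (igk k)) (PhiE _ _ ln).
apply: eq_Leb => x; congr (_ * _).
rewrite -(heatE _ _ s0) (heat_psi_shift _ _ (ltW s0) (v_ge0 lm)).
by have -> : t m - t n + (dT 1 + dT m) = dT 1 + dT n by rewrite /dT; ring.
Qed.

Lemma Leb_Rm_pk m n k z : level m -> level n -> (m < n)%N ->
  Leb (fun y => Rm T t m k y * pk (t n - t m) y z) = Rm T t n k z.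
Proof.
move=> lm ln mn; have s0 : 0 < t n - t m.
  by rewrite subr_gt0 t_lt // mn; case/andP: ln.
rewrite RmE -(_ : t n - t m + (t m - t 1%N) = t n - t 1%N); last by ring.
rewrite -(heat_heat_itg z (ltW s0) (dt_ge0 lm) (igk k)) heatE //.
by apply: eq_Leb => y; rewrite RmE mulrC pk_sym.
Qed.

Lemma Leb_pk_F l m n x z : level l -> level m -> level n -> (l < m)%N ->
  Leb (fun y => pk (t m - t l) x y * F T t m n y z) = F T t l n x z.
Proof.
move=> ll lm ln lt_lm; have s0 : 0 < t m - t l.
  by rewrite subr_gt0 t_lt // lt_lm; case/andP: lm.
rewrite (eq_Leb (g := fun y => pk (t m - t l) x y * psi (dT m + dT n) (z - y))); last first.
  by move=> y; rewrite FE.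
have v0 : 0 <= dT m + dT n by rewrite addr_ge0 ?dT_ge0.
rewrite -(heatE _ _ s0) (heat_psi_reflect _ _ (ltW s0) v0) (FE _ _ ll ln).
by have -> : t m - t l + (dT m + dT n) = dT l + dT n by rewrite /dT; ring.
Qed.

Lemma Leb_pk_pk l m n x z : level m -> level n -> (l < m)%N -> (m < n)%N ->
  Leb (fun y => pk (t m - t l) x y * pk (t n - t m) y z) = pk (t n - t l) x z.
Proof.
move=> /andP[_ lm] /andP[_ ln] l_m m_n; rewrite pk_conv ?subr_gt0 ?t_lt ?l_m ?m_n //.
by have -> : t m - t l + (t n - t m) = t n - t l by ring.
Qed.

Lemma F_anti m n x y : level m -> level n -> F T t m n x y = - F T t n m y x.
Proof.
move=> lm ln; rewrite (FE _ _ lm ln) (FE _ _ ln lm) psiBC; last by rewrite addr_ge0 ?dT_ge0.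
by rewrite [dT n + _]addrC.
Qed.

Definition idx := (nat + bool * (nat * R))%type.

Definition Pk m n x y : R := pk (t n - t m) x y * (m < n)%N%:R.

(** The guard makes [KA] antisymmetric on all indices: the antisymmetry of [F] is established only
    for times up to [T]. *)
Definition Fg m n x y : R := if level m && level n then F T t m n x y else 0.

(** A [false] index has the roles of [Phi] and [F], a [true] index those of [R^{(m)}] and of the
    arrival point of a transition; two [true] indices do not interact. *)
Definition KA (u v : idx) : R :=
  match u, v with
  | inl k, inl l => gramR k l
  | inl k, inr (false, (m, x)) => Phi T t m k x
  | inl k, inr (true, (m, x)) => Rm T t m k x
  | inr (false, (m, x)), inl k => - Phi T t m k x
  | inr (true, (m, x)), inl k => - Rm T t m k x
  | inr (false, (m, x)), inr (false, (n, y)) => Fg m n x y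
  | inr (false, (m, x)), inr (true, (n, y)) => Pk m n x y
  | inr (true, (m, x)), inr (false, (n, y)) => - Pk n m y x
  | inr (true, _), inr (true, _) => 0
  end.

Lemma KA_anti u v : KA u v = - KA v u.
Proof.
case: u v => [k|[[] [m x]]] [l|[[] [n y]]] //=; rewrite ?opprK ?oppr0 //.
  apply: gram_anti; first exact: t1_gt0.
  by apply: addr_gt0; rewrite subr_gt0 t1_ltT.
rewrite /Fg; case lm: (level m); case ln: (level n); [exact: (F_anti x y lm ln)|..];
  exact: (esym (oppr0 _)).
Qed.

Definition lev_ok (u : idx) := if u is inr (_, (m, _)) then level m else true.

(** Weights of the indices when a point of level [m] is integrated. The two indices of a particle of
    level [l] together weigh -1 if [l = m] and 0 otherwise ([sum_Xm]). *)
Definition Xm m (u : idx) : R :=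
  match u with
  | inl _ => 1
  | inr (false, (l, _)) => (l < m)%N%:R
  | inr (true, (l, _)) => - (l <= m)%N%:R
  end.

Lemma itg_KA2 m u : level m -> lev_ok u -> itg (fun y => KA (inr (true, (m, y))) u).
Proof.
move=> lm; case: u => [k _|[[] [l x]] ll] /=.
- have := itgZ (-1) (itg_Rm k lm); apply: eq_integrable => // y _ /=.
  by rewrite mulN1r.
- exact: itg0.
rewrite /Pk; case: ltnP => [l_m|_].
  have s0 : 0 < t m - t l by rewrite subr_gt0 t_lt // l_m; case/andP: lm.
  have := itgZ (-1) (itg_pk x s0); apply: eq_integrable => // y _ /=.
  by rewrite mulr1 mulN1r.
by apply: eq_integrable (@itg0 R) => // y _ /=; rewrite mulr0 oppr0.
Qed.

Lemma msr_bdd_KA1 m v : level m -> lev_ok v ->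
  msr (fun y => KA (inr (false, (m, y))) v) /\ exists C, bdd C (fun y => KA (inr (false, (m, y))) v).
Proof.
move=> lm; case: v => [k _|[[] [n z]] ln] /=.
- split; first by apply: measurableT_comp (msr_Phi k lm).
  by eexists => y; rewrite normrN; exact: bdd_Phi.
- rewrite /Pk; case: ltnP => [m_n|_].
    have s0 : 0 < t n - t m by rewrite subr_gt0 t_lt // m_n; case/andP: ln.
    have E : (fun y => pk (t n - t m) y z * true%:R) = pk (t n - t m) z.
      by apply/funext => y; rewrite mulr1 pk_sym.
    by rewrite E; split; [exact: msr_pk|eexists; exact: bdd_pk].
  have E : (fun y => pk (t n - t m) y z * false%:R) = fun _ => 0.
    by apply/funext => y; rewrite mulr0.
  by rewrite E; split; [exact: msr_cst|exists 0 => y; rewrite normr0].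
have E : (fun y => Fg m n y z) = fun y => psi (dT m + dT n) (z - y).
  by apply/funext => y; rewrite /Fg lm (ln : level n) FE.
have v0 : 0 <= dT m + dT n by rewrite addr_ge0 ?dT_ge0.
rewrite E; split; first exact: msr_psi_reflect.
by exists 1 => y; exact: bdd_psi.
Qed.

Lemma itg_KA21 m u v : level m -> lev_ok u -> lev_ok v ->
  itg (fun y => KA (inr (true, (m, y))) u * KA (inr (false, (m, y))) v).
Proof.
move=> lm lu lv; have [mv [C Cv]] := msr_bdd_KA1 lm lv.
by have := itg_bddM mv Cv (itg_KA2 lm lu); apply: eq_integrable => // y _ /=; rewrite mulrC.
Qed.

Definition EE m u v := Leb (fun y => KA (inr (true, (m, y))) u * KA (inr (false, (m, y))) v).

(** Case by case, the integral over the point of level [m] reproduces an entry of [KA] or vanishes,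
    according to the time order of [m] and the levels of [u] and [v]. This is the hypothesis of
    [rsum_rsum_pf]. *)
Lemma EE_diff m u v : level m -> lev_ok u -> lev_ok v ->
  EE m u v - EE m v u = - ((Xm m u + Xm m v) * KA u v).
Proof.
move=> lm.
have lzero (f g : R -> R) : (forall y, f y = 0) -> Leb (fun y => f y * g y) = 0.
  by move=> f0; rewrite -[RHS](@Leb0 R); apply: eq_Leb => y; rewrite f0 mul0r.
have rzero (f g : R -> R) : (forall y, g y = 0) -> Leb (fun y => f y * g y) = 0.
  by move=> f0; rewrite -[RHS](@Leb0 R); apply: eq_Leb => y; rewrite f0 mulr0.
have Ebb k l : EE m (inl k) (inl l) = gramR l k.
  rewrite -(Leb_Rm_Phi k l lm); apply: eq_Leb => y /=; rewrite mulrNN //.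
have Eb1 k n z : level n -> EE m (inl k) (inr (false, (n, z))) = - Phi T t n k z.
  move=> ln; rewrite PhiE // -(Leb_Rm_F k z lm ln) -LebN; last first.
    have := itg_KA21 lm (u := inl k) (v := inr (false, (n, z))) isT ln.
    move/(itgZ (-1)); apply: eq_integrable => // y _ /=.
    by rewrite /Fg lm ln mulN1r mulNr opprK.
  by apply: eq_Leb => y /=; rewrite /Fg lm ln mulNr.
have E1b k n z : level n -> EE m (inr (false, (n, z))) (inl k) = (n < m)%N%:R * Phi T t n k z.
  move=> ln; case: ltnP => nm.
    rewrite mul1r -(Leb_pk_Phi k z ln lm nm); apply: eq_Leb => y /=.
    by rewrite mulrNN /Pk nm mulr1.
  by rewrite mul0r; apply: lzero => y; rewrite /= /Pk ltnNge nm mulr0 oppr0.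
have E2x n z w : EE m (inr (true, (n, z))) w = 0 by apply: lzero.
have Eb2 k n z : level n -> EE m (inl k) (inr (true, (n, z))) = - ((m < n)%N%:R * Rm T t n k z).
  move=> ln; case: ltnP => mn.
    rewrite mul1r -(Leb_Rm_pk k z lm ln mn) -LebN.
      by apply: eq_Leb => y /=; rewrite /Pk mn mulr1 mulNr.
    have := itg_KA21 lm (u := inl k) (v := inr (true, (n, z))) isT ln.
    move/(itgZ (-1)); apply: eq_integrable => // y _ /=.
    by rewrite /Pk mn mulr1 mulN1r mulNr opprK.
  by rewrite mul0r oppr0; apply: rzero => y; rewrite /= /Pk ltnNge mn mulr0.
have E11 l x n z : level l -> level n ->
    EE m (inr (false, (l, x))) (inr (false, (n, z))) = - ((l < m)%N%:R * F T t l n x z).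
  move=> ll ln; case: ltnP => l_m.
    rewrite mul1r -(Leb_pk_F x z ll lm ln l_m) -LebN.
      by apply: eq_Leb => y /=; rewrite /Pk l_m mulr1 /Fg lm ln mulNr.
    have := itg_KA21 lm (u := inr (false, (l, x))) (v := inr (false, (n, z))) ll ln.
    move/(itgZ (-1)); apply: eq_integrable => // y _ /=.
    by rewrite /Pk l_m mulr1 /Fg lm ln mulN1r mulNr opprK.
  by rewrite mul0r oppr0; apply: lzero => y; rewrite /= /Pk ltnNge l_m mulr0 oppr0.
have E12 l x n z : level l -> level n ->
    EE m (inr (false, (l, x))) (inr (true, (n, z))) =
    - ((l < m)%N%:R * (m < n)%N%:R * pk (t n - t l) x z).
  move=> ll ln; case: (ltnP l m) => l_m; last first.
    by rewrite !mul0r oppr0; apply: lzero => y; rewrite /= /Pk ltnNge l_m mulr0 oppr0.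
  case: ltnP => mn; last first.
    by rewrite mulr0 mul0r oppr0; apply: rzero => y; rewrite /= /Pk ltnNge mn mulr0.
  rewrite !mul1r -(Leb_pk_pk x z lm ln l_m mn) -LebN.
    by apply: eq_Leb => y /=; rewrite /Pk l_m mn !mulr1 mulNr.
  have := itg_KA21 lm (u := inr (false, (l, x))) (v := inr (true, (n, z))) ll ln.
  move/(itgZ (-1)); apply: eq_integrable => // y _ /=.
  by rewrite /Pk l_m mn !mulr1 mulN1r mulNr opprK.
have sym a b : EE m b a - EE m a b = - ((Xm m b + Xm m a) * KA b a) ->
    EE m a b - EE m b a = - ((Xm m a + Xm m b) * KA a b).
  by move=> H; rewrite -opprB H (KA_anti a b); ring.
have Db1 k n z : level n -> EE m (inl k) (inr (false, (n, z))) - EE m (inr (false, (n, z))) (inl k) =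
    - ((Xm m (inl k) + Xm m (inr (false, (n, z)))) * KA (inl k) (inr (false, (n, z)))).
  by move=> ln; rewrite Eb1 // E1b //=; ring.
have Db2 k n z : level n -> EE m (inl k) (inr (true, (n, z))) - EE m (inr (true, (n, z))) (inl k) =
    - ((Xm m (inl k) + Xm m (inr (true, (n, z)))) * KA (inl k) (inr (true, (n, z)))).
  by move=> ln; rewrite Eb2 // E2x /= [(m < n)%N]ltnNge; case: (n <= m)%N => /=; ring.
have D12 l x n z : level l -> level n ->
    EE m (inr (false, (l, x))) (inr (true, (n, z))) - EE m (inr (true, (n, z))) (inr (false, (l, x))) =
    - ((Xm m (inr (false, (l, x))) + Xm m (inr (true, (n, z)))) *
      KA (inr (false, (l, x))) (inr (true, (n, z)))).
  move=> ll ln; rewrite E12 // E2x /= /Pk [(m < n)%N]ltnNge.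
  case: (ltnP l m) => l_m; case: (leqP n m) => n_m /=; rewrite ?(ltn_trans l_m n_m);
    rewrite ?(leq_ltn_trans l_m n_m) /=; try ring.
  by rewrite ltnNge (leq_trans n_m l_m) /=; ring.
case: u v => [k|[[] [l x]]] [k'|[[] [n z]]] lu lv.
- by rewrite !Ebb /= /gramR gram_anti; [|exact: t1_gt0|by apply: addr_gt0; rewrite subr_gt0 t1_ltT];
    rewrite -/(gramR _ _); ring.
- exact: Db2.
- exact: Db1.
- exact/sym/Db2.
- by rewrite !E2x /= mulr0 subrr oppr0.
- exact/sym/D12.
- exact/sym/Db1.
- exact: D12.
have ll : level l := lu; have ln : level n := lv.
rewrite (E11 _ _ _ _ ll ln) (E11 _ _ _ _ ln ll) /KA /Fg /Xm ll ln [true && true]/= (F_anti z x ln ll).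
by move: (F T t l n x z) => f; ring.
Qed.

End Kernel.

(** * The skew inner products at time [t_1] are the [r_k] *)

Section GramTable.
Context {R : realType}.
Variables (T : R) (t : nat -> R).
Hypotheses (t1 : 0 < t 1%N) (t1T : t 1%N < T).
Local Opaque Leb Rpoly gram skew_norm.

Lemma gramR_rj k l :
  [/\ gramR T t k.*2 l.*2 = 0, gramR T t k.*2.+1 l.*2.+1 = 0 &
      gramR T t k.*2 l.*2.+1 = (k == l)%:R * rj T t k].
Proof.
have T0 : 0 < T by exact: lt_trans t1T.
pose s := t 1%N; pose v := (T - s) + (T - s).
have s0 : 0 < s := t1.
have d0 : 0 < T - s by rewrite subr_gt0.
have v0 : 0 < v by rewrite addr_gt0.
pose al := s^-1 + v^-1; pose be := v^-1.
pose w := al / (al ^+ 2 - be ^+ 2); pose wr := be / (al ^+ 2 - be ^+ 2).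
have sN : s != 0 by rewrite gt_eqF.
have vN : v != 0 by rewrite gt_eqF.
have TN : T != 0 by rewrite gt_eqF.
have vE : v = 2 * T - 2 * s by rewrite /v; ring.
have D : al ^+ 2 - be ^+ 2 = 2 * T / (s ^+ 2 * v).
  by rewrite /al /be vE; move: vN; rewrite vE => vN; field; rewrite vN sN.
have u0 : 0 < 2 * T - s by move: d0; lra.
have wE : w = c1 T t ^+ 2 / 2.
  rewrite /w D /c1 -/s sqr_sqrtr; last by rewrite ltW // divr_gt0 ?mulr_gt0.
  by rewrite /al; move: (vN); rewrite vE => vN'; field; rewrite TN vN'.
have wrE : wr = t 1%N ^+ 2 / (2 * T).
  by rewrite /wr D /be -/s; move: (vN); rewrite vE => vN'; field; rewrite TN vN'.
have rhoE : wr / w = z1 T t ^- 2.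
  rewrite wrE wE /c1 /z1 -/s !sqr_sqrtr; first last.
  - by rewrite ltW // divr_gt0 ?mulr_gt0.
  - by rewrite ltW // divr_gt0 ?mulr_gt0.
  by field; rewrite TN sN gt_eqF.
have [] := @gram_Rpoly R s v s0 v0 al be w wr erefl erefl erefl erefl k l.
by rewrite rhoE wE (skew_norm_rj t1 t1T k (v := v) _ wrE).
Qed.

End GramTable.

(** * Expanding along two rows, and integrating signed extractions termwise *)

Lemma pf_cons2 (T : eqType) (R : comNzRingType) (A : T -> T -> R) a b s :
  pf A (a :: b :: s) = A a b * pf A s
    - rsum (fun u => rsum (fun v r => A a u * A b v * pf A r)) s.
Proof.
rewrite pf_cons /=; congr (_ - _); apply: eq_rsum => u r.
by rewrite pf_cons -rsumZ; apply: eq_rsum => v r'; rewrite mulrA.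
Qed.

Section LebRsum.
Context {R : realType}.
Variable T : eqType.
Local Opaque Leb.

Lemma Leb_rsum (s : seq T) (G : R -> T -> seq T -> R) :
  (forall u r, perm_eq s (u :: r) -> itg (fun y => G y u r)) ->
  itg (fun y => rsum (G y) s) /\
  Leb (fun y => rsum (G y) s) = rsum (fun u r => Leb (fun y => G y u r)) s.
Proof.
elim: s G => [|w s IH] G H; first by split; [exact: itg0|exact: Leb0].
have iw : itg (fun y => G y w s) by exact: H.
have [|i e] := IH (fun y v r => G y v (w :: r)).
  move=> v r pr; apply: H.
  by rewrite (perm_trans (y := w :: v :: r)) ?perm_cons // (perm_catCA [:: w] [:: v]).
by split; [exact: itgB iw i|rewrite /= (LebB iw i) e].
Qed.

Lemma Leb_rsum2 (s : seq T) (f : R -> T -> T -> R) (g : seq T -> R) :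
  {in s &, forall u v, itg (fun y => f y u v)} ->
  let h y := rsum (fun u => rsum (fun v r => f y u v * g r)) s in
  itg h /\ Leb h = rsum (fun u => rsum (fun v r => Leb (fun y => f y u v) * g r)) s.
Proof.
move=> H h.
have i1 u v c : u \in s -> v \in s -> itg (fun y => f y u v * c).
  move=> us vs; have := itgZ c (H u v us vs); apply: eq_integrable => // y _ /=.
  by rewrite mulrC.
have L u r : perm_eq s (u :: r) ->
    itg (fun y => rsum (fun v r' => f y u v * g r') r) /\
    Leb (fun y => rsum (fun v r' => f y u v * g r') r) =
    rsum (fun v r' => Leb (fun y => f y u v) * g r') r.
  move=> pr; have us : u \in s by rewrite (perm_mem pr) mem_head.
  have rs v : v \in r -> v \in s by rewrite (perm_mem pr) inE orbC => ->.
  have [|i e] := @Leb_rsum r (fun y v r' => f y u v * g r').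
    by move=> v r' /perm_mem/(_ v); rewrite mem_head => vr; apply: i1 => //; exact: rs.
  split=> //; rewrite e; apply: eq_rsum_perm => v r' /perm_mem/(_ v).
  rewrite mem_head => /rs vs; rewrite [RHS]mulrC -LebZ; last exact: H.
  by apply: eq_Leb => y; exact: mulrC.
have [|i e] := @Leb_rsum s (fun y u => rsum (fun v r => f y u v * g r)).
  by move=> u r /L[].
split=> //; rewrite e; apply: eq_rsum_perm => u r pr.
by have [_ ->] := L u r pr.
Qed.

End LebRsum.

(** * Particles as pairs of indices, and the bordered Pfaffian *)

Section Points.
Context {R : realType}.
Implicit Types (p : nat * R) (pts pre u v s : seq (nat * R)).

Definition pair12 p : idx (R := R) * idx (R := R) := (inr (true, p), inr (false, p)).

Definition prs pts := dbl [seq pair12 p | p <- pts].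

Lemma prs_cat s1 s2 : prs (s1 ++ s2) = prs s1 ++ prs s2.
Proof. by rewrite /prs map_cat dbl_cat. Qed.

Lemma size_prs pts : size (prs pts) = (size pts).*2.
Proof. by rewrite size_dbl size_map. Qed.

Lemma mem_prs (u : idx) pts : (u \in prs pts) =
  if u is inr (_, p) then p \in pts else false.
Proof.
elim: pts => [|p pts IH]; first by case: u => [|[]].
rewrite /prs /= !inE -/(prs pts) IH.
case: u {IH} => [k|[b q]] //=; rewrite !inE.
have -> : (inr (b, q) == inr (true, p) :> idx) = b && (q == p) by case: b.
have -> : (inr (b, q) == inr (false, p) :> idx) = ~~ b && (q == p) by case: b.
by case: b => /=; case: (q == p).
Qed.

Variables (N : nat) (K : idx (R := R) -> idx (R := R) -> R).
Hypothesis KN : forall a b : idx, K a b = - K b a.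

Definition border : seq (idx (R := R)) := [seq inl k | k <- iota 0 N].

Definition pfB pts := pf K (border ++ prs pts).

(** A particle carries two indices, so moving it is an even permutation; hence [pfB] depends only on
    the multiset of particles. *)
Lemma pfB_front p s1 s2 : pfB (s1 ++ p :: s2) = pfB (p :: s1 ++ s2).
Proof.
have pA := pf_alternating KN.
rewrite /pfB prs_cat -[p :: s2]cat1s -[p :: s1 ++ s2]cat1s !prs_cat.
have := alternating_block (prs s1) (prs [:: p]) (prs s2) (alternating_cat border pA).
by move=> /= ->; rewrite size_prs -signr_odd oddM odd_double mul1r.
Qed.

Lemma pfB_perm s1 s2 : perm_eq s1 s2 -> pfB s1 = pfB s2.
Proof.
suff H pre : perm_eq s1 s2 -> pfB (pre ++ s1) = pfB (pre ++ s2) by exact: (H [::]).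
elim: s1 s2 pre => [|a s1 IH] s2 pre; first by rewrite perm_sym => /perm_nilP ->.
move=> pa; have ain : a \in s2 by rewrite -(perm_mem pa) mem_head.
case/splitPr: ain pa => u v pa; have pa' : perm_eq s1 (u ++ v).
  by rewrite -(perm_cons a) (perm_trans pa) // (perm_catCA u [:: a] v).
rewrite -cat_rcons (IH _ _ pa') [in RHS]catA.
by rewrite [RHS]pfB_front cat_rcons pfB_front -catA.
Qed.

End Points.

(** * Hidden particles and the factors produced by integrating them *)

Section Hidden.
Context {R : realType}.
Variable N : nat.

Definition lvl (o : seq (nat * R)) m := count_mem m (unzip1 o).

Fixpoint hid (ms : seq nat) (z : nat -> R) : seq (nat * R) :=
  if ms is m :: ms' then (m, z 0%N) :: hid ms' (fun k => z k.+1) else [::].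

Lemma eq_iint n (f g : (nat -> R) -> R) : f =1 g -> iint n f = iint n g.
Proof.
elim: n f g => [|n IH] f g fg /=; first exact: fg.
by apply: eq_Leb => x; apply: IH => v; exact: fg.
Qed.

(** Here [c l] is the number of particles of level [l] preceding the one integrated. Innermost
    variables are integrated first, so the counter grows along [ms]. *)
Fixpoint cf (c : nat -> nat) (ms : seq nat) : R :=
  if ms is m :: ms' then (N%:R - (c m)%:R) * cf (fun l => (m == l) + c l)%N ms' else 1.

Lemma eq_cf c c' ms : c =1 c' -> cf c ms = cf c' ms.
Proof.
elim: ms c c' => //= m ms IH c c' cc; rewrite cc; congr (_ * _).
by apply: IH => l; rewrite cc.
Qed.

Lemma cf_nseq c m k rest : (c m + k = N)%N ->
  cf c (nseq k m ++ rest) = k`!%:R * cf (fun l => (m == l) * k + c l)%N rest.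
Proof.
elim: k c => [|k IH] c ck /=; first by rewrite mul1r; apply: eq_cf => l; rewrite muln0.
rewrite IH; last by rewrite eqxx; lia.
have -> : N%:R - (c m)%:R = k.+1%:R :> R by rewrite -ck natrD addrC addKr.
rewrite mulrA -natrM -factS; congr (_ * _); apply: eq_cf => l; lia.
Qed.

End Hidden.

(** * Integrating out particles *)

Section Integration.
Context {R : realType}.
Variables (T : R) (t : nat -> R) (M : nat).
Hypotheses (M1 : (1 <= M)%N) (t00 : t 0%N = 0).
Hypotheses (tS : forall m, (m <= M)%N -> t m < t m.+1) (tM : t M.+1 = T).
Local Opaque Leb pk Fg Rm Phi gramR.
Implicit Types (o : seq (nat * R)).

Let K := KA T t M.
Let KN := KA_anti M1 t00 tS tM.

Variable N : nat.

Lemma sum_Xm m o : \sum_(u <- border (R := R) N ++ prs o) Xm m u = N%:R - (lvl o m)%:R.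
Proof.
rewrite big_cat /= /border big_map; congr (_ + _).
  by rewrite big_const_seq count_predT size_iota iter_addr_0.
elim: o => [|[l x] o IH]; first by rewrite big_nil oppr0.
rewrite /prs /= !big_cons -/(prs o) IH /lvl /= natrD; case: (ltngtP l m) => _ /=; ring.
Qed.

Definition lev_pts o := forall p, p \in o -> level M p.1.

Lemma lev_ok_pts o u : lev_pts o -> u \in border N ++ prs o -> lev_ok M u.
Proof.
move=> lo; rewrite mem_cat => /orP[/mapP[k _ ->]//|]; rewrite mem_prs.
by case: u => // -[b [m x]] /lo.
Qed.

(** Expanding along the two indices of the new particle and integrating puts [EE] inside a double
    extraction; [rsum_rsum_pf] then returns the same Pfaffian times the total weight
    [N - lvl o m]. *)
Lemma Leb_pfB m o : level M m -> lev_pts o ->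
  itg (fun y => pfB N K (rcons o (m, y))) /\
  Leb (fun y => pfB N K (rcons o (m, y))) = (N%:R - (lvl o m)%:R) * pfB N K o.
Proof.
move=> lm lo; pose s := border (R := R) N ++ prs o.
pose f y u v := K (inr (true, (m, y))) u * K (inr (false, (m, y))) v.
have E y : pfB N K (rcons o (m, y)) = - rsum (fun u => rsum (fun v r => f y u v * pf K r)) s.
  rewrite -cats1 (pfB_front N KN) cats0 /pfB /prs /= -/(prs o).
  have pA := pf_alternating KN.
  have := alternating_block (border N) (prs [:: (m, y)]) (prs o) pA.
  move=> /= ->; rewrite muln2 -signr_odd odd_double mul1r.
  (* The two indices of one particle do not pair: the heat kernel entry requires strictly increasing
     levels. *)
  have K0 : K (inr (true, (m, y))) (inr (false, (m, y))) = 0.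
    by rewrite /K /= /Pk ltnn mulr0 oppr0.
  by rewrite pf_cons2 -/s [KA T t M (inr (true, _)) (inr (false, _))]K0 mul0r sub0r.
have [|i e] := @Leb_rsum2 R _ s f (pf K).
  by move=> u v us vs; apply: itg_KA21 => //; apply: lev_ok_pts lo _.
split.
  have := itgZ (-1) i; apply: eq_integrable => // y _ /=.
  by rewrite E mulN1r.
rewrite (eq_Leb E) LebN // e -sum_Xm -/s /pfB -/s.
apply: (rsum_rsum_pf KN) => u v us vs.
by apply: EE_diff => //; apply: lev_ok_pts lo _.
Qed.

Lemma iint_pfB C ms o : (forall m, m \in ms -> level M m) -> lev_pts o ->
  iint (size ms) (fun z => C * pfB N K (o ++ hid ms z)) = C * (cf N (lvl o) ms * pfB N K o).
Proof.
elim: ms o => [|m ms IH] o lm lo /=; first by rewrite cats0 mul1r.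
have lm' : level M m by apply: lm; exact: mem_head.
have [i e] := Leb_pfB lm' lo.
transitivity (Leb (fun x => C * cf N (lvl (rcons o (m, x))) ms * pfB N K (rcons o (m, x)))).
  apply: eq_Leb => x; rewrite -mulrA -IH; first last.
  - by move=> p; rewrite mem_rcons inE => /predU1P[->|/lo].
  - by move=> l lms; apply: lm; rewrite inE lms orbT.
  by apply: eq_iint => v; rewrite /= cat_rcons.
set c := fun l => ((m == l) + lvl o l)%N.
transitivity (Leb (fun x => C * cf N c ms * pfB N K (rcons o (m, x)))).
  apply: eq_Leb => x; congr (_ * _ * _); apply: eq_cf => l.
  by rewrite /c /lvl /unzip1 map_rcons -cats1 count_cat /= addn0 addnC.
by rewrite (LebZ _ i) e -!mulrA; congr (_ * _); exact: mulrCA.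
Qed.

End Integration.

(** * Eliminating the border and recognising the quaternion entries *)

Section Schur.
Context {R : realType}.
Variables (T : R) (t : nat -> R) (M : nat).
Hypotheses (M1 : (1 <= M)%N) (t00 : t 0%N = 0).
Hypotheses (tS : forall m, (m <= M)%N -> t m < t m.+1) (tM : t M.+1 = T).
Local Opaque Leb pk F Rm Phi gramR rj.

Let t1 : 0 < t 1%N. Proof. exact: t1_gt0 t00 tS. Qed.
Let t1T : t 1%N < T. Proof. exact: t1_ltT M1 tS tM. Qed.

Definition KS n (u v : idx) : R := KA T t M u v - \sum_(k < n) (rj T t k)^-1 *
  (KA T t M (inl k.*2) u * KA T t M (inl k.*2.+1) v
   - KA T t M (inl k.*2) v * KA T t M (inl k.*2.+1) u).

Lemma KS_anti n u v : KS n u v = - KS n v u.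
Proof.
rewrite /KS opprB (KA_anti M1 t00 tS tM u v) addrC; congr (_ - _).
rewrite -sumrN; apply: eq_bigr => k _; rewrite -mulrN; congr (_ * _).
by rewrite opprB.
Qed.

Let KA_oe k l : KA T t M (inl k.*2.+1) (inl l.*2) = - ((k == l)%:R * rj T t k).
Proof.
rewrite (KA_anti M1 t00 tS tM) /=; have [_ _ ->] := gramR_rj t1 t1T l k.
by rewrite eq_sym; case: eqP => [->|_] //; rewrite !mul0r.
Qed.

Lemma KS_even n u : KS n (inl n.*2) u = KA T t M (inl n.*2) u.
Proof.
rewrite /KS big1 ?subr0 // => k _; rewrite KA_oe ltn_eqF // mul0r oppr0 mulr0 subr0 /=.
by have [-> _ _] := gramR_rj t1 t1T k n; rewrite mul0r mulr0.
Qed.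

Lemma KS_odd n u : KS n (inl n.*2.+1) u = KA T t M (inl n.*2.+1) u.
Proof.
rewrite /KS big1 ?subr0 // => k _; rewrite [KA _ _ _ (inl _) (inl n.*2.+1)]/=.
have [_ _ ->] := gramR_rj t1 t1T k n; rewrite ltn_eqF // !mul0r sub0r /=.
by have [_ -> _] := gramR_rj t1 t1T k n; rewrite !mulr0 oppr0 mulr0.
Qed.

(** By skew-orthogonality the corrections already made do not touch the rows [2j] and [2j+1]. The
    pivot is therefore [r_j], and its Schur complement subtracts exactly the term of index [j]. *)
Lemma pf_border n j s : pf (KS j) ([seq inl k | k <- iota j.*2 n.*2] ++ s) =
  (\prod_(j <= k < j + n) rj T t k) * pf (KS (j + n)%N) s.
Proof.
elim: n j => [|n IH] j; first by rewrite addn0 big_geq // mul1r.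
have rN : KS j (inl j.*2) (inl j.*2.+1) = rj T t j.
  rewrite KS_even /=; have [_ _ ->] := gramR_rj t1 t1T j j.
  by rewrite eqxx mul1r.
rewrite doubleS /= pf_schur rN ?gt_eqF ?rj_gt0 //.
rewrite addnS -addSn big_ltn; last by rewrite addSn ltnS leq_addr.
rewrite -mulrA -IH doubleS; congr (_ * _).
apply: eq_pf => u v _ _.
rewrite !KS_even !KS_odd {2}/KS big_ord_recr /= /KS opprD addrA; congr (_ - _).
by rewrite mulrC.
Qed.

Lemma pfB_schur n pts : pfB n.*2 (KA T t M) pts =
  (\prod_(k < n) rj T t k) * pf (KS n) (prs pts).
Proof.
rewrite -(big_mkord xpredT (fun k => rj T t k)) -[n in RHS]add0n -pf_border.
by apply: eq_pf => u v _ _; rewrite /KS big_ord0 subr0.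
Qed.

Lemma Tdet_TdS (I : finType) (Q : I -> I -> 'M[R]_2) : Tdet Q = TdS [set: I] Q.
Proof.
rewrite TdetE /TdS; apply: eq_big => s; first by rewrite /perm.perm_on; apply/esym/fintype.subsetP.
move=> _; congr (_ * _); apply: eq_bigr => e _.
by apply: eq_bigl => x; rewrite inE.
Qed.

Lemma KS_qmat N (I : finType) (f : I -> nat * R) z w :
  (forall z, level M (f z).1) ->
  QofB (fun z => inr (false, f z)) (fun z => inr (true, f z)) (KS N./2) z w =
  qmat N T t (f z).1 (f w).1 (f z).2 (f w).2.
Proof.
move=> lf; apply/matrixP => a b; rewrite !mxE.
have sw (r p q q' : R) : r * (p - q * q') = r * (p - q' * q) by rewrite (mulrC q).
have : level M (f z).1 by []. have : level M (f w).1 by [].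
case: (f z) (f w) => m x [n y] /= ln lm.
have [->|->] := ord2P a; have [->|->] := ord2P b; rewrite /KS /=.

- rewrite /St /Sk /Pk mulN1r opprB; congr (_ - _).
  by apply: eq_bigr => k _; exact: sw.
- rewrite mul1r /It /Ik [LHS]addrC /Fg lm ln [true && true]/=.
  apply: (congr2 (fun a b => - a + b)); last by [].
  by apply: eq_bigr => k _; exact: sw.
- rewrite mulN1r sub0r opprK /Dk.
  by apply: eq_bigr => k _; exact: sw.
rewrite mul1r /St /Sk /Pk addrC; congr (_ - _).
rewrite -sumrN; apply: eq_bigr => k _; rewrite -mulrN opprB.
exact: sw.
Qed.

End Schur.

(** * The transition density as a bordered Pfaffian *)

Lemma pf_map (T T' : eqType) (R : comNzRingType) (h : T' -> T) (A : T -> T -> R) s :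
  pf A (map h s) = pf (fun u v => A (h u) (h v)) s.
Proof.
elim/seq_size_ind: s => -[|a s] IH //=; rewrite !pf_cons rsum_map.
by apply: eq_rsum_size => u r sr; rewrite IH //= sr.
Qed.

(** The matrix is the transposed Vandermonde matrix times a triangular matrix with unit diagonal. *)
Lemma det_monic (R : comNzRingType) n (p : nat -> {poly R}) (x : 'I_n -> R) :
  (forall k, (p k \is monic) && (size (p k) == k.+1)) ->
  \det (\matrix_(i < n, j < n) (p j).[x i]) =
  \prod_(i < n) \prod_(j < n | (i < j)%N) (x j - x i).
Proof.
move=> mp; pose c := \matrix_(j < n, k < n) (p j)`_k.
have -> : (\matrix_(i, j) (p j).[x i]) = (Vandermonde n (\row_i x i))^T *m c^T.
  apply/matrixP => i j; rewrite !mxE; have /andP[_ /eqP sp] := mp j.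
  rewrite (@horner_coef_wide _ n) ?sp //.
  by apply: eq_bigr => k _; rewrite !mxE mulrC.
rewrite det_mulmx !det_tr det_Vandermonde det_trig; last first.
  apply/is_trig_mxP => i j ij; rewrite mxE nth_default //.
  by have /andP[_ /eqP ->] := mp i.
rewrite [X in _ * X]big1 ?mulr1.
  by apply: eq_bigr => i _; apply: eq_bigr => j _; rewrite !mxE.
move=> i _; rewrite mxE; have /andP[/monicP pm /eqP sp] := mp i.
by rewrite -[RHS]pm lead_coefE sp.
Qed.

Section Density.
Context {R : realType}.
Variables (T : R) (t : nat -> R) (M : nat).
Hypotheses (M1 : (1 <= M)%N) (t00 : t 0%N = 0).
Hypotheses (tS : forall m, (m <= M)%N -> t m < t m.+1) (tM : t M.+1 = T).
Local Opaque Leb pk F Rm Phi gramR Rpoly.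

Let K := KA T t M.
Let KN := KA_anti M1 t00 tS tM.

Variables (N : nat) (x : nat -> 'I_N -> R).
Hypothesis N2 : ~~ odd N.

Definition levp m := [seq (m, x m i) | i <- enum 'I_N].
Definition allp m k := flatten [seq levp j | j <- iota m k].

Let two m := [seq inr (true, (m, x m i)) : idx | i <- enum 'I_N].
Let one m := [seq inr (false, (m, x m i)) : idx | i <- enum 'I_N].

Lemma allp_level m k p : p \in allp m k -> (m <= p.1)%N.
Proof.
case/flattenP => s /mapP[j]; rewrite mem_iota => /andP[mj _] -> /mapP[i _ ->] //.
Qed.

(** The [true] indices of level [m] vanish against all particles of levels at least [m], so
    [pf_peel] forces them onto the [N] entries of [bs]. Its sign [(-1)^N] is 1 as [N] is even. *)
Lemma pf_level m k bs : size bs = N ->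
  pf K (bs ++ prs (allp m k.+1)) = dt K (two m) bs * pf K (one m ++ prs (allp m.+1 k)).
Proof.
move=> sbs; have pA := pf_alternating KN.
pose ps := [seq pair12 p | p <- levp m].
have e1 : unzip1 ps = two m by rewrite /ps /levp /unzip1 -2!map_comp.
have e2 : unzip2 ps = one m by rewrite /ps /levp /unzip2 -2!map_comp.
have sps : size ps = N by rewrite /ps /levp 2!size_map size_enum_ord.
rewrite [allp m k.+1]/= prs_cat -/(allp m.+1 k) (alternating_block bs (prs _) _ pA).
rewrite size_prs -signr_odd oddM odd_double andbF mul1r.
have E : prs (levp m) = dbl ps by [].
rewrite E (pf_peel KN) ?sps ?e1 ?e2 //.
  by rewrite -signr_odd (negbTE N2) mul1r.
move=> _ u /mapP[i _ ->]; rewrite -E -prs_cat mem_prs.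
case: u => [l|[[] [n y]]] // /(@allp_level m k.+1) /= mn.
by rewrite /Pk ltnNge mn mulr0 oppr0.
Qed.

Lemma pf_levels m k :
  pf K (one m ++ prs (allp m.+1 k)) =
  (\prod_(j < k) dt K (two (m + j).+1) (one (m + j))) * pf K (one (m + k)).
Proof.
elim: k m => [|k IH] m; first by rewrite cats0 addn0 big_ord0 mul1r.
rewrite pf_level; last by rewrite size_map size_enum_ord.
rewrite IH big_ord_recl addn0 addnS -addSn mulrA; congr (_ * _ * _).
by apply: eq_bigr => j _; rewrite lift0 addnS.
Qed.

Let sgnN (f : 'I_N -> 'I_N -> R) : \det (\matrix_(i, j) - f i j) = \det (\matrix_(i, j) f i j).
Proof.
have -> : \matrix_(i, j) - f i j = -1 *: \matrix_(i, j) f i j.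
  by apply/matrixP => i j; rewrite !mxE mulN1r.
by rewrite detZ -signr_odd (negbTE N2) mul1r.
Qed.

Lemma dt_border : dt K (two 1) (border N) = (\prod_(i < N) pk (t 1%N) 0 (x 1%N i)) * hN (x 1%N).
Proof.
have -> : border (R := R) N = [seq inl (val i) | i <- enum 'I_N].
  by rewrite /border -val_enum_ord -map_comp.
rewrite dt_det /K /= (sgnN (fun i j => Rm T t 1 j (x 1%N i))).
set P := fun k => Rpoly (c1 T t ^+ 2 / 2) (z1 T t ^- 2) k.
have -> : \matrix_(i, j < N) Rm T t 1 j (x 1%N i) =
    diag_mx (\row_i pk (t 1%N) 0 (x 1%N i)) *m \matrix_(i, j < N) (P j).[x 1%N i].
  apply/matrixP => i j; rewrite mul_diag_mx !mxE (Rm1 M1 t00 tS tM).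
  by rewrite /gk /pg; exact: mulrC.
rewrite det_mulmx det_diag det_monic; last by move=> k; exact: Rpoly_monic.
by congr (_ * _); apply: eq_bigr => i _; rewrite mxE.
Qed.

Lemma dt_step m : dt K (two m.+1) (one m) =
  \det (\matrix_(i < N, j < N) pk (t m.+1 - t m) (x m i) (x m.+1 j)).
Proof.
rewrite dt_det /K /= (sgnN (fun i j => Pk t m m.+1 (x m j) (x m.+1 i))) -det_tr.
by congr (\det _); apply/matrixP => i j; rewrite !mxE /Pk ltnSn mulr1.
Qed.

(** At the final time both variances in [F] are 0, so the kernel is the bare sign of the difference
    and [pf_sg] applies. *)
Lemma pf_last : pf K (one M.+1) = Num.sg (hN (x M.+1)).
Proof.
have -> : one M.+1 = map (fun y => inr (false, (M.+1, y))) [seq x M.+1 i | i <- enum 'I_N].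
  by rewrite -map_comp.
rewrite pf_map -vdm_sgnE -pf_sg; last by rewrite size_map size_enum_ord.
apply: eq_pf => u v _ _; rewrite /K /= /Fg.
have lM : level M M.+1 by rewrite /level leqnn.
by rewrite lM /= (FE tS tM) // /dT tM subrr addr0 /psi heat0.
Qed.

Lemma density_pfB : density T M t x = Cnorm N T (t 1%N) * pfB N K (allp 1 M.+1).
Proof.
rewrite /pfB pf_level; last by rewrite size_map size_iota.
rewrite dt_border pf_levels add1n pf_last.
rewrite /density (eq_bigr (fun m : 'I_M => dt K (two m.+2) (one m.+1))); last first.
  by move=> m _; rewrite dt_step.
rewrite (eq_bigr (fun m : 'I_M => dt K (two m.+2) (one m.+1))) //.
move: (Cnorm _ _ _) (hN _) (Num.sg _) (\prod_(i < N) _) (\prod_(m < M) _) => a b c d e.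
by ring.
Qed.

End Density.

(** * Sorting the configuration into visible and hidden particles, and counting them *)

Section Reindex.
Context {R : realType}.
Variables (N : nat) (Nm : nat -> nat).
Implicit Types (z : nat -> R) (ms : seq nat).

Lemma offsS m : (0 < m)%N -> offs N Nm m.+1 = (offs N Nm m + (N - Nm m))%N.
Proof. by move=> m0; rewrite /offs big_nat_recr. Qed.

Lemma eq_hid ms z z' : z =1 z' -> hid ms z = hid ms z'.
Proof.
elim: ms z z' => //= m ms IH z z' zz; rewrite zz; congr (_ :: _).
by apply: IH => k; rewrite zz.
Qed.

Lemma hid_cat ms ms' z : hid (ms ++ ms') z = hid ms z ++ hid ms' (fun k => z (size ms + k)%N).
Proof.
by elim: ms z => [|m ms IH] z //=; rewrite IH; congr (_ :: _ ++ _); apply: eq_hid => k.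
Qed.

Lemma hid_nseq k m z : hid (nseq k m) z = [seq (m, z i) | i <- iota 0 k].
Proof.
elim: k z => //= k IH z; rewrite IH; congr (_ :: _).
by rewrite -[1%N]addn0 iotaDl -map_comp.
Qed.

Definition hlev a k := flatten [seq nseq (N - Nm m) m | m <- iota a k].

Lemma size_hlev a k : (0 < a)%N -> offs N Nm (a + k) = (offs N Nm a + size (hlev a k))%N.
Proof.
elim: k a => [|k IH] a a0; first by rewrite !addn0.
by rewrite addnS -addSn IH // offsS // -addnA /hlev /= size_cat size_nseq.
Qed.

Definition vis (xs : nat -> nat -> R) a k :=
  flatten [seq [seq (m, xs m i) | i <- iota 0 (Nm m)] | m <- iota a k].

(** Levels interleave visible and hidden particles; the equality is only up to order, which
    [pfB_perm] allows. *)
Lemma allp_fullconf (xs : nat -> nat -> R) z a k : (0 < a)%N ->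
  (forall m, (a <= m < a + k)%N -> (Nm m <= N)%N) ->
  perm_eq (allp (N := N) (fullconf (N := N) Nm xs z) a k)
          (vis xs a k ++ hid (hlev a k) (fun j => z (offs N Nm a + j)%N)).
Proof.
elim: k a => [|k IH] a a0 le //.
have E : levp (fullconf (N := N) Nm xs z) a = [seq (a, xs a i) | i <- iota 0 (Nm a)] ++
    hid (nseq (N - Nm a) a) (fun j => z (offs N Nm a + j)%N).
  have la : (Nm a <= N)%N by apply: le; rewrite leqnn addnS ltnS leq_addr.
  pose g i := if (i < Nm a)%N then xs a i else z (offs N Nm a + (i - Nm a))%N.
  have -> : levp (fullconf (N := N) Nm xs z) a = [seq (a, g i) | i <- iota 0 N].
    by rewrite -val_enum_ord -map_comp.
  rewrite -{1}(subnKC la) iotaD map_cat add0n; congr (_ ++ _).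
    by apply/eq_in_map => i; rewrite mem_iota /g => /andP[_ ->].
  have -> : iota (Nm a) (N - Nm a) = [seq (Nm a + i)%N | i <- iota 0 (N - Nm a)].
    by rewrite -iotaDl addn0.
  rewrite hid_nseq -map_comp.
  by apply/eq_map => i /=; rewrite /g ltnNge leq_addr addKn.
rewrite /allp /vis /hlev /= -/(allp _ _ _) -/(vis _ _ _) -/(hlev _ _) E hid_cat -!catA perm_cat2l.
rewrite perm_sym perm_catCA perm_cat2l perm_sym size_nseq.
apply: perm_trans (IH a.+1 isT _) _.
  by move=> m /andP[am mk]; apply: le; rewrite (ltnW am) addnS -addSn.
rewrite perm_cat2l; suff -> : hid (hlev a.+1 k) (fun j => z (offs N Nm a.+1 + j)%N) =
  hid (hlev a.+1 k) (fun j => z (offs N Nm a + (N - Nm a + j))%N) by [].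
by apply: eq_hid => j; rewrite offsS // addnA.
Qed.

End Reindex.

Section Counting.
Context {R : realType}.
Variables (N : nat) (Nm : nat -> nat).

Lemma lvl_vis (xs : nat -> nat -> R) a k m : (a <= m < a + k)%N ->
  lvl (vis Nm xs a k) m = Nm m.
Proof.
have lvl_nseq b : lvl [seq (b, xs b i) | i <- iota 0 (Nm b)] m = ((b == m) * Nm b)%N.
  rewrite /lvl /unzip1 -map_comp count_map; have [->|bm] := eqVneq b m.
    by rewrite mul1n -[RHS](size_iota 0) -count_predT; apply: eq_count => i /=; exact: eqxx.
  by apply/eqP; rewrite mul0n -leqn0 leqNgt -has_count; apply/hasPn => i _ /=.
have visS b j : lvl (vis Nm xs b j.+1) m = ((b == m) * Nm b + lvl (vis Nm xs b.+1 j) m)%N.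
  by rewrite -lvl_nseq /lvl /vis /= /unzip1 map_cat count_cat.
have lvl0 b j : (m < b)%N -> lvl (vis Nm xs b j) m = 0%N.
  by elim: j b => // j IH b mb; rewrite visS gtn_eqF // IH // ltnW.
elim: k a => [|k IH] a; first by lia.
rewrite visS => /andP[am mk]; have [am'|am'] := eqVneq a m.
  by rewrite lvl0 am' ?mul1n ?addn0.
by rewrite mul0n add0n; apply: IH; rewrite ltn_neqAle am' am addSn -addnS.
Qed.

(** Starting from [N_m] visible particles at level [m], the factors run down from [N - N_m] to 1. *)
Lemma cf_hlev (c : nat -> nat) a k :
  (forall m, (a <= m < a + k)%N -> c m = Nm m /\ (Nm m <= N)%N) ->
  cf N c (hlev N Nm a k) = \prod_(a <= m < a + k) ((N - Nm m)`!)%:R :> R.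
Proof.
elim: k a c => [|k IH] a c H; first by rewrite addn0 big_geq.
have [ca la] : c a = Nm a /\ (Nm a <= N)%N by apply: H; rewrite leqnn addnS ltnS leq_addr.
rewrite /hlev /= -/(hlev N Nm a.+1 k) cf_nseq; last by rewrite ca subnKC.
rewrite addnS -addSn big_ltn ?addSn ?ltnS ?leq_addr // -addSn IH // => m /andP[am mk].
rewrite ltn_eqF // mul0n add0n; apply: H; rewrite (ltnW am) addnS -addSn //.
Qed.

End Counting.

Lemma enum_tagged_perm (n : nat) (c : nat -> nat) :
  perm_eq [seq (nat_of_ord (tag u), nat_of_ord (tagged u)) | u <- enum {: {m : 'I_n & 'I_(c m)}}]
          (flatten [seq [seq (m, i) | i <- iota 0 (c m)] | m <- iota 0 n]).
Proof.
apply: uniq_perm.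
- rewrite map_inj_uniq ?enum_uniq // => -[m i] [m' i'] /= [] /val_inj em.
  by case: _ / em i' => i' /val_inj ->.
- apply: allpairs_uniq_dep => [|m _|]; rewrite ?iota_uniq //.
  by move=> [m i] [m' i'] _ _ /= [-> ->].
move=> [m i]; apply/mapP/allpairsPdep => /=.
  case=> -[a b] _ [-> ->]; exists (nat_of_ord a), (nat_of_ord b).
  by rewrite !mem_iota !add0n !ltn_ord.
case=> [a [b [+ + [-> ->]]]]; rewrite !mem_iota !add0n /= => an bc.
by exists (Tagged (fun m : 'I_n => 'I_(c m)) (Ordinal bc : 'I_(c (Ordinal an)))); rewrite ?mem_enum.
Qed.

Theorem theorem3 (R : realType) (N : nat) (T : R) (M : nat) (t : nat -> R)
  (Nm : nat -> nat) (xs : nat -> nat -> R) :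
  ~~ odd N -> (0 < N)%N -> 0 < T -> (1 <= M)%N ->
  t 0%N = 0 -> (forall m, (m <= M)%N -> t m < t m.+1) -> t M.+1 = T ->
  (forall m, (1 <= m <= M.+1)%N -> (0 < Nm m <= N)%N) ->
  corr N T M t Nm xs = Tdet (Qmat N T M t Nm xs).
Proof.
move=> N2 _ _ M1 t00 tS tM HN.
have KN := KA_anti M1 t00 tS tM.
have t1 := t1_gt0 t00 tS; have t1T := t1_ltT M1 tS tM.
have NE : N = N./2.*2 by rewrite even_halfK.
have leN m : (1 <= m < 1 + M.+1)%N -> (Nm m <= N)%N by move=> /HN /andP[].
pose K := KA T t M; pose obs := vis Nm xs 1 M.+1.
pose I : finType := Qidx M Nm.
pose f (u : I) : nat * R := ((tag u).+1, xs (tag u).+1 (tagged u)).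
have lf u : level M (f u).1 by case: u => a b; exact: ltn_ord a.
have obsE : perm_eq obs [seq f u | u <- enum I].
  pose g (p : nat * nat) := (p.1.+1, xs p.1.+1 p.2).
  have -> : obs = map g (flatten [seq [seq (m, i) | i <- iota 0 (Nm m.+1)] | m <- iota 0 M.+1]).
    rewrite /obs /vis map_flatten -map_comp -[1%N]addn0 iotaDl -map_comp.
    by congr flatten; apply: eq_map => m /=; rewrite -map_comp.
  have -> : [seq f u | u <- enum I] =
      map g [seq (nat_of_ord (tag u), nat_of_ord (tagged u)) | u <- enum I].
    by rewrite -map_comp.
  rewrite perm_sym; have H := @enum_tagged_perm M.+1 (fun m => Nm m.+1).
  exact: (perm_map g H).
have lo : lev_pts M obs.
  by move=> p; rewrite (perm_mem obsE) => /mapP[u _ ->].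
have lms m : m \in hlev N Nm 1 M.+1 -> level M m.
  case/flattenP => s /mapP[l]; rewrite mem_iota => lM -> /nseqP[-> _] //.
have sz : offs N Nm M.+2 = size (hlev N Nm 1 M.+1).
  by rewrite -[M.+2]add1n size_hlev // /offs big_geq.
(* Integrating out the hidden particles gives the factorials that [corr] divides by, leaving the
   bordered Pfaffian of the observed ones. *)
have -> : corr N T M t Nm xs = Cnorm N T (t 1%N) * pfB N K obs.
  rewrite /corr sz; have -> : iint (size (hlev N Nm 1 M.+1))
      (fun z => density T M t (fullconf (N := N) Nm xs z)) =
    iint (size (hlev N Nm 1 M.+1))
      (fun z => Cnorm N T (t 1%N) * pfB N K (obs ++ hid (hlev N Nm 1 M.+1) z)).
    apply: eq_iint => z; rewrite (density_pfB M1 t00 tS tM) //; congr (_ * _).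
    apply: (pfB_perm N KN); apply: perm_trans (allp_fullconf xs z _ leN) _ => //.
    suff -> : hid (hlev N Nm 1 M.+1) (fun j => z (offs N Nm 1 + j)%N) =
      hid (hlev N Nm 1 M.+1) z by [].
    by apply: eq_hid => j; rewrite /offs big_geq.
  rewrite (iint_pfB M1 t00 tS tM) // (cf_hlev (Nm := Nm)); last first.
    by move=> m ml; split; [exact: lvl_vis|exact: leN].
  rewrite mulrCA mulKf //.
  by rewrite prodf_seq_neq0; apply/allP => m _; rewrite pnatr_eq0 -lt0n fact_gt0.
(* The pivots [r_k] of the elimination cancel against the normalising constant. *)
rewrite (pfB_perm N KN obsE) NE (Cnorm_rj t1 t1T) (pfB_schur M1 t00 tS tM) mulrA -big_split /=.
rewrite big1 ?mul1r; last by move=> k _; rewrite mulVf // gt_eqF // rj_gt0.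
rewrite Tdet_TdS -NE.
have -> : [set: I]%SET = [set u in enum I]%SET.
  by apply/finset.setP => u; rewrite !inE mem_enum.
(* The entries of [Qmat] are the twisted blocks of the reduced kernel, so [TdS_pf] turns the
   quaternion determinant into its Pfaffian. *)
rewrite (eq_TdS (Q' := QofB (fun u => inr (false, f u)) (fun u => inr (true, f u)) (KS T t M N./2))).
  by rewrite (TdS_pf _ _ (KS_anti M1 t00 tS tM N./2) (enum_uniq I)) /pts /prs -map_comp.
by move=> z w; rewrite KS_qmat.
Qed.
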